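(* Let $A\ge0$ be a self-adjoint operator in a Hilbert space $\mathcal H$, and let $\mathfrak b$ be a symmetric sesquilinear form on $\mathrm{Dom}[\mathfrak b]=\mathrm{Dom}(A^{1/2})$ given in one of the two settings (G) (general) or (O) (off-diagonal) described in the context. Let $B$ be the self-adjoint operator associated with $\mathfrak b$. Fix $s\in\{-1,1\}$ and let $\mathrm{sgn}(B)$ be the unitary sign of $B$ with $\mathrm{sgn}(0)=s$. Then the following statements are equivalent: (i) $\mathrm{Dom}(|B|^{1/2})=\mathrm{Dom}(A^{1/2})$; (ii) $\mathrm{Dom}(|B|^{1/2})\supseteq\mathrm{Dom}(A^{1/2})$; (ii') $\mathrm{Dom}(|B|^{1/2})\subseteq\mathrm{Dom}(A^{1/2})$; (iii) $X:=(A+I)^{-1/2}|B+\mathrm{sgn}(B)|(A+I)^{-1/2}$ is a bounded symmetric operator on $\mathrm{Dom}(X):=(A+I)^{1/2}\mathrm{Dom}(B)$; (iii') $Y:=(A+I)^{1/2}|B+\mathrm{sgn}(B)|^{-1}(A+I)^{1/2}$ is a bounded symmetric operator on $\mathrm{Dom}(Y):=\mathrm{Dom}(A^{1/2})$; (iv) $K:=(A+I)^{1/2}\mathrm{sgn}(B)(A+I)^{-1/2}$ is a bounded involution on $\mathcal H$; (v) $\mathrm{sgn}(B)\,\mathrm{Dom}(A^{1/2})\subseteq\mathrm{Dom}(A^{1/2})$.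
   Context: A self-adjoint involution is a bounded self-adjoint operator $J$ with $J^2=I$; it commutes with a self-adjoint operator $A$ if $J\,\mathrm{Dom}(A)\subseteq\mathrm{Dom}(A)$ and $JAx=AJx$ for all $x\in\mathrm{Dom}(A)$. In (iv), ''involution'' means a (not necessarily self-adjoint) operator with $K^2=I$, defined on all of $\mathcal H$; $K$ is taken on its natural domain. Setting (G): $H$ is a bounded, boundedly invertible self-adjoint operator on $\mathcal H$, and there is a self-adjoint involution $J_A\ne\pm I$ commuting with $A$ such that, with $P_A:=\frac12(I+J_A)$ and $P_A^\bot:=I-P_A$, one has $P_AHP_A\ge\alpha P_A$ and $P_A^\bot HP_A^\bot\le-\alpha P_A^\bot$ for some $\alpha\in(0,1]$; the form is $\mathfrak b[x,y]:=\langle A^{1/2}x,HA^{1/2}y\rangle$ on $\mathrm{Dom}[\mathfrak b]=\mathrm{Dom}(A^{1/2})$. Setting (O): $J_A$ is a self-adjoint involution commuting with $A$; $\mathfrak v$ is a symmetric sesquilinear form with $\mathrm{Dom}[\mathfrak v]\supseteq\mathrm{Dom}(A^{1/2})$, $|\mathfrak v[x,x]|\le\beta\|(A+I)^{1/2}x\|^2$ for a finite constant $\beta$ and all $x\in\mathrm{Dom}(A^{1/2})$, and $\mathfrak v[J_Ax,y]=-\mathfrak v[x,J_Ay]$ for all $x,y\in\mathrm{Dom}(A^{1/2})$; the form is $\mathfrak b[x,y]:=\langle A^{1/2}x,A^{1/2}J_Ay\rangle+\mathfrak v[x,y]$ on $\mathrm{Dom}[\mathfrak b]=\mathrm{Dom}(A^{1/2})$.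 In both settings there exists a unique self-adjoint operator $B$ with $\mathrm{Dom}(B)\subseteq\mathrm{Dom}[\mathfrak b]$ and $\mathfrak b[x,y]=\langle x,By\rangle$ for all $x\in\mathrm{Dom}[\mathfrak b]$, $y\in\mathrm{Dom}(B)$; this is the operator associated with $\mathfrak b$. The unitary sign function is $\mathrm{sgn}(x)=-1$ for $x<0$, $\mathrm{sgn}(0)=s$, $\mathrm{sgn}(x)=1$ for $x>0$, and $\mathrm{sgn}(B)$ is defined by functional calculus; the operator $B+\mathrm{sgn}(B)$ is boundedly invertible. *)

(* Defs.v *)
From HB Require Import structures.
From mathcomp Require Import all_boot all_order all_algebra sesquilinear.
From mathcomp Require Import complex.
From mathcomp Require Import all_classical all_reals all_analysis.

Set Implicit Arguments.
Unset Strict Implicit.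
Unset Printing Implicit Defensive.

Import Order.TTheory GRing.Theory Num.Theory numFieldNormedType.Exports.

Local Open Scope classical_set_scope.
Local Open Scope ring_scope.
Local Open Scope complex_scope.

(* As for every MathComp form, the inner product is linear in its first
   argument and antilinear in its second one. *)
HB.mixin Record isHilbert (R : realType) V & CompleteNormedModule R[i] V := {
  inner : {dot V for Num.Def.conjC} ;
  inner_normE : forall x : V, `|x| ^+ 2 = inner x x }.

#[short(type="hilbertType")]
HB.structure Definition Hilbert (R : realType) :=
  { V of CompleteNormedModule R[i] V & isHilbert R V }.

Notation "''[' x , y ]" := (inner x y) : ring_scope.

Definition subspace (K : nzRingType) (U : lmodType K) (D : set U) :=
  D 0 /\ forall a x y, D x -> D y -> D (a *: x + y).

Section Operators.
Context (R : realType) (V : hilbertType R).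

(* A possibly unbounded, partially defined operator is given by its graph:
   T (x, y) means that x is in the domain of T and T x = y. *)
Definition op := set (V * V).

Implicit Types (T : op) (D : set V).

Definition linear_op T :=
  subspace T /\ forall x y z, T (x, y) -> T (x, z) -> y = z.

Definition dom T : set V := [set x | exists y, T (x, y)].

(* the value T x, when x is in dom T *)
Definition app T (x : V) : V := xget 0 [set y | T (x, y)].

Definition graph_of (f : V -> V) : op := [set p | p.2 = f p.1].
Definition op_id : op := graph_of id.
Definition op_add (S T : op) : op :=
  [set p | exists y z, [/\ S (p.1, y), T (p.1, z) & p.2 = y + z]].
Definition op_comp (S T : op) : op :=
  [set p | exists y, T (p.1, y) /\ S (y, p.2)].
Definition op_inv T : op := [set p | T (p.2, p.1)].
Definition op_restrict T D : op := [set p | T p /\ D p.1].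

Definition adjoint T : op :=
  [set p | forall x y, T (x, y) -> '[y, p.1] = '[x, p.2]].

Definition selfadjoint T :=
  [/\ linear_op T, dense (dom T) & T = adjoint T].

Definition symmetric_op T :=
  [/\ linear_op T, dense (dom T) & T `<=` adjoint T].

Definition op_ge0 T := forall x y, T (x, y) -> 0 <= '[y, x].

Definition op_bounded T :=
  linear_op T /\ exists M : R, forall x y, T (x, y) -> `|y| <= M%:C * `|x|.

Definition everywhere_bounded T := op_bounded T /\ dom T = setT.

Definition boundedly_invertible T := everywhere_bounded (op_inv T).

Definition projection_valued_measure (E : set R -> {linear V -> V}) :=
  [/\ forall S, measurable S -> forall x, E S (E S x) = E S x,
      forall S, measurable S -> forall x y, '[E S x, y] = '[x, E S y],
      forall x, E setT x = x
    & forall F : (set R)^nat, (forall n, measurable (F n)) ->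
        trivIset setT F -> forall x,
        \sum_(0 <= k < n) E (F k) x @[n --> \oo] --> E (\bigcup_n F n) x].

Section SpectralIntegral.
Variables (E : set R -> {linear V -> V}) (f : R -> R).

(* The set function <E(.) x, x> is a finite measure on Borel sets. *)
Definition spectral_mass (x : V) : set R -> \bar R :=
  fun S => (complex.Re '[E S x, x])%:E.

Definition spectral_dom : set V :=
  [set x | (\int[spectral_mass x]_t ((f t) ^+ 2)%:E < +oo)%E].

(* The integral of f with respect to the complex measure <E(.) x, z>, which is
   expressed through finite positive measures by polarization. *)
Definition spectral_form (x z : V) : R[i] :=
  4^-1 * \sum_(k < 4) 'i ^+ k *
    (fine (\int[spectral_mass (x + 'i ^+ k *: z)%R]_t (f t)%:E)%E)%:C.

(* Since spectral_dom is dense, the second condition determines p.2. *)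
Definition spectral_integral : op :=
  [set p | spectral_dom p.1 /\
     forall z, spectral_dom z -> '[p.2, z] = spectral_form p.1 z].

End SpectralIntegral.

Definition spectral_measure_of T (E : set R -> {linear V -> V}) :=
  projection_valued_measure E /\ T = spectral_integral E id.

(* f(T), for a self-adjoint T: by the spectral theorem there is an E as below,
   and it is unique on Borel sets. *)
Definition op_fun (f : R -> R) T : op :=
  [set p | exists2 E, spectral_measure_of T E & spectral_integral E f p].

Definition op_sqrt T : op := op_fun Num.sqrt T.
Definition op_abs T : op := op_fun (fun t => `|t|) T.

Definition unitary_sign (s t : R) : R :=
  if t < 0 then -1 else if t == 0 then s else 1.
Definition op_sgn (s : R) T : op := op_fun (unitary_sign s) T.

(* Sesquilinear forms with a domain; the values of fval outside of fdom are
   irrelevant. *)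
Record sform := SForm { fdom : set V; fval :> V -> V -> R[i] }.

Definition is_sesquilinear (b : sform) :=
  [/\ subspace (fdom b),
      forall a x y z, fdom b x -> fdom b y -> fdom b z ->
        b (a *: x + y) z = a * b x z + b y z
    & forall a x y z, fdom b x -> fdom b y -> fdom b z ->
        b x (a *: y + z) = Num.Def.conjC a * b x y + b x z].

Definition is_symmetric_form (b : sform) :=
  is_sesquilinear b /\
  forall x y, fdom b x -> fdom b y -> b x y = Num.Def.conjC (b y x).

Definition associated_op (b : sform) (B : op) :=
  [/\ selfadjoint B, dom B `<=` fdom b
    & forall x y, fdom b x -> dom B y -> b x y = '[x, app B y]].

Definition selfadjoint_involution (J : {linear V -> V}) :=
  [/\ everywhere_bounded (graph_of J), selfadjoint (graph_of J)
    & forall x, J (J x) = x].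

Definition commutes_with (J : V -> V) (A : op) :=
  forall x, dom A x -> dom A (J x) /\ J (app A x) = app A (J x).

Definition setting_G (A : op) (b : sform) :=
  exists (H J : {linear V -> V}) (alpha : R),
    let P x := 2^-1 *: (x + J x) in
    let Pbot x := x - P x in
    [/\ [/\ everywhere_bounded (graph_of H), selfadjoint (graph_of H)
          & boundedly_invertible (graph_of H)],
        [/\ selfadjoint_involution J, commutes_with J A,
            ~ (forall x, J x = x) & ~ (forall x, J x = - x)],
        0 < alpha <= 1,
        (forall x, alpha%:C * '[P x, x] <= '[P (H (P x)), x]) /\
        (forall x, '[Pbot (H (Pbot x)), x] <= - alpha%:C * '[Pbot x, x])
      & fdom b = dom (op_sqrt A) /\
        forall x y, fdom b x -> fdom b y ->
          b x y = '[app (op_sqrt A) x, H (app (op_sqrt A) y)]].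

Definition setting_O (A : op) (b : sform) :=
  exists (J : {linear V -> V}) (v : sform) (beta : R),
    [/\ selfadjoint_involution J /\ commutes_with J A,
        is_symmetric_form v /\ dom (op_sqrt A) `<=` fdom v,
        forall x, dom (op_sqrt A) x ->
          `|v x x| <= beta%:C * `|app (op_sqrt (op_add A op_id)) x| ^+ 2,
        forall x y, dom (op_sqrt A) x -> dom (op_sqrt A) y ->
          v (J x) y = - v x (J y)
      & fdom b = dom (op_sqrt A) /\
        forall x y, fdom b x -> fdom b y ->
          b x y = '[app (op_sqrt A) x, app (op_sqrt A) (J y)] + v x y].

End Operators.

Arguments op_id {R V}.

(* Main.v *)
Require Import Defs.
From HB Require Import structures.
From mathcomp Require Import all_boot all_order all_algebra sesquilinear.
From mathcomp Require Import complex.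
From mathcomp Require Import all_classical all_reals all_analysis.
From mathcomp Require Import measurable_realfun ring lra.

(** Write S := sgn B, M := |B + S|^(-1/2), L := (A + 1)^(-1/2).  Then
    (B + S)^-1 = S M^2, the domain of |B|^(1/2) is the range of M and the domain
    of A^(1/2) is the range of L.  So every statement is about the bounded
    self-adjoint operators L, M, S, and each of them turns out to be equivalent
    to an estimate |L S z| <= k |L z| ([sign_bound]).

    What ties B to A is a factorisation S M^2 = L F L in which F is bounded with
    a bounded inverse ([sandwich_factor]).  In both settings b + <., J .>, for J
    the involution commuting with A, is carried by L to a form <u, H w> on the
    whole space, and H is bounded from below because J separates the positive
    part of the form from the negative one ([reduce_G], [reduce_O]); hence
    (B + J)^-1 = L H^-1 L.  Since S - J is bounded, two applications of the
    resolvent identity replace J by S and keep a factor L on either side.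

    Given S M^2 = L F L, the rest is Douglas' lemma, by which an inclusion of
    ranges is an inequality between adjoints.  If L = M W then M = S W F L, so one
    inclusion between the ranges of L and M entails the other one ([rangeLM],
    [rangeML]); if the ranges agree, S maps the range of L to itself because S
    commutes with M, and this is the estimate; conversely
    |M x|^2 = <F L x, L S x> <= k |F| |L x|^2 ([rangeML_sign]).  Finally X maps
    F L z to L S z, Y maps L z to F L S z, and K maps x to y when S L x = L y, so
    that their boundedness is the estimate once more.

    To identify L, M and S with functions of A and B one needs the spectral
    theorem and a calculus.  The calculus is based on the relation [local]: y is
    f(T) x exactly when |E_Q y - v E_Q x| <= e |E_Q x| for all Borel sets Q and
    numbers v, e with |f - v| <= e on Q.  Sums, products and quotients of
    functions are then treated on the pieces of a fine partition, and
    [spectral_integralP] connects the relation to integrals.  The spectral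
    measure of T itself is built from c = (1 + T^2)^-1 and a = T c, which come
    from the orthogonal projection onto the graph of T
    ([resolvent_pair_exists]).  The projection P_l of ]l, oo[ has to be the one
    onto the positive part of a - l c ([spectral_pos_proj]).  It is a limit
    of polynomials in a - l c ([pos_proj_exists]) and is characterised by
    positivity ([pos_proj_unique]), which yields uniqueness of E; for existence the monotone
    functions l |-> |x|^2 - <P_l x, x> are turned into Stieltjes measures, which
    extend P_l to Borel sets ([spectral_theorem]). *)


Set Implicit Arguments.
Unset Strict Implicit.
Unset Printing Implicit Defensive.

Import Order.TTheory GRing.Theory Num.Theory numFieldNormedType.Exports.

Local Open Scope classical_set_scope.
Local Open Scope ring_scope.

(** * Real inner product and sequential convergence *)

Section RealInner.
Context (R : realType) (V : hilbertType R).
Implicit Types (x y z : V) (r : R) (a : R[i]).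

Definition ip x y : R := complex.Re '[x, y].
Definition nm x : R := Num.sqrt (ip x x).

Lemma innerC x y : '[y, x] = ('[x, y]^*)%C.
Proof. by rewrite hermC/= expr0 mul1r. Qed.

Lemma innerZl a x y : '[a *: x, y] = a * '[x, y].
Proof. by rewrite linearZl_LR. Qed.

Lemma innerZr a x y : '[x, a *: y] = (a^*)%C * '[x, y].
Proof. by rewrite linearZr_LR. Qed.

Lemma ipC x y : ip x y = ip y x.
Proof. by rewrite /ip (innerC x y); case: ('[x, y]). Qed.

Lemma ipDl x y z : ip (x + y) z = ip x z + ip y z.
Proof. by rewrite /ip linearDl raddfD. Qed.

Lemma ipDr x y z : ip z (x + y) = ip z x + ip z y.
Proof. by rewrite ipC ipDl !(ipC z). Qed.

Lemma ipNl x y : ip (- x) y = - ip x y.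
Proof. by rewrite /ip linearNl raddfN. Qed.

Lemma ipNr x y : ip x (- y) = - ip x y.
Proof. by rewrite ipC ipNl ipC. Qed.

Lemma Re_realM r (u : R[i]) : complex.Re (r%:C%C * u) = r * complex.Re u.
Proof. by case: u => p q /=; rewrite mul0r subr0. Qed.

Lemma ipZl r x y : ip (r%:C%C *: x) y = r * ip x y.
Proof. by rewrite /ip innerZl Re_realM. Qed.

Lemma ipZr r x y : ip x (r%:C%C *: y) = r * ip x y.
Proof. by rewrite ipC ipZl ipC. Qed.

Lemma ip0l x : ip 0 x = 0.
Proof. by rewrite /ip linear0l. Qed.

Lemma ip0r x : ip x 0 = 0.
Proof. by rewrite ipC ip0l. Qed.

Definition ipE := (ipDl, ipDr, ipNl, ipNr, ipZl, ipZr, ip0l, ip0r).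

Lemma normE2 x : `|x| ^+ 2 = (ip x x)%:C%C.
Proof.
have := inner_normE x; have n0 : 0 <= `|x| by [].
move/ger0_Im: n0; rewrite /ip; case: `|x| => p q /= -> <-.
by rewrite expr2; simpc.
Qed.

Lemma ip_ge0 x : 0 <= ip x x.
Proof. by rewrite -lecR -normE2 exprn_ge0. Qed.

Lemma nm_ge0 x : 0 <= nm x.
Proof. exact: sqrtr_ge0. Qed.

Lemma nm2 x : nm x ^+ 2 = ip x x.
Proof. by rewrite sqr_sqrtr ?ip_ge0. Qed.

Lemma normE x : `|x| = (nm x)%:C%C.
Proof.
apply/eqP; rewrite -(@eqrXn2 _ 2) ?ler0c ?nm_ge0//.
by rewrite normE2 -nm2 rmorphXn.
Qed.

Lemma ip_eq0 x : ip x x = 0 -> x = 0.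
Proof.
move=> h; apply/eqP; rewrite -normr_eq0 normE /nm h sqrtr0.
by rewrite eqxx.
Qed.

Lemma nm0 : nm 0 = 0.
Proof. by rewrite /nm ip0l sqrtr0. Qed.

Lemma nm_eq0 x : nm x = 0 -> x = 0.
Proof. by move=> h; apply: ip_eq0; rewrite -nm2 h expr0n. Qed.

Lemma nmD x y : nm (x + y) <= nm x + nm y.
Proof. by rewrite -lecR rmorphD/= -!normE ler_normD. Qed.

Lemma nmN x : nm (- x) = nm x.
Proof. by rewrite /nm ipNl ipNr opprK. Qed.

Lemma nmZ r x : nm (r%:C%C *: x) = `|r| * nm x.
Proof.
rewrite /nm ipZl ipZr mulrA -expr2 sqrtrM ?sqr_ge0//.
by rewrite sqrtr_sqr.
Qed.

Lemma nmB x y : nm (x - y) = nm (y - x).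
Proof. by rewrite -nmN opprB. Qed.

Lemma nm_tri z x y : nm (x - y) <= nm (x - z) + nm (z - y).
Proof. by apply: le_trans (nmD _ _); rewrite addrA subrK. Qed.

Lemma ip_cauchy_schwarz x y : `|ip x y| <= nm x * nm y.
Proof.
have [y0|y0] := eqVneq (ip y y) 0.
  by rewrite (ip_eq0 y0) ip0r nm0 mulr0 normr0.
have yp : 0 < ip y y by rewrite lt_neqAle eq_sym y0 ip_ge0.
rewrite -(@ler_pXn2r _ 2) ?nnegrE ?mulr_ge0 ?nm_ge0//.
rewrite real_normK ?num_real// exprMn !nm2.
have := ip_ge0 ((ip y y)%:C%C *: x - (ip x y)%:C%C *: y).
rewrite !ipE (ipC y x) => h.
rewrite -subr_ge0 -(pmulr_rge0 _ yp).
by apply: le_trans h _; rewrite le_eqVlt; apply/orP; left; apply/eqP; ring.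
Qed.

Lemma ip_le x y : ip x y <= nm x * nm y.
Proof. exact: le_trans (ler_norm _) (ip_cauchy_schwarz _ _). Qed.

Lemma innerE x y : '[x, y] = (ip x y +i* ip x ('i%C *: y))%C.
Proof.
rewrite /ip innerZr; case: '[x, y] => p q /=.
by congr (_ +i* _)%C; rewrite mul0r sub0r mulN1r opprK.
Qed.

Lemma ip_inj x y : (forall z, ip z x = ip z y) -> x = y.
Proof.
move=> h; apply/eqP; rewrite -subr_eq0; apply/eqP/ip_eq0.
by rewrite ipDr ipNr h subrr.
Qed.

Lemma rscaleDl r s x : (r + s)%:C%C *: x = r%:C%C *: x + s%:C%C *: x.
Proof. by rewrite rmorphD/= scalerDl. Qed.

Lemma rscaleA r s x : r%:C%C *: (s%:C%C *: x) = (r * s)%:C%C *: x.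
Proof. by rewrite scalerA rmorphM. Qed.

Definition cvs (u : nat -> V) (l : V) :=
  forall e : R, 0 < e -> exists N, forall n, (N <= n)%N -> nm (u n - l) < e.

Lemma cvsP (u : nat -> V) l : cvs u l <-> u @ \oo --> l.
Proof.
split=> h.
  apply/cvgrPdist_lt => e e0.
  have er : (complex.Re e)%:C%C = e by apply: RRe_real; apply: gtr0_real.
  have [|N hN] := h (complex.Re e); first by rewrite -ltcR er.
  exists N => // n /= Nn; rewrite distrC normE -er ltcR.
  exact: hN.
move=> e e0.
move/cvgrPdist_lt: h => /(_ e%:C%C).
rewrite ltcR => /(_ e0) [N _ hN]; exists N => n Nn.
by have := hN n Nn; rewrite /= distrC normE ltcR.
Qed.

Lemma cauchy_cvs (u : nat -> V) :
  (forall e : R, 0 < e -> exists N, forall m n, (N <= m)%N -> (N <= n)%N ->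
     nm (u m - u n) < e) -> exists l, cvs u l.
Proof.
move=> h; suff : cvgn u by move=> c; exists (limn u); apply/cvsP.
apply/cauchy_cvgP/cauchy_exP => e e0.
have er : (complex.Re e)%:C%C = e by apply: RRe_real; apply: gtr0_real.
have [|N hN] := h (complex.Re e); first by rewrite -ltcR er.
exists (u N); exists N => // n /= Nn.
by rewrite -ball_normE/= normE -er ltcR; exact: hN.
Qed.

Lemma cvs_uniq u l l' : cvs u l -> cvs u l' -> l = l'.
Proof.
move=> h h'; apply/eqP; rewrite -subr_eq0; apply/eqP/nm_eq0.
apply/eqP; rewrite eq_le nm_ge0 andbT; apply/ler_addgt0Pr => e e0; rewrite add0r.
have [|N hN] := h (e / 2); first by rewrite divr_gt0.
have [|N' hN'] := h' (e / 2); first by rewrite divr_gt0.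
apply: le_trans (nm_tri (u (maxn N N')) _ _) _; rewrite nmB.
have := hN (maxn N N') (leq_maxl _ _); have := hN' (maxn N N') (leq_maxr _ _).
lra.
Qed.

Lemma small_eq (r : R) : (forall e, 0 < e -> r <= e) -> r <= 0.
Proof. by move=> h; apply/ler_addgt0Pr => e e0; rewrite add0r; exact: h. Qed.

Lemma cvs_cst l : cvs (fun=> l) l.
Proof. by move=> e e0; exists 0%N => n _; rewrite subrr nm0. Qed.

Lemma cvsD u v l k : cvs u l -> cvs v k -> cvs (fun n => u n + v n) (l + k).
Proof.
move=> hu hv e e0; have e2 : 0 < e / 2 by rewrite divr_gt0.
have [N hN] := hu _ e2; have [N' hN'] := hv _ e2.
exists (maxn N N') => n; rewrite geq_max => /andP[Nn N'n].
rewrite opprD addrACA; apply: le_lt_trans (nmD _ _) _.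
by have := hN n Nn; have := hN' n N'n; lra.
Qed.

Lemma cvsZ (r : R) u l : cvs u l -> cvs (fun n => r%:C%C *: u n) (r%:C%C *: l).
Proof.
move=> hu e e0; have r0 : 0 < `|r| + 1 by rewrite ltr_wpDl.
have [|N hN] := hu (e / (`|r| + 1)); first by rewrite divr_gt0.
exists N => n /hN; rewrite -scalerBr nmZ ltr_pdivlMr// => h.
by apply: le_lt_trans h; rewrite mulrC ler_wpM2l ?nm_ge0// lerDl.
Qed.

Lemma cvsN u l : cvs u l -> cvs (fun n => - u n) (- l).
Proof.
move=> h e e0; have [N hN] := h e e0; exists N => n /hN.
by rewrite -opprD nmN.
Qed.

Lemma cvsB u v l k : cvs u l -> cvs v k -> cvs (fun n => u n - v n) (l - k).
Proof. by move=> hu hv; apply: cvsD => //; apply: cvsN. Qed.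

Lemma cvs_shift u l k : cvs u l -> cvs (fun n => u (n + k)%N) l.
Proof.
move=> h e e0; have [N hN] := h e e0; exists N => n Nn; apply: hN.
by rewrite (leq_trans Nn)// leq_addr.
Qed.

Lemma cvs_nm_le u l (C : R) : cvs u l -> (forall n, nm (u n) <= C) -> nm l <= C.
Proof.
move=> h hC; rewrite -subr_le0; apply: small_eq => e e0.
have [N hN] := h e e0; have := hN N (leqnn _); rewrite nmB => h1.
have := nm_tri (u N) l 0; rewrite !subr0; have := hC N; lra.
Qed.

Lemma cvs_ip u l x (e : R) : cvs u l -> 0 < e ->
  exists N, forall n, (N <= n)%N -> `|ip (u n) x - ip l x| < e.
Proof.
move=> h e0; have x0 : 0 < nm x + 1 by rewrite ltr_wpDl ?nm_ge0.
have [|N hN] := h (e / (nm x + 1)); first by rewrite divr_gt0.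
exists N => n /hN; rewrite ltr_pdivlMr// => h1.
have -> : ip (u n) x - ip l x = ip (u n - l) x by rewrite !ipE.
apply: le_lt_trans (ip_cauchy_schwarz _ _) _; apply: le_lt_trans h1.
by rewrite ler_wpM2l ?nm_ge0// lerDl.
Qed.

Lemma cvs_ip_ge u l x (C : R) : cvs u l -> (forall n, C <= ip (u n) x) ->
  C <= ip l x.
Proof.
move=> h hC; rewrite -subr_le0; apply: small_eq => e e0.
have [N hN] := cvs_ip x h e0; have := hN N (leqnn _).
have := hC N; rewrite ltr_norml => ? /andP[? ?]; lra.
Qed.

Lemma inv_lt (e : R) : 0 < e -> exists N, forall n, (N <= n)%N -> n.+1%:R^-1 < e.
Proof.
move=> e0; exists (Num.truncn e^-1).+1 => n Nn.
rewrite -[e]invrK ltf_pV2 ?posrE ?invr_gt0//.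
apply: lt_trans (truncnS_gt _) _; by rewrite ltr_nat ltnS.
Qed.

(** A bounded monotone sequence of reals is Cauchy, and it controls the
    increments of u. *)
Lemma monotone_cvs (u : nat -> V) (s : nat -> R) (K : R) :
  (forall m n, (m <= n)%N -> ip (u n - u m) (u n - u m) <= s n - s m) ->
  (forall n, s n <= K) -> exists l, cvs u l.
Proof.
move=> us sK.
have snd m n : (m <= n)%N -> s m <= s n.
  by move=> mn; rewrite -subr_ge0; apply: le_trans (us _ _ mn); exact: ip_ge0.
have hs : has_sup (range s).
  by split; [exists (s 0%N); exists 0%N|exists K => _ [n _ <-]; exact: sK].
apply: cauchy_cvs => e e0; have e2 : 0 < e ^+ 2 by rewrite exprn_gt0.
have [_ [N _ <-] hN] := sup_adherent e2 hs; exists N.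
have base m n : (N <= m)%N -> (m <= n)%N -> nm (u n - u m) < e.
  move=> Nm mn; rewrite -(@ltr_pXn2r _ 2) ?nnegrE ?nm_ge0 ?(ltW e0)// nm2.
  apply: le_lt_trans (us _ _ mn) _.
  have h1 : s n <= sup (range s) by apply: ub_le_sup; [exact: (proj2 hs)|exists n].
  by have := snd _ _ Nm; lra.
by move=> m n Nm Nn; have [mn|/ltnW nm'] := leqP m n; [rewrite nmB|]; exact: base.
Qed.

(** The Riesz representation theorem for a form q of which completeness is only
    required through an abstract notion of limit, as it is applied both to V and
    to V x V.  The functional q x x - 2 phi x is bounded below on D; a sequence d
    almost minimising it is Cauchy by the parallelogram law, and phi = q (., d_n)
    in the limit.  D need not be closed, so that the limit may lie outside. *)
Lemma riesz_form (X : lmodType R[i]) (q : X -> X -> R) (D : set X) (phi : X -> R)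
    (M : R) (lim : (nat -> X) -> X -> Prop) :
  (forall x y : X, q x y = q y x) -> (forall x y z : X, q (x + y) z = q x z + q y z) ->
  (forall r (x y : X), q (r%:C%C *: x) y = r * q x y) -> (forall x : X, 0 <= q x x) ->
  (forall d, (forall m n,
     q (d m - d n) (d m - d n) <= 2 * (m.+1%:R^-1 + n.+1%:R^-1)) ->
     exists w, lim d w) ->
  (forall d w (x : X) (e : R), lim d w -> 0 < e ->
     exists N, forall n, (N <= n)%N -> `|q x (d n) - q x w| < e) ->
  D 0 -> (forall r (x y : X), D x -> D y -> D (r%:C%C *: x + y)) ->
  (forall r (x y : X), D x -> D y -> phi (r%:C%C *: x + y) = r * phi x + phi y) ->
  0 <= M -> (forall x : X, D x -> phi x ^+ 2 <= M * q x x) ->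
  exists w, (exists d, (forall n, D (d n)) /\ lim d w) /\
    forall x : X, D x -> phi x = q x w.
Proof.
move=> qC qDl qZl q0 qlim limq D0 DL phiL M0 phiM.
have qDr (x y z : X) : q z (x + y) = q z x + q z y by rewrite qC qDl !(qC z).
have qZr r (x y : X) : q x (r%:C%C *: y) = r * q x y by rewrite qC qZl qC.
pose G (x : X) := q x x - 2 * phi x.
have Glow (x : X) : D x -> - M <= G x.
  move=> Dx; have := phiM x Dx; have := q0 x; rewrite /G.
  move: (q x x) (phi x) => a p a0 pM; rewrite leNgt; apply/negP => h.
  have {}h : a + M < 2 * p by lra.
  have h2 : (a + M) ^+ 2 < (2 * p) ^+ 2 by rewrite ltr_pXn2r ?nnegrE//; lra.
  have := sqr_ge0 (a - M); lra.
have hi : has_inf [set G x | x in D].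
  split; first by exists (G 0); exists 0.
  by exists (- M) => _ [x Dx <-]; exact: Glow.
pose I := inf [set G x | x in D].
have Ile (x : X) : D x -> I <= G x.
  by move=> Dx; apply: (ge_inf (proj2 hi)); exists x.
have dP n : exists x : X, D x /\ G x < I + n.+1%:R^-1.
  have n0 : 0 < n.+1%:R^-1 :> R by rewrite invr_gt0.
  by have [_ [x Dx <-] h] := inf_adherent n0 hi; exists x.
have [d dD] := choice dP.
have [|w dw] := qlim d.
  move=> m n; have [Dm Gm] := dD m; have [Dn Gn] := dD n.
  have Dh : D (2^-1%:C%C *: d m + (2^-1%:C%C *: d n + 0)) by apply: (DL) => //; apply: (DL).
  have := Ile _ Dh; rewrite addr0 /G.
  have -> : phi (2^-1%:C%C *: d m + 2^-1%:C%C *: d n) =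
            2^-1 * phi (d m) + 2^-1 * phi (d n).
    have := phiL 2^-1 (d n) 0 Dn D0; rewrite addr0 => e1.
    have e0 : phi 0 = 0.
      have := phiL 1 0 0 D0 D0; rewrite scaler0 addr0 mul1r => h.
      by apply: (addrI (phi 0)); rewrite -h addr0.
    rewrite phiL//; first by rewrite e1 e0 addr0.
    by have := DL 2^-1 _ _ Dn D0; rewrite addr0.
  have -> : d m - d n = d m + (-1)%:C%C *: d n by rewrite rmorphN1 scaleN1r.
  move: Gm Gn; rewrite /G !(qDl, qDr, qZl, qZr) (qC (d n) (d m)).
  set i1 := (m.+1%:R^-1); set i2 := (n.+1%:R^-1).
  lra.
exists w; split; first by exists d; split => // n; have [] := dD n.
have main (x : X) n : D x -> (q x (d n) - phi x) ^+ 2 <= (q x x + 1) * n.+1%:R^-1.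
  move=> Dx; have [Dn Gn] := dD n.
  have i0 : 0 < n.+1%:R^-1 :> R by rewrite invr_gt0.
  have h t := Ile _ (DL t _ _ Dx Dn).
  have {}h t : 0 <= t ^+ 2 * q x x + 2 * t * (q x (d n) - phi x) + n.+1%:R^-1.
    have := h t; move: Gn; rewrite /G phiL// !(qDl, qDr, qZl, qZr) (qC (d n) x).
    set g := _^-1; lra.
  move: h i0 (q0 x); move: (q x x) (q x (d n) - phi x) (n.+1%:R^-1) => a b g h g0 a0.
  have a1 : 0 < a + 1 by lra.
  have := h (- b / (a + 1)).
  rewrite -(pmulr_rge0 _ a1) => {}h.
  have {h} : 0 <= - b ^+ 2 * (1 + 1 / (a + 1)) + g * (a + 1).
    apply: le_trans h _; rewrite le_eqVlt; apply/orP; left; apply/eqP.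
    by field; lra.
  have : 0 <= b ^+ 2 * (1 / (a + 1)).
    by rewrite mulr_ge0 ?sqr_ge0// divr_ge0// ltW.
  move: (1 / (a + 1)) => c; lra.
move=> x Dx; apply/eqP; rewrite -subr_eq0 -sqrf_eq0 eq_le sqr_ge0 andbT.
apply: small_eq => e e0; have K0 : 0 < q x x + 1 by rewrite ltr_wpDl.
have e40 : 0 < e / 4 by rewrite divr_gt0.
have s0 : 0 < Num.sqrt (e / 4) by rewrite sqrtr_gt0.
have [N hN] := limq d w x _ dw s0.
have [N' hN'] := inv_lt (divr_gt0 e40 K0).
have := hN (maxn N N') (leq_maxl _ _); have := hN' (maxn N N') (leq_maxr _ _).
have := main x (maxn N N') Dx; rewrite ltr_pdivlMr//.
set u := q x (d _); set g := _^-1 => h1 h2 h3.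
have h4 : (u - q x w) ^+ 2 < e / 4.
  by rewrite -real_normK ?num_real// -[ltRHS](sqr_sqrtr (ltW e40)) ltr_pXn2r ?nnegrE// ltW.
have := sqr_ge0 ((u - phi x) + (u - q x w)); lra.
Qed.

Lemma cauchy_sqr_cvs (u : nat -> V) :
  (forall m n, ip (u m - u n) (u m - u n) <= 2 * (m.+1%:R^-1 + n.+1%:R^-1)) ->
  exists l, cvs u l.
Proof.
move=> h; apply: cauchy_cvs => e e0.
have e4 : 0 < e ^+ 2 / 4 by rewrite divr_gt0// exprn_gt0.
have [N hN] := inv_lt e4; exists N => m n Nm Nn.
rewrite -(@ltr_pXn2r _ 2) ?nnegrE ?nm_ge0 ?(ltW e0)// nm2.
have := h m n; have := hN _ Nm; have := hN _ Nn.
by move: (m.+1%:R^-1) (n.+1%:R^-1) => g1 g2; lra.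
Qed.

Lemma riesz (D : set V) (phi : V -> R) (M : R) :
  D 0 -> (forall r x y, D x -> D y -> D (r%:C%C *: x + y)) ->
  (forall r x y, D x -> D y -> phi (r%:C%C *: x + y) = r * phi x + phi y) ->
  0 <= M -> (forall x, D x -> phi x ^+ 2 <= M * ip x x) ->
  exists w, (exists d, (forall n, D (d n)) /\ cvs d w) /\
    forall x, D x -> phi x = ip x w.
Proof.
apply: (riesz_form ipC ipDl ipZl ip_ge0 cauchy_sqr_cvs) => d w x e dw e0.
have [N hN] := cvs_ip x dw e0; exists N => n /hN.
by rewrite !(ipC x).
Qed.

Lemma dense_of_ortho (D : set V) :
  D 0 -> (forall r x y, D x -> D y -> D (r%:C%C *: x + y)) ->
  (forall w, (forall x, D x -> ip x w = 0) -> w = 0) ->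
  forall x, exists d, (forall n, D (d n)) /\ cvs d x.
Proof.
move=> D0 DL h x.
have [|||w [dw wP]] := @riesz D (fun y => ip y x) (ip x x) D0 DL.
- by move=> r u v _ _; rewrite ipDl ipZl.
- exact: ip_ge0.
- move=> y _; rewrite -!nm2 mulrC -exprMn -real_normK ?num_real//.
  by rewrite ler_pXn2r ?nnegrE ?mulr_ge0 ?nm_ge0 ?ip_cauchy_schwarz.
suff -> : x = w by [].
apply/eqP; rewrite -subr_eq0; apply/eqP/h => y Dy.
by rewrite ipDr ipNr wP// subrr.
Qed.

(** Uniform boundedness for vectors seen as functionals, by the gliding hump:
    the increments 3^-(n+1) along the directions w_n, where |w_n| >= 4^n, add up
    to a vector on which the functionals are unbounded. *)
Lemma weakly_bounded (W : set V) :
  (forall x, exists C, forall w, W w -> `|ip x w| <= C) ->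
  exists2 C, 0 <= C & forall w, W w -> nm w <= C.
Proof.
move=> hW; apply: contrapT => hn.
have wP n : exists w, W w /\ 4 ^+ n < nm w.
  apply: contrapT => h; apply: hn; exists (4 ^+ n) => [|w Ww].
    by rewrite exprn_ge0.
  by rewrite leNgt; apply/negP => ?; apply: h; exists w.
have [w /all_and2[Ww w4]] := choice wP.
have w0 n : 0 < nm (w n) by apply: le_lt_trans (w4 n); rewrite exprn_ge0.
pose sg (r : R) : R := if 0 <= r then 1 else -1.
pose x := fix x n := if n is k.+1 then
  x k + (sg (ip (x k) (w k)) * (3^-1 ^+ k.+1 / nm (w k)))%:C%C *: w k else 0.
have p3 n : 0 < 3^-1 ^+ n :> R by rewrite exprn_gt0.
have xw n : 3^-1 ^+ n.+1 * nm (w n) <= `|ip (x n.+1) (w n)|.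
  rewrite /= ipDl ipZl -nm2.
  have -> : sg (ip (x n) (w n)) * (3^-1 ^+ n.+1 / nm (w n)) * nm (w n) ^+ 2 =
    sg (ip (x n) (w n)) * (3^-1 ^+ n.+1 * nm (w n)).
    by field; rewrite gt_eqF.
  have := mulr_gt0 (p3 n.+1) (w0 n); move: (_ * nm (w n)) => g g0.
  rewrite /sg; case: ifPn => [h|]; first by rewrite ger0_norm; lra.
  by rewrite -ltNge => h; rewrite ler0_norm; lra.
have xx n : nm (x n.+1 - x n) <= 3^-1 ^+ n.+1.
  rewrite /= addrAC subrr add0r nmZ normrM [`|sg _|](_ : _ = 1); last first.
    by rewrite /sg; case: ifP; rewrite ?normrN normr1.
  rewrite mul1r ger0_norm; last by rewrite divr_ge0// ltW.
  by rewrite divfK// gt_eqF.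
have xk n k : nm (x (n + k)%N - x n) <= (3^-1 ^+ n - 3^-1 ^+ (n + k)) / 2.
  elim: k => [|k ih]; first by rewrite addn0 !subrr nm0 mul0r.
  apply: le_trans (nm_tri (x (n + k)%N) _ _) _.
  have := xx (n + k)%N; rewrite addnS => h.
  apply: le_trans (lerD h ih) _; rewrite exprS; lra.
have x3 n k : nm (x (n + k)%N - x n) <= 3^-1 ^+ n / 2.
  by have := xk n k; have := p3 (n + k)%N; lra.
have small (e : R) : 0 < e -> exists N, forall n, (N <= n)%N -> 3^-1 ^+ n < e.
  move=> e0; have [N hN] := inv_lt e0; exists N => n Nn.
  apply: le_lt_trans (hN n Nn); rewrite exprVn lef_pV2 ?posrE ?exprn_gt0//.
  by rewrite -natrX ler_nat ltn_expl.
have [l xl] : exists l, cvs x l.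
  apply: cauchy_cvs => e e0; have [N hN] := small e e0; exists N => m n Nm Nn.
  have := x3 N (m - N)%N; have := x3 N (n - N)%N; rewrite !subnKC//.
  have := nm_tri (x N) (x m) (x n); rewrite (nmB (x N)); have := hN _ (leqnn _).
  lra.
have lx n : nm (l - x n) <= 3^-1 ^+ n / 2.
  have h : cvs (fun k => x (n + k)%N - x n) (l - x n).
    apply: cvsB; last exact: cvs_cst.
    have := cvs_shift n xl; congr cvs; apply/funext => k; by rewrite addnC.
  exact: cvs_nm_le h (x3 n).
have [C hC] := hW l.
have key n : (4 / 3) ^+ n / 6 <= C.
  apply: le_trans (hC _ (Ww n)).
  have : 3^-1 ^+ n.+1 / 2 * nm (w n) <= `|ip l (w n)|.
    have -> : ip l (w n) = ip (x n.+1) (w n) + ip (l - x n.+1) (w n).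
      by rewrite -ipDl addrC subrK.
    have h := ip_cauchy_schwarz (l - x n.+1) (w n).
    have h' := ler_wpM2r (ltW (w0 n)) (lx n.+1).
    have := xw n; have := lerB_normD (ip (x n.+1) (w n)) (ip (l - x n.+1) (w n)).
    lra.
  apply: le_trans; rewrite exprS expr_div_n exprVn.
  have := ler_wpM2l (ltW (p3 n)) (ltW (w4 n)); rewrite exprVn; lra.
have unb : exists n, 6 * C < (4 / 3) ^+ n.
  exists (Num.truncn (18 * C)).+1.
  have : forall n, 1 + n%:R / 3 <= (4 / 3) ^+ n :> R.
    elim=> [|n ih]; first by rewrite mul0r addr0 expr0.
    rewrite exprS -natr1; have : 0 <= n%:R :> R by []. lra.
  move=> /(_ (Num.truncn (18 * C)).+1); have := truncnS_gt (18 * C); lra.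
have [n hn'] := unb; have := key n; lra.
Qed.

End RealInner.

(** * Adjointable operators and range inclusion *)

Section Adjointable.
Context (R : realType) (V : hilbertType R).
Implicit Types (x y z : V) (r : R) (a : R[i]) (f g : V -> V).

Definition adj f g := forall x y, '[f x, y] = '[x, g y].
Definition sa f := adj f f.

Lemma inner_inj x y : (forall z, '[z, x] = '[z, y]) -> x = y.
Proof. by move=> h; apply: ip_inj => z; rewrite /ip h. Qed.

Lemma adjC f g : adj f g -> adj g f.
Proof. by move=> h x y; rewrite innerC -h -innerC. Qed.

Lemma adj_ip f g x y : adj f g -> ip (f x) y = ip x (g y).
Proof. by move=> h; rewrite /ip h. Qed.

Lemma adj_linear f g : adj f g -> linear f.
Proof.
move=> h a x y; apply: inner_inj => z.
by rewrite -(adjC h) [in RHS]linearDr [in LHS]linearDr /= !innerZr !(adjC h).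
Qed.

Lemma adjD f g x y : adj f g -> f (x + y) = f x + f y.
Proof. by move=> /adj_linear/(_ 1 x y); rewrite !scale1r. Qed.

Lemma adj0 f g : adj f g -> f 0 = 0.
Proof. by move=> h; have := adjD 0 0 h; rewrite addr0 -{1}[f 0]addr0 => /addrI. Qed.

Lemma adjZ f g a x : adj f g -> f (a *: x) = a *: f x.
Proof.
by move=> h; have := adj_linear h a x 0; rewrite (adj0 h) !addr0.
Qed.

Lemma adjN f g x : adj f g -> f (- x) = - f x.
Proof. by move=> h; rewrite -scaleN1r (adjZ _ _ h) scaleN1r. Qed.

Lemma adjB f g x y : adj f g -> f (x - y) = f x - f y.
Proof. by move=> h; rewrite (adjD _ _ h) (adjN _ h). Qed.

(** An operator with an everywhere defined adjoint is bounded
    (Hellinger and Toeplitz); so bounded operators are described by [adj] and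
    [sa] alone. *)
Lemma adj_bounded f g : adj f g -> exists2 C, 0 <= C & forall x, nm (f x) <= C * nm x.
Proof.
move=> h; have [|C C0 hC] := @weakly_bounded _ _ [set f x | x in [set x | nm x <= 1]].
  move=> z; exists (nm (g z)) => _ [x /= x1 <-].
  rewrite -(adj_ip _ _ (adjC h)).
  apply: le_trans (ip_cauchy_schwarz _ _) _.
  by rewrite ler_piMr ?nm_ge0.
exists C => // x; have [->|x0] := eqVneq x 0.
  by rewrite (adj0 h) nm0 mulr0.
have xp : 0 < nm x.
  by rewrite lt_neqAle nm_ge0 andbT eq_sym; apply: contra x0 => /eqP/nm_eq0 ->.
have /hC : [set f x | x in [set x | nm x <= 1]] (f ((nm x)^-1%:C%C *: x)).
  exists ((nm x)^-1%:C%C *: x) => //=.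
  by rewrite nmZ gtr0_norm ?invr_gt0// mulVf ?gt_eqF.
rewrite (adjZ _ _ h) nmZ gtr0_norm ?invr_gt0// ler_pdivrMl//.
by rewrite mulrC.
Qed.

Lemma cvs_adj f g u l : adj f g -> cvs u l -> cvs (fun n => f (u n)) (f l).
Proof.
move=> h ul e e0; have [C C0 hC] := adj_bounded h.
have C1 : 0 < C + 1 by lra.
have [|N hN] := ul (e / (C + 1)); first by rewrite divr_gt0.
exists N => n /hN; rewrite ltr_pdivlMr// -(adjB _ _ h) => h1.
have := hC (u n - l); have := nm_ge0 (u n - l); lra.
Qed.

Lemma adj_comp f f' g g' : adj f f' -> adj g g' -> adj (f \o g) (g' \o f').
Proof. by move=> h h' x y /=; rewrite h h'. Qed.

Lemma sa_sum f g : sa f -> sa g -> sa (fun x => f x + g x).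
Proof. by move=> hf hg x y; rewrite linearDl linearDr /= hf hg. Qed.

Lemma sa_opp f : sa f -> sa (fun x => - f x).
Proof. by move=> hf x y; rewrite linearNl linearNr /= hf. Qed.

Lemma sa_sub f g : sa f -> sa g -> sa (fun x => f x - g x).
Proof. by move=> hf hg; apply: sa_sum => //; exact: sa_opp. Qed.

Lemma sa_scale r f : sa f -> sa (fun x => r%:C%C *: f x).
Proof. by move=> hf x y; rewrite innerZl innerZr hf /= oppr0. Qed.

Lemma sa_sandwich f g : sa f -> sa g -> sa (fun x => f (g (f x))).
Proof. by move=> hf hg x y; rewrite hf hg hf. Qed.

Lemma sa_comp f g : sa f -> sa g -> (forall x, f (g x) = g (f x)) ->
  sa (fun x => f (g x)).
Proof. by move=> hf hg c x y; rewrite hf hg -c. Qed.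

Definition inj0 f := forall x, f x = 0 -> x = 0.

Lemma inj0P f g x y : adj f g -> inj0 f -> f x = f y -> x = y.
Proof.
move=> h i e; apply/eqP; rewrite -subr_eq0; apply/eqP/i.
by rewrite (adjB _ _ h) e subrr.
Qed.

Lemma sa_dense_range f : sa f -> inj0 f -> forall y,
  exists u : nat -> V, cvs (fun n => f (u n)) y.
Proof.
move=> sf fi y; have [|||d [dD dy]] := @dense_of_ortho _ _ (range f) _ _ _ y.
- by exists 0; rewrite ?(adj0 sf).
- move=> r _ _ [x _ <-] [z _ <-]; exists (r%:C%C *: x + z) => //.
  by rewrite (adj_linear sf).
- move=> w hw; apply: fi; apply: ip_eq0; rewrite -(adj_ip _ _ sf) ipC.
  by rewrite ipC; apply: hw; exists (f w).
have /choice[x hx] : forall n, exists x, f x = d n.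
  by move=> n; have [x _ <-] := dD n; exists x.
by exists x; move: dy; congr cvs; apply/funext => n; rewrite hx.
Qed.

(** A self-adjoint operator which is bounded from below has closed and dense
    range. *)
Lemma sa_inverse f (c : R) : sa f -> 0 < c -> (forall x, c * nm x <= nm (f x)) ->
  exists g, [/\ sa g, forall x, f (g x) = x & forall x, g (f x) = x].
Proof.
move=> sf c0 hc.
have fi : inj0 f.
  move=> x fx; apply: nm_eq0; apply/eqP; rewrite eq_le nm_ge0 andbT.
  by have := hc x; rewrite fx nm0 pmulr_rle0.
have /choice[g fg] : forall y, exists x, f x = y.
  move=> y; have [u uy] := sa_dense_range sf fi y.
  have [x ux] : exists x, cvs u x.
    apply: cauchy_cvs => e e0; have [|N hN] := uy (c * e / 2).
      by rewrite divr_gt0// mulr_gt0.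
    exists N => m n /hN hm /hN hn; rewrite -(ltr_pM2l c0).
    apply: le_lt_trans (hc _) _; rewrite (adjB _ _ sf).
    by have := nm_tri y (f (u m)) (f (u n)); rewrite (nmB y); lra.
  by exists x; exact: cvs_uniq (cvs_adj sf ux) uy.
exists g; split => // [x y|x]; first by rewrite -{1}(fg y) -(sf (g x)) fg.
by apply: (inj0P sf fi); rewrite fg.
Qed.

(** ** Range inclusion *)

Definition subrange f g := forall y, exists z, f y = g z.

(** Douglas' lemma: a range inclusion is an inequality between adjoints.  One
    direction represents the functional g' x |-> <f' x, y>, the other one is
    uniform boundedness of the f' x with |g' x| <= 1. *)
Lemma subrange_of_le f f' g g' (C : R) : adj f f' -> adj g g' -> 0 <= C ->
  (forall x, nm (f' x) <= C * nm (g' x)) -> subrange f g.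
Proof.
move=> hf hg C0 hC y.
pose pre u := xget 0 [set x | g' x = u].
have preP x : f' (pre (g' x)) = f' x.
  have e : g' (pre (g' x)) = g' x.
    by rewrite /pre; case: xgetP => [z _ //|/(_ x)]; case.
  apply/eqP; rewrite -subr_eq0 -(adjB _ _ (adjC hf)); apply/eqP/nm_eq0.
  apply/eqP; rewrite eq_le nm_ge0 andbT; apply: le_trans (hC _) _.
  by rewrite (adjB _ _ (adjC hg)) e subrr nm0 mulr0.
have [|||||w [_ hw]] := @riesz _ _ (range g') (fun u => ip (f' (pre u)) y)
    ((C * nm y) ^+ 2).
- by exists 0; rewrite ?(adj0 (adjC hg)).
- move=> r _ _ [x _ <-] [z _ <-]; exists (r%:C%C *: x + z) => //.
  by rewrite (adj_linear (adjC hg)).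
- move=> r _ _ [x _ <-] [z _ <-]; rewrite -(adj_linear (adjC hg)) !preP.
  by rewrite (adj_linear (adjC hf)) ipDl ipZl.
- exact: sqr_ge0.
- move=> _ [x _ <-]; rewrite preP -nm2 -exprMn -real_normK ?num_real//.
  rewrite ler_pXn2r ?nnegrE ?mulr_ge0 ?nm_ge0//.
  apply: le_trans (ip_cauchy_schwarz _ _) _.
  by rewrite mulrAC ler_wpM2r ?nm_ge0.
exists w; apply: ip_inj => x; rewrite -(adj_ip _ _ (adjC hg)).
by rewrite -hw ?preP ?(adj_ip _ _ (adjC hf))//; exists x.
Qed.

Lemma le_of_subrange f f' g g' : adj f f' -> adj g g' -> subrange f g ->
  exists2 C, 0 <= C & forall x, nm (f' x) <= C * nm (g' x).
Proof.
move=> hf hg sfg.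
have [|C C0 hC] := @weakly_bounded _ _ [set f' x | x in [set x | nm (g' x) <= 1]].
  move=> y; have [z fgz] := sfg y; exists (nm z) => _ [x /= x1 <-].
  rewrite -(adj_ip _ _ hf) fgz (adj_ip _ _ hg).
  apply: le_trans (ip_cauchy_schwarz _ _) _.
  by rewrite ler_piMr ?nm_ge0.
exists C => // x; rewrite -subr_le0; apply: small_eq => e e0.
have C1 : 0 < C + 1 by lra.
pose t := nm (g' x) + e / (C + 1).
have e1 : 0 < e / (C + 1) by rewrite divr_gt0.
have t0 : 0 < t by rewrite ltr_wpDl ?nm_ge0.
have /hC : [set f' x | x in [set x | nm (g' x) <= 1]] (f' (t^-1%:C%C *: x)).
  exists (t^-1%:C%C *: x) => //=.
  rewrite (adjZ _ _ (adjC hg)) nmZ gtr0_norm ?invr_gt0// ler_pdivrMl// mulr1.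
  by rewrite lerDl ltW.
rewrite (adjZ _ _ (adjC hf)) nmZ gtr0_norm ?invr_gt0// ler_pdivrMl//.
have : C * (e / (C + 1)) <= e.
  by rewrite mulrA ler_pdivrMr//; nra.
rewrite /t; nra.
Qed.

(** <W y, g x> = <y, f' x> bounds W y, because g has dense range. *)
Lemma subrange_factor f f' g : adj f f' -> sa g -> inj0 g -> subrange f g ->
  exists W C, [/\ forall y, f y = g (W y), 0 <= C & forall y, nm (W y) <= C * nm y].
Proof.
move=> hf sg gi sfg; have [W hW] := choice sfg.
have [C C0 hC] := le_of_subrange hf sg sfg.
exists W, C; split => // y.
have [x gx] := sa_dense_range sg gi (W y).
have {}gx : ip (W y) (W y) <= C * nm y * nm (W y).
  rewrite -subr_le0; apply: small_eq => e e0.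
  have K0 : 0 < C * nm y + nm (W y) + 1.
    by rewrite ltr_wpDl// addr_ge0 ?mulr_ge0 ?nm_ge0.
  have [|N hN] := gx (e / (C * nm y + nm (W y) + 1)); first by rewrite divr_gt0.
  have := hN N (leqnn _); rewrite ltr_pdivlMr//.
  set d := nm _ => h1.
  have h2 : ip (W y) (g (x N)) <= C * nm y * nm (g (x N)).
    rewrite -(adj_ip _ _ sg) -hW (adj_ip _ _ hf).
    apply: le_trans (ip_le _ _) _; rewrite (mulrC C) -mulrA.
    by rewrite ler_wpM2l ?nm_ge0.
  have h3 : ip (W y) (W y - g (x N)) <= nm (W y) * d.
    by rewrite /d nmB; exact: ip_le.
  have h4 : nm (g (x N)) <= nm (W y) + d.
    by rewrite -[g (x N)](subrK (W y)) addrC; exact: nmD.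
  have h5 : 0 <= C * nm y by rewrite mulr_ge0 ?nm_ge0.
  move: h3; rewrite ipDr ipNr.
  have d0 : 0 <= d by exact: nm_ge0.
  nra.
move: gx; rewrite -nm2; have := nm_ge0 (W y); rewrite le_eqVlt => /orP[/eqP<- _|Wp].
  by rewrite mulr_ge0 ?nm_ge0.
by rewrite expr2 ler_pM2r.
Qed.

End Adjointable.

(** ** The equivalence for bounded operators *)

Section Core.
Context (R : realType) (V : hilbertType R) (L M S F G : V -> V).
Hypotheses (sL : sa L) (sM : sa M) (sS : sa S) (sF : sa F) (sG : sa G).
Hypotheses (Li : inj0 L) (Mi : inj0 M).
Hypotheses (SS : forall x, S (S x) = x) (SM : forall x, S (M x) = M (S x)).
Hypotheses (FG : forall x, F (G x) = x) (GF : forall x, G (F x) = x).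
Hypothesis SMM : forall x, S (M (M x)) = L (F (L x)).

Definition sign_bound := exists2 C, 0 <= C & forall z, nm (L (S z)) <= C * nm (L z).

Lemma adjSL : adj (S \o L) (L \o S).
Proof. exact: adj_comp. Qed.

Lemma sign_boundP : sign_bound <-> subrange (S \o L) L.
Proof.
split=> [[C C0 hC]|h]; first exact: (subrange_of_le adjSL sL C0).
exact: le_of_subrange adjSL sL h.
Qed.

(** If L = M W then M x = S W F L x, so |M x| is bounded by a multiple of
    |L x|. *)
Lemma rangeLM : subrange L M -> subrange M L.
Proof.
move=> h; have [W [C [LW C0 hW]]] := subrange_factor sL sM Mi h.
have [CF CF0 hF] := adj_bounded sF; have [CS CS0 hS] := adj_bounded sS.
apply: (@subrange_of_le _ _ M M L L (CS * (C * CF))) => // [|x].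
  by rewrite !mulr_ge0.
have -> : M x = S (W (F (L x))).
  apply: (inj0P sM Mi); rewrite -SM -LW -SMM SS.
  by [].
apply: le_trans (hS _) _; rewrite -mulrA ler_wpM2l//.
apply: le_trans (hW _) _; rewrite -mulrA ler_wpM2l//.
Qed.

(** If M = L Z then L x = F^-1 Z S M x. *)
Lemma rangeML : subrange M L -> subrange L M.
Proof.
move=> h; have [Z [C [MZ C0 hZ]]] := subrange_factor sM sL Li h.
have [CG CG0 hG] := adj_bounded sG; have [CS CS0 hS] := adj_bounded sS.
apply: (@subrange_of_le _ _ L L M M (CG * (C * CS))) => // [|x].
  by rewrite !mulr_ge0.
have -> : L x = G (Z (S (M x))).
  rewrite -[LHS]GF; congr G; apply: (inj0P sL Li).
  by rewrite -SMM SM MZ.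
apply: le_trans (hG _) _; rewrite -mulrA ler_wpM2l//.
apply: le_trans (hZ _) _; rewrite -mulrA ler_wpM2l//.
Qed.

(** <M x, M x> = <S L F L x, x> = <F L x, L S x>. *)
Lemma rangeML_sign : sign_bound -> subrange M L.
Proof.
move=> [C C0 hC]; have [CF CF0 hF] := adj_bounded sF.
apply: (@subrange_of_le _ _ M M L L (Num.sqrt (CF * C))) => // x.
rewrite -(@ler_pXn2r _ 2) ?nnegrE ?mulr_ge0 ?nm_ge0 ?sqrtr_ge0//.
rewrite nm2 exprMn sqr_sqrtr ?mulr_ge0// -(adj_ip _ _ sM).
have -> : M (M x) = S (L (F (L x))) by rewrite -SMM SS.
rewrite (adj_ip _ _ sS) (adj_ip _ _ sL).
apply: le_trans (ip_le _ _) _.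
apply: le_trans (ler_pM (nm_ge0 _) (nm_ge0 _) (hF _) (hC _)) _.
by rewrite mulrACA expr2.
Qed.

Lemma sign_rangeLM : subrange L M -> sign_bound.
Proof.
move=> h; apply/sign_boundP => y /=; have [z ->] := h y.
by rewrite SM; exact: rangeLM.
Qed.

End Core.

(** * Local approximation by spectral projections *)

Notation "r *r x" := (r%:C%C *: x) (at level 40) : ring_scope.

Section Partition.
Context (R : realType).
Implicit Types (f g : R -> R).

Definition measurable_partition (S : nat -> set R) :=
  [/\ forall k, measurable (S k), trivIset setT S & \bigcup_k S k = setT].

(** The level sets of the floors of f / d and g / d, numbered through the
    countability of int * int; most pieces may be empty. *)
Lemma fine_partition f g (d : R) : measurable_fun setT f -> measurable_fun setT g ->
  0 < d -> exists S : nat -> set R,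
  [/\ forall k, measurable (S k), trivIset setT S, \bigcup_k S k = setT &
      forall k s t, S k s -> S k t -> `|f s - f t| <= d /\ `|g s - g t| <= d].
Proof.
move=> mf mg d0.
pose cell t : int * int := (Num.floor (f t / d), Num.floor (g t / d)).
exists (fun k => [set t | pickle (cell t) = k]); split.
- move=> k.
  have hm (p : R -> R) (z : int) : measurable_fun setT p ->
      measurable [set t | Num.floor (p t / d) = z].
    move=> mp.
    have -> : [set t | Num.floor (p t / d) = z] =
        p @^-1` `[z%:~R * d, (z + 1)%:~R * d[%classic.
      apply/seteqP; split => t /=; rewrite in_itv/= -ler_pdivlMr// -ltr_pdivrMr//.
        by move=> <-; exact: floor_itv.
      by move=> ?; exact: floor_def.
    by rewrite -[X in measurable X]setTI; apply: mp.
  have [[[p q] <-]|h] := pselect (exists pq : int * int, pickle pq = k); last first.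
    by rewrite (_ : mkset _ = set0)//; apply/seteqP; split => // t /= e; case: h; exists (cell t).
  rewrite (_ : mkset _ = [set t | Num.floor (f t / d) = p] `&` [set t | Num.floor (g t / d) = q]).
    by apply: measurableI; exact: hm.
  apply/seteqP; split => t /=; last by move=> [<- <-].
  by move=> /(pcan_inj pickleK)[<- <-].
- by move=> i j _ _ [t [/= <- <-]].
- by apply/seteqP; split => // t _; exists (pickle (cell t)).
- move=> k s t /= <- /esym/(pcan_inj pickleK) [h1 h2].
  have hp (p : R -> R) : Num.floor (p s / d) = Num.floor (p t / d) -> `|p s - p t| <= d.
    move=> e; have := floor_itv (p s / d); have := floor_itv (p t / d).
    rewrite e intrD !ler_pdivlMr// !ltr_pdivrMr// => /andP[a1 a2] /andP[a3 a4].
    rewrite ler_norml; apply/andP; split; lra.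
  by split; exact: hp.
Qed.

(** The value on an empty piece is arbitrary. *)
Lemma sampled_partition f (d : R) : measurable_fun setT f -> 0 < d ->
  exists P (v : nat -> R), measurable_partition P /\
    forall k t, P k t -> `|f t - v k| <= d /\ exists2 s, P k s & v k = f s.
Proof.
move=> mf d0; have [P [mP tP uP hP]] := fine_partition mf mf d0.
exists P, (fun k => xget 0 [set r | exists2 t, P k t & r = f t]); split=> // k t Pt.
have [s Ps ->] : exists2 s, P k s & xget 0 [set r | exists2 t, P k t & r = f t] = f s.
  by case: xgetP => [r _ //|/(_ (f t))]; case; exists t.
by split; [have [] := hP k t s Pt Ps|exists s].
Qed.

End Partition.

Section SpectralMeasure.
Context (R : realType) (V : hilbertType R).
Implicit Types (x y z u w : V) (S T : set R) (f g h : R -> R).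

Lemma nmZc (a : R[i]) x : nm (a *: x) = complex.Re `|a| * nm x.
Proof.
by apply: complexI; rewrite rmorphM/= -!normE normrZ; congr (_ * _).
Qed.

Lemma pythagoras x y : ip x y = 0 -> ip (x + y) (x + y) = ip x x + ip y y.
Proof. by move=> h; rewrite !ipE (ipC y x) h; ring. Qed.

Variable E : set R -> {linear V -> V}.
Hypothesis pE : projection_valued_measure E.

Lemma pvm_idem S x : measurable S -> E S (E S x) = E S x.
Proof. by case: pE => h _ _ _ mS; exact: h. Qed.

Lemma pvm_sa S : measurable S -> sa (E S).
Proof. by case: pE => _ h _ _ mS x y; exact: h. Qed.

Lemma pvm_setT x : E setT x = x.
Proof. by case: pE. Qed.

Lemma pvm_series (F : nat -> set R) x : (forall n, measurable (F n)) ->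
  trivIset setT F -> cvs (fun n => \sum_(0 <= k < n) E (F k) x) (E (\bigcup_n F n) x).
Proof. by move=> mF tF; apply/cvsP; case: pE => _ _ _; exact. Qed.

Lemma pvm_set0 x : E set0 x = 0.
Proof.
have h := @pvm_series (fun=> set0) x (fun=> measurable0) (@trivIset_set0 _ _ _).
have h1 : cvs (fun n => \sum_(0 <= k < (n + 1)%N) E set0 x - \sum_(0 <= k < n) E set0 x) 0.
  by have := cvsB (cvs_shift 1%N h) h; rewrite subrr.
apply: (cvs_uniq _ h1); move: (cvs_cst (E set0 x)); congr cvs; apply/funext => n.
by rewrite addn1 big_nat_recr//= addrAC subrr add0r.
Qed.

Lemma pvm_setU S T x : measurable S -> measurable T -> S `&` T = set0 ->
  E (S `|` T) x = E S x + E T x.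
Proof.
move=> mS mT ST; have mF n : measurable (bigcup2 S T n) by case: n => [|[|n]] //=; exact: measurable0.
have tF : trivIset setT (bigcup2 S T) by rewrite -trivIset_bigcup2.
have := pvm_series x mF tF; rewrite bigcup2E => h.
apply: (cvs_uniq (cvs_shift 2%N h)) => e e0; exists 0%N => n _.
rewrite (_ : \sum_(0 <= k < (n + 2)%N) _ = E S x + E T x) ?subrr ?nm0//.
elim: n => [|n ih]; first by rewrite add0n unlock /= addr0.
by rewrite addSn big_nat_recr//= ih addn2/= pvm_set0 addr0.
Qed.

(** Additivity makes E (S `|` T) = E S + E T idempotent; on the range of E T this
    says that E T (E S w) = - E S w, so |E S w|^2 <= 0. *)
Lemma pvm_disj S T x : measurable S -> measurable T -> S `&` T = set0 ->
  E S (E T x) = 0.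
Proof.
move=> mS mT ST; set w := E T x.
have mU : measurable (S `|` T) by exact: measurableU.
have Tw : E T w = w by rewrite pvm_idem.
have h : E S w + E T (E S w) = 0.
  have := pvm_idem w mU; rewrite !pvm_setU// Tw !linearD/= Tw pvm_idem//.
  move: (E S w) (E T (E S w)) => a b e.
  by apply: (addrI (a + w)); rewrite addr0 -[RHS]e addrACA (addrC w).
apply: ip_eq0; apply/eqP; rewrite eq_le ip_ge0 andbT.
have -> : ip (E S w) (E S w) = - ip (E T (E S w)) (E T (E S w)).
  have -> : ip (E T (E S w)) (E T (E S w)) = ip (E T (E S w)) (E S w).
    by rewrite (adj_ip _ _ (pvm_sa mT)) pvm_idem// -(adj_ip _ _ (pvm_sa mT)).
  by rewrite -ipNl; congr ip; apply/eqP; rewrite -addr_eq0 h.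
by rewrite oppr_le0 ip_ge0.
Qed.

Lemma pvm_setI S T x : measurable S -> measurable T -> E S (E T x) = E (S `&` T) x.
Proof.
move=> mS mT.
have mI : measurable (S `&` T) by exact: measurableI.
have mD (A B : set R) : measurable A -> measurable B -> measurable (A `\` B) by exact: measurableD.
have dec (A B : set R) y : measurable A -> measurable B -> E A y = E (A `&` B) y + E (A `\` B) y.
  move=> mA mB; rewrite -pvm_setU//; first by rewrite setUIDK.
  - exact: measurableI.
  - exact: mD.
  - by apply/seteqP; split => // t [[_ ?] []].
rewrite (dec S T)// (dec T S x)// !linearD/= setIC.
rewrite pvm_idem ?(setIC T)// (@pvm_disj (S `&` T) (T `\` S))// ?addr0; last 2 first.
- exact: mD.
- by apply/seteqP; split => // t [[? _] []].
rewrite (@pvm_disj (S `\` T))// ?(@pvm_disj (S `\` T) (T `\` S))// ?addr0//; try exact: mD.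
- by apply/seteqP; split => // t [[? _] []].
- by apply/seteqP; split => // t [[_ ?] []].
Qed.

Lemma pvm_comm S T x : measurable S -> measurable T -> E S (E T x) = E T (E S x).
Proof. by move=> mS mT; rewrite !pvm_setI// setIC. Qed.

Lemma pvm_ip S x : measurable S -> ip (E S x) x = ip (E S x) (E S x).
Proof.
by move=> mS; rewrite -[in RHS](adj_ip _ _ (pvm_sa mS)) pvm_idem.
Qed.

Lemma parseval_ip (S : nat -> set R) w z (e : R) : measurable_partition S -> 0 < e ->
  exists N, forall n, (N <= n)%N ->
    `|\sum_(0 <= k < n) ip (E (S k) w) (E (S k) z) - ip w z| < e.
Proof.
move=> [mS tS uS] e0; have := pvm_series w mS tS; rewrite uS pvm_setT => h.
have [N hN] := cvs_ip z h e0; exists N => n /hN.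
suff -> : ip (\sum_(0 <= k < n) E (S k) w) z = \sum_(0 <= k < n) ip (E (S k) w) (E (S k) z) by [].
elim: n => [|n ih]; first by rewrite !big_nil ip0l.
rewrite !big_nat_recr//= ipDl ih -[in RHS](adj_ip _ _ (pvm_sa (mS n))).
by rewrite pvm_idem.
Qed.

Lemma bessel (S : nat -> set R) w n : (forall k, measurable (S k)) -> trivIset setT S ->
  \sum_(0 <= k < n) ip (E (S k) w) (E (S k) w) <= ip w w.
Proof.
move=> mS tS.
have h := pvm_series w mS tS.
have mU : measurable (\bigcup_k S k) by exact: bigcup_measurable.
have : ip (E (\bigcup_k S k) w) w <= ip w w.
  rewrite pvm_ip//; have := ip_ge0 (w - E (\bigcup_k S k) w).
  by rewrite !ipE (ipC w) pvm_ip//; lra.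
apply: le_trans.
have eqn m : ip (\sum_(0 <= k < m) E (S k) w) w = \sum_(0 <= k < m) ip (E (S k) w) (E (S k) w).
  elim: m => [|m ih]; first by rewrite !big_nil ip0l.
  by rewrite !big_nat_recr//= ipDl ih pvm_ip.
apply: (cvs_ip_ge (cvs_shift n h)) => m; rewrite eqn [leRHS](@big_cat_nat _ _ _ n)//= ?leq_addl//.
by rewrite lerDl; apply: sumr_ge0 => k _; exact: ip_ge0.
Qed.

(** By Parseval's identity an estimate may be proved piece by piece; the three
    terms on the right are those which [local_of_fine] produces. *)
Lemma parseval_le (S : nat -> set R) w z w' z' x1 x2 x3 (c1 c2 c3 : R) :
  measurable_partition S -> 0 <= c1 -> 0 <= c2 -> 0 <= c3 ->
  (forall k, ip (E (S k) w) (E (S k) z) - ip (E (S k) w') (E (S k) z') <=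
     c1 * ip (E (S k) x1) (E (S k) x1) + c2 * ip (E (S k) x2) (E (S k) x2) +
     c3 * ip (E (S k) x3) (E (S k) x3)) ->
  ip w z - ip w' z' <= c1 * ip x1 x1 + c2 * ip x2 x2 + c3 * ip x3 x3.
Proof.
move=> pS c10 c20 c30 h; rewrite -subr_le0; apply: small_eq => e e0.
have e2 : 0 < e / 2 by rewrite divr_gt0.
have [N1 hN1] := parseval_ip w z pS e2; have [N2 hN2] := parseval_ip w' z' pS e2.
have := hN1 (maxn N1 N2) (leq_maxl _ _); have := hN2 (maxn N1 N2) (leq_maxr _ _).
case: (pS) => mS tS _; set N := maxn N1 N2.
have := bessel x1 N mS tS; have := bessel x2 N mS tS; have := bessel x3 N mS tS.
have : \sum_(0 <= k < N) ip (E (S k) w) (E (S k) z) -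
   \sum_(0 <= k < N) ip (E (S k) w') (E (S k) z') <=
   c1 * \sum_(0 <= k < N) ip (E (S k) x1) (E (S k) x1) +
   c2 * \sum_(0 <= k < N) ip (E (S k) x2) (E (S k) x2) +
   c3 * \sum_(0 <= k < N) ip (E (S k) x3) (E (S k) x3).
  by rewrite !mulr_sumr -sumrB -!big_split/=; apply: ler_sum => k _; exact: h.
move: (\sum_(0 <= _ < _) _) (\sum_(0 <= _ < _) _) (\sum_(0 <= _ < _) _) (\sum_(0 <= _ < _) _) (\sum_(0 <= _ < _) _).
move=> s0 s1 s2 s3 s4 h0 h3 h2 h1; rewrite !ltr_norml => /andP[_ h4] /andP[h5 _].
have := ler_wpM2l c10 h1; have := ler_wpM2l c20 h2; have := ler_wpM2l c30 h3; lra.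
Qed.

Lemma parseval_le1 (S : nat -> set R) w x1 (c1 : R) : measurable_partition S -> 0 <= c1 ->
  (forall k, ip (E (S k) w) (E (S k) w) <= c1 * ip (E (S k) x1) (E (S k) x1)) ->
  ip w w <= c1 * ip x1 x1.
Proof.
move=> pS c0 h.
have := @parseval_le S w w 0 0 x1 0 0 c1 0 0 pS c0 (lexx 0) (lexx 0).
rewrite !mul0r !addr0 ip0l subr0; apply => k.
by rewrite !mul0r !addr0 linear0 ip0l subr0.
Qed.

(** Prescribed multiples on the pieces of a partition are realised by a vector as
    soon as the squared norms are summable; this is where completeness provides
    the vectors f(T) x. *)
Lemma orthogonal_series (S : nat -> set R) (v : nat -> R) x (K : R) :
  measurable_partition S ->
  (forall n, \sum_(0 <= k < n) v k ^+ 2 * ip (E (S k) x) (E (S k) x) <= K) ->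
  exists u, forall k, E (S k) u = v k *r E (S k) x.
Proof.
move=> [mS tS uS] hK.
pose s n := \sum_(0 <= k < n) v k ^+ 2 * ip (E (S k) x) (E (S k) x).
pose U n := \sum_(0 <= k < n) v k *r E (S k) x.
have dS i j : i != j -> S i `&` S j = set0.
  move=> /eqP ij; apply/seteqP; split=> // t [Si Sj]; apply: ij.
  by apply: tS => //; exists t.
have EU n j : (j < n)%N -> E (S j) (U n) = v j *r E (S j) x.
  move=> jn; rewrite /U linear_sum/= big_mkord (bigD1 (Ordinal jn))//=.
  rewrite linearZ/= pvm_idem// big1 ?addr0// => i ij.
  rewrite linearZ/= pvm_disj ?scaler0// dS//.
  by apply: contra ij => /eqP e; apply/eqP/val_inj.
have EU0 n j : (n <= j)%N -> E (S j) (U n) = 0.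
  move=> nj; rewrite /U linear_sum/= big_mkord big1// => i _.
  rewrite linearZ/= pvm_disj ?scaler0// dS//.
  by rewrite neq_ltn (leq_trans (ltn_ord i) nj) orbT.
have US m n : (m <= n)%N -> ip (U n - U m) (U n - U m) = s n - s m.
  elim: n => [|n ih]; first by rewrite leqn0 => /eqP->; rewrite !subrr ip0l.
  rewrite leq_eqVlt => /orP[/eqP<-|]; first by rewrite !subrr ip0l.
  rewrite ltnS => mn.
  have -> : U n.+1 - U m = (U n - U m) + v n *r E (S n) x.
    by rewrite {1}/U big_nat_recr//= addrAC.
  have -> : s n.+1 = s n + v n ^+ 2 * ip (E (S n) x) (E (S n) x).
    by rewrite /s big_nat_recr.
  rewrite pythagoras ?ih//.
    by rewrite ipZl ipZr; ring.
  rewrite ipZr -(adj_ip _ _ (pvm_sa (mS n))) linearB/= !EU0// subrr ip0l.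
  by rewrite mulr0.
have [|u hu] := @monotone_cvs _ _ U s K _ hK.
  by move=> m n mn; rewrite US.
exists u => j; have h := cvs_shift j.+1 (cvs_adj (pvm_sa (mS j)) hu).
apply: (cvs_uniq h); move: (cvs_cst (v j *r E (S j) x)); congr cvs; apply/funext => n.
by rewrite EU// addnS ltnS leq_addl.
Qed.

End SpectralMeasure.

(** * The relation y = f(T) x *)

Section Local.
Context (R : realType) (V : hilbertType R).
Implicit Types (x y z u w : V) (S T : set R) (f g h : R -> R).

(** The relation y = f(T) x, expressed by the estimates which y has to satisfy on
    pieces of the spectrum where f is almost constant.  That x lies in the domain
    of f(T) is expressed by the existence of y. *)
Definition local (E : set R -> {linear V -> V}) f x y :=
  forall S (v e : R), measurable S -> (forall t, S t -> `|f t - v| <= e) ->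
    nm (E S y - v *r E S x) <= e * nm (E S x).

Variable E : set R -> {linear V -> V}.
Hypothesis pE : projection_valued_measure E.

Definition near_local (d : R) f x y :=
  forall S (v e : R), measurable S -> (forall t, S t -> `|f t - v| <= e) ->
    nm (E S y - v *r E S x) <= (e + d) * nm (E S x).

Lemma local_near f x y : local E f x y <-> near_local 0 f x y.
Proof. by split=> h S v e mS hS; have := h S v e mS hS; rewrite addr0. Qed.

(** On a piece where f is within q of v, both E_S y and E_S y' are close to
    v E_S x; Parseval's identity adds this up. *)
Lemma near_local_dist (d d' : R) f x y y' : measurable_fun setT f ->
  0 <= d -> 0 <= d' -> near_local d f x y -> near_local d' f x y' ->
  nm (y - y') <= (d + d') * nm x.
Proof.
move=> mf d0 d'0 h h'; rewrite -subr_le0; apply: small_eq => e e0.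
have x0 : 0 < nm x + 1 by rewrite ltr_wpDl ?nm_ge0.
pose q := e / (2 * (nm x + 1)).
have q0 : 0 < q by rewrite divr_gt0// mulr_gt0.
have [S [mS tS uS hS]] := fine_partition mf mf q0.
suff : nm (y - y') <= (2 * q + d + d') * nm x.
  have : 2 * q * nm x <= e.
    have -> : 2 * q * nm x = e * (nm x / (nm x + 1)) by rewrite /q; field; lra.
    by rewrite ler_piMr ?(ltW e0)// ler_pdivrMr//; lra.
  lra.
rewrite -(@ler_pXn2r _ 2) ?nnegrE ?mulr_ge0 ?nm_ge0//; last by lra.
rewrite exprMn !nm2; apply: (parseval_le1 pE (S := S)) => // [|k]; first exact: sqr_ge0.
have [e1|/set0P[t St]] := eqVneq (S k) set0.
  by rewrite e1 !pvm_set0// !ip0l mulr0.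
have hk s : S k s -> `|f s - f t| <= q by move=> Ss; have [] := hS k s t Ss St.
have := h _ _ _ (mS k) hk; have := h' _ _ _ (mS k) hk.
rewrite -!nm2 -exprMn ler_pXn2r ?nnegrE ?mulr_ge0 ?nm_ge0//; last by lra.
rewrite linearB/=; have := nm_tri (f t *r E (S k) x) (E (S k) y) (E (S k) y').
rewrite (nmB (f t *r _)); lra.
Qed.

Lemma local_unique f x y y' : measurable_fun setT f ->
  local E f x y -> local E f x y' -> y = y'.
Proof.
move=> mf /local_near h /local_near h'; apply/eqP; rewrite -subr_eq0.
apply/eqP/nm_eq0/eqP; rewrite eq_le nm_ge0 andbT.
by have := near_local_dist mf (lexx 0) (lexx 0) h h'; rewrite addr0 mul0r.
Qed.

(** It suffices to estimate on pieces on which two given functions are almost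
    constant, with an error which is small compared to fixed vectors. *)
Lemma local_of_fine f1 f2 h x z u1 u2 :
  measurable_fun setT f1 -> measurable_fun setT f2 ->
  (forall (d : R) S t, 0 < d -> d <= 1 -> measurable S -> S t ->
     (forall s, S s -> `|f1 s - f1 t| <= d /\ `|f2 s - f2 t| <= d) ->
     nm (E S z - h t *r E S x) <= d * (nm (E S u1) + nm (E S u2))) ->
  local E h x z.
Proof.
move=> m1 m2 H S v e mS hS.
have [->|/set0P[t0 St0]] := eqVneq S set0.
  by rewrite !pvm_set0// scaler0 subrr nm0 mulr0.
have e0 : 0 <= e by apply: le_trans (hS _ St0).
set w := E S z - v *r E S x; pose K := e ^+ 2 * ip x x + 4 * (ip u1 u1 + ip u2 u2) + 1.
have K0 : 0 < K.
  by rewrite ltr_wpDl// addr_ge0// mulr_ge0 ?sqr_ge0 ?addr_ge0 ?ip_ge0.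
suff hw : ip w w <= e ^+ 2 * ip (E S x) (E S x).
  by rewrite -(@ler_pXn2r _ 2) ?nnegrE ?mulr_ge0 ?nm_ge0// exprMn !nm2.
rewrite -subr_le0; apply: small_eq => q q0.
pose d := Num.min 1 (q / K).
have d0 : 0 < d by rewrite lt_min ltr01 divr_gt0.
have d1 : d <= 1 by rewrite ge_min lexx.
have dK : d * K <= q by rewrite -ler_pdivlMr// ge_min lexx orbT.
have [P [mP tP uP hP]] := fine_partition m1 m2 d0.
have ES_le y : ip (E S y) (E S y) <= ip y y.
  rewrite -pvm_ip//; have := ip_ge0 (y - E S y).
  by rewrite !ipE (ipC y) pvm_ip//; lra.
suff : ip w w <= (1 + d) * e ^+ 2 * ip (E S x) (E S x) +
    2 * (d ^+ 2 + d) * ip (E S u1) (E S u1) + 2 * (d ^+ 2 + d) * ip (E S u2) (E S u2).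
  have := ES_le u1; have := ES_le u2; have := ES_le x; rewrite /K in dK.
  have := ip_ge0 x; have := ip_ge0 u1; have := ip_ge0 u2.
  have := ip_ge0 (E S u1); have := ip_ge0 (E S u2).
  move: (ip x x) (ip u1 u1) (ip u2 u2) dK (ip (E S x) (E S x)) (ip (E S u1) (E S u1)) (ip (E S u2) (E S u2)).
  move=> a b c dK a' b' c' b'0 c'0 c0 b0 a0 aa cc bb hyp.
  have d2 : d ^+ 2 <= d by rewrite expr2 ler_piMr// ltW.
  have h1 : d * (e ^+ 2 * a') <= d * (e ^+ 2 * a) by rewrite !ler_wpM2l ?sqr_ge0// ltW.
  have h2 : 2 * (d ^+ 2 + d) * b' <= 4 * d * b by apply: ler_pM => //; nra.
  have h3 : 2 * (d ^+ 2 + d) * c' <= 4 * d * c by apply: ler_pM => //; nra.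
  lra.
have d20 : 0 <= 2 * (d ^+ 2 + d) by nra.
rewrite -[ip w w]subr0 -[X in _ - X](ip0l (0 : V)); apply: (parseval_le pE (S := P)) => // [|k].
  by rewrite mulr_ge0 ?sqr_ge0//; lra.
rewrite linear0 ip0l subr0 /w linearB/= linearZ/= !pvm_setI//.
have mk : measurable (P k `&` S) by exact: measurableI.
have [->|/set0P[t St]] := eqVneq (P k `&` S) set0.
  by rewrite !pvm_set0// scaler0 subrr !ip0l !mulr0 !addr0.
have hk s : (P k `&` S) s -> `|f1 s - f1 t| <= d /\ `|f2 s - f2 t| <= d.
  by move=> [Ps _]; case: St => Pt _; exact: hP Ps Pt.
have := H d _ t d0 d1 mk St hk.
have hv := hS t (proj2 St).
set Q := P k `&` S.
have h1 : nm (E Q z - v *r E Q x) <= nm (E Q z - h t *r E Q x) + e * nm (E Q x).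
  have -> : E Q z - v *r E Q x = (E Q z - h t *r E Q x) + (h t - v) *r E Q x.
    by rewrite rmorphB/= scalerBl addrA subrK.
  apply: le_trans (nmD _ _) _; rewrite lerD2l nmZ ler_wpM2r ?nm_ge0//.
move=> h2; have := le_trans h1 (lerD h2 (lexx _)).
rewrite -!nm2.
have := nm_ge0 (E Q x); have := nm_ge0 (E Q u1); have := nm_ge0 (E Q u2).
have := nm_ge0 (E Q z - v *r E Q x).
move: (nm (E Q z - v *r E Q x)) (nm (E Q x)) (nm (E Q u1)) (nm (E Q u2)).
move=> p a b c p0 c0 b0 a0 hp.
have s0 : 0 <= d * (b + c) + e * a by rewrite addr_ge0 ?mulr_ge0 ?addr_ge0// ltW.
have : p ^+ 2 <= (d * (b + c) + e * a) ^+ 2 by rewrite ler_pXn2r ?nnegrE.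
have : 0 <= d * (e * a - (b + c)) ^+ 2 by rewrite mulr_ge0 ?sqr_ge0// ltW.
have : 0 <= (d ^+ 2 + d) * (b - c) ^+ 2 by rewrite mulr_ge0 ?sqr_ge0//; lra.
nra.
Qed.

Lemma local_linear f (a : R[i]) x x' y y' : measurable_fun setT f ->
  local E f x y -> local E f x' y' -> local E f (a *: x + x') (a *: y + y').
Proof.
move=> mf h h'; apply: (@local_of_fine f f f _ _ (a *: x) x') => // d S t d0 _ mS St hS.
have hS' s : S s -> `|f s - f t| <= d by move=> /hS[].
have := h S _ _ mS hS'; have := h' S _ _ mS hS'.
rewrite [E S (a *: y + y')]linearP [E S (a *: x + x')]linearP [E S (a *: x)]linearZ/=.
have -> : a *: E S y + E S y' - f t *r (a *: E S x + E S x') =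
   a *: (E S y - f t *r E S x) + (E S y' - f t *r E S x').
  by rewrite scalerBr scalerDr opprD addrACA !scalerA (mulrC a).
rewrite !nmZc => h1 h2; apply: le_trans (nmD _ _) _; rewrite nmZc.
have a0 : 0 <= complex.Re `|a| by rewrite -ler0c RRe_real ?normr_real.
have := ler_wpM2l a0 h2; lra.
Qed.

Lemma local0 f : local E f 0 0.
Proof.
by move=> S v e mS _; rewrite linear0 scaler0 subrr nm0 mulr0.
Qed.

Lemma localZ f (a : R[i]) x y : measurable_fun setT f ->
  local E f x y -> local E f (a *: x) (a *: y).
Proof.
by move=> mf h; have := local_linear a mf h (@local0 f); rewrite !addr0.
Qed.

Lemma local_closed f (xs ys : nat -> V) x y : cvs xs x -> cvs ys y ->
  (forall n, local E f (xs n) (ys n)) -> local E f x y.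
Proof.
move=> cx cy h S v e mS hS; rewrite -subr_le0; apply: small_eq => q q0.
have [->|/set0P[t0 St0]] := eqVneq S set0.
  by rewrite !pvm_set0// scaler0 subrr nm0 mulr0 subrr ltW.
have e0 : 0 <= e by apply: le_trans (hS _ St0).
have sE := pvm_sa pE mS.
have q3 : 0 < q / (e + 2) by rewrite divr_gt0//; lra.
have cx' := cvs_adj sE cx; have cy' := cvs_adj sE cy.
have [N hN] := cvsB cy' (cvsZ v cx') q3; have [N' hN'] := cx' _ q3.
have := hN (maxn N N') (leq_maxl _ _); have := hN' (maxn N N') (leq_maxr _ _).
have := h (maxn N N') S v e mS hS.
set a := E S _ - _; set b := E S _ - _; set xn := E S (xs _) => h1 h2 h3.
have h4 : nm b <= nm a + nm (a - b) by have := nm_tri a b 0; rewrite !subr0 (nmB b) addrC.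
have h5 : nm xn <= nm (E S x) + nm (xn - E S x).
  by have := nm_tri (E S x) xn 0; rewrite !subr0 addrC.
have h6 : (e + 2) * (q / (e + 2)) = q by rewrite mulrC divfK// gt_eqF//; lra.
have := ler_wpM2l e0 h5; have := ler_wpM2l e0 (ltW h2); lra.
Qed.

Lemma local_proj f S x y : measurable S -> local E f x y -> local E f (E S x) (E S y).
Proof.
move=> mS h T v e mT hT; rewrite !pvm_setI//; apply: h; first exact: measurableI.
by move=> t [/hT].
Qed.

Lemma local_proj_fix f S x y : measurable_fun setT f -> measurable S ->
  local E f x y -> E S x = x -> E S y = y.
Proof.
move=> mf mS h e; have := local_proj mS h; rewrite e => h'.
exact: local_unique mf h' h.
Qed.

Lemma local_ip_le f x y x' y' : measurable_fun setT f ->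
  local E f x y -> local E f x' y' -> ip y x' - ip x y' <= 0.
Proof.
move=> mf h h'; apply: small_eq => e e0.
have K0 : 0 < ip x x + ip x' x' + 1 by rewrite ltr_wpDl// addr_ge0 ?ip_ge0.
pose q := e / (ip x x + ip x' x' + 1); have q0 : 0 < q by rewrite divr_gt0.
have qe : q * ip x x + q * ip x' x' + 0 * ip (0 : V) (0 : V) <= e.
  have -> : e = q * (ip x x + ip x' x' + 1) by rewrite divfK// gt_eqF.
  by rewrite mul0r; lra.
apply: le_trans qe; have [S [mS tS uS hS]] := fine_partition mf mf q0.
apply: (parseval_le pE (S := S)) => //; rewrite ?ltW// => k.
rewrite linear0 ip0l mul0r addr0.
have [->|/set0P[t St]] := eqVneq (S k) set0.
  by rewrite !pvm_set0// !ip0l subrr !mulr0 addr0.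
have hk s : S k s -> `|f s - f t| <= q by move=> Ss; have [] := hS k s t Ss St.
have := h _ _ _ (mS k) hk; have := h' _ _ _ (mS k) hk.
move: (E (S k) x) (E (S k) x') (E (S k) y) (E (S k) y') => p p' r r' h1 h2.
have -> : ip r p' - ip p r' = ip (r - f t *r p) p' + ip (- p) (r' - f t *r p').
  by rewrite !ipE; ring.
have h3 := ip_le (r - f t *r p) p'; have := ip_le (- p) (r' - f t *r p').
have h5 := ler_wpM2r (nm_ge0 p') h2; have h6 := ler_wpM2l (nm_ge0 p) h1.
rewrite nmN -!nm2; have := mulr_ge0 (ltW q0) (sqr_ge0 (nm p - nm p')); lra.
Qed.

(** f is real, so f(T) is symmetric. *)
Lemma local_sym f x y x' y' : measurable_fun setT f ->
  local E f x y -> local E f x' y' -> '[y, x'] = '[x, y'].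
Proof.
move=> mf h h'; have e u v : local E f u v -> ip y u = ip x v.
  move=> hu; have := local_ip_le mf h hu; have := local_ip_le mf hu h.
  by rewrite (ipC v) (ipC u); lra.
by rewrite !innerE (e _ _ h') (e _ _ (localZ 'i%C mf h')).
Qed.

(** Positivity on the part of the spectrum on which x lives. *)
Lemma local_ge f S x y (m : R) : measurable_fun setT f -> measurable S ->
  local E f x y -> E S x = x -> (forall t, S t -> m <= f t) ->
  m * ip x x <= ip y x.
Proof.
move=> mf mS h ex hm; have ey := local_proj_fix mf mS h ex.
rewrite -subr_le0; apply: small_eq => e e0.
have K0 : 0 < ip x x + 1 by rewrite ltr_wpDl ?ip_ge0.
pose q := e / (ip x x + 1); have q0 : 0 < q by rewrite divr_gt0.
have qe : q * ip x x + 0 * ip (0 : V) (0 : V) + 0 * ip (0 : V) (0 : V) <= e.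
  have -> : e = q * (ip x x + 1) by rewrite divfK// gt_eqF.
  by rewrite !mul0r; lra.
apply: le_trans qe; have [P [mP tP uP hP]] := fine_partition mf mf q0.
rewrite -ipZl; apply: (parseval_le pE (S := P)) => //; rewrite ?ltW// => k.
rewrite linear0 ip0l !mul0r !addr0 linearZ/= ipZl -ex -ey !pvm_setI//.
have mk : measurable (P k `&` S) by exact: measurableI.
have [->|/set0P[t [Pt St]]] := eqVneq (P k `&` S) set0.
  by rewrite !pvm_set0// !ip0l !mulr0 subr0.
have hk s : (P k `&` S) s -> `|f s - f t| <= q.
  by move=> [Ps _]; have [] := hP k s t Ps Pt.
have := h _ _ _ mk hk; have := hm t St.
move: (E _ x) (E _ y) => p r h1 h2.
have := ip_cauchy_schwarz (r - f t *r p) p; have := ler_wpM2r (nm_ge0 p) h2.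
rewrite !ipE ler_norml -mulrA -expr2 nm2 => h4 /andP[h3 _].
have := ler_wpM2r (ip_ge0 p) h1; lra.
Qed.

End Local.

(** * Existence and algebra of functions of T *)

Section Calculus.
Context (R : realType) (V : hilbertType R).
Implicit Types (x y z u w : V) (S T : set R) (f g h : R -> R).
Variable E : set R -> {linear V -> V}.
Hypothesis pE : projection_valued_measure E.

(** The measure f^2 d<E(.) x, x> is dominated by d<E(.) u, u> for some u: this
    replaces the square integrability of f. *)
Definition dominated f x := exists u, forall S (c : R), measurable S -> 0 <= c ->
  (forall t, S t -> c <= `|f t|) -> c * nm (E S x) <= nm (E S u).

Lemma nm_pvm_le S x : measurable S -> nm (E S x) <= nm x.
Proof.
move=> mS; rewrite -(@ler_pXn2r _ 2) ?nnegrE ?nm_ge0// !nm2 -pvm_ip//.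
have := ip_ge0 (x - E S x).
by rewrite !ipE (ipC x) pvm_ip//; lra.
Qed.

(** The vector u with E_P u = w_k E_P x on each piece. *)
Lemma dominated_of_partition (P : nat -> set R) (w : nat -> R) (K : R) f x :
  measurable_partition P -> (forall k t, P k t -> `|f t| <= w k) ->
  (forall n, \sum_(0 <= k < n) w k ^+ 2 * ip (E (P k) x) (E (P k) x) <= K) ->
  dominated f x.
Proof.
move=> pP hw hK; have [u hu] := orthogonal_series pE pP hK; exists u.
case: (pP) => mP tP uP S c mS c0 hS.
have -> : c * nm (E S x) = nm (c *r E S x) by rewrite nmZ ger0_norm.
rewrite -(@ler_pXn2r _ 2) ?nnegrE ?nm_ge0// !nm2 -[leRHS]mul1r.
apply: (parseval_le1 pE pP) => // k; rewrite mul1r linearZ/=.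
rewrite (pvm_comm pE x (mP k) mS) (pvm_comm pE u (mP k) mS) hu linearZ/= !pvm_setI//.
have [->|/set0P[t [St Pt]]] := eqVneq (S `&` P k) set0.
  by rewrite !pvm_set0// !scaler0.
rewrite !ipE !mulrA -!expr2 ler_wpM2r ?ip_ge0//.
have cw : c <= w k by apply: le_trans (hS _ St) (hw _ _ Pt).
by rewrite ler_pXn2r ?nnegrE// (le_trans c0).
Qed.

(** With f = g this recovers square summability from the mere existence of
    f(T) x: on a piece where g is within 1 of v, |v| |E_P x| is at most
    |E_P y| + |E_P x|.  The constants come from (3 s + t)^2 <= 18 s^2 + 2 t^2. *)
Lemma local_partition (C : R) f g x y : measurable_fun setT g -> 0 <= C ->
  local E g x y -> (forall t, `|f t| <= C * (1 + `|g t|)) ->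
  exists P (w : nat -> R) (K : R), [/\ measurable_partition P,
    forall k t, P k t -> `|f t| <= w k &
    forall n, \sum_(0 <= k < n) w k ^+ 2 * ip (E (P k) x) (E (P k) x) <= K].
Proof.
move=> mg C0 h hC.
have [P [v [pP hv]]] := sampled_partition mg ltr01; case: (pP) => mP tP uP.
exists P, (fun k => C * (2 + `|v k|)), (C ^+ 2 * (18 * ip x x + 2 * ip y y)).
split=> // [k t Pt|n].
  apply: le_trans (hC t) _; rewrite ler_wpM2l//; have [h1 _] := hv k t Pt.
  have := ler_normD (g t - v k) (v k); rewrite subrK; lra.
have hk k : (C * (2 + `|v k|)) ^+ 2 * ip (E (P k) x) (E (P k) x) <=
    C ^+ 2 * (18 * ip (E (P k) x) (E (P k) x) + 2 * ip (E (P k) y) (E (P k) y)).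
  have := h _ _ _ (mP k) (fun s Ps => (hv k s Ps).1); rewrite mul1r => h1.
  rewrite exprMn -mulrA ler_wpM2l ?sqr_ge0// -!nm2.
  have := nmD (v k *r E (P k) x - E (P k) y) (E (P k) y).
  rewrite subrK (nmB (_ *r _)) nmZ.
  have := nm_ge0 (E (P k) x); have := nm_ge0 (E (P k) y); have := normr_ge0 (v k).
  move: h1; move: (nm (E (P k) x)) (nm (E (P k) y)) (nm (E (P k) y - _)) `|v k| => a b r q.
  move=> ra q0 b0 a0 h2.
  have h3 : (2 + q) * a <= 3 * a + b by lra.
  have h4 : ((2 + q) * a) ^+ 2 <= (3 * a + b) ^+ 2.
    by rewrite ler_pXn2r ?nnegrE// ?mulr_ge0//; lra.
  have := sqr_ge0 (3 * a - b); rewrite exprMn in h4; lra.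
apply: le_trans (ler_sum _ (fun k _ => hk k)) _; rewrite -mulr_sumr big_split/=.
rewrite ler_wpM2l ?sqr_ge0// -!mulr_sumr.
have := bessel pE x n mP tP; have := bessel pE y n mP tP; lra.
Qed.

Lemma local_dominated (C : R) f g x y : measurable_fun setT g -> 0 <= C ->
  local E g x y -> (forall t, `|f t| <= C * (1 + `|g t|)) -> dominated f x.
Proof.
move=> mg C0 h hC; have [P [w [K [pP hw hK]]]] := local_partition mg C0 h hC.
exact: dominated_of_partition pP hw hK.
Qed.

(** Step functions approximating f uniformly produce vectors which are correct up
    to a relative error; by [near_local_dist] these form a Cauchy sequence. *)
Lemma local_exists f x : measurable_fun setT f -> dominated f x ->
  exists y, local E f x y.
Proof.
move=> mf [u hu].
have ex (d : R) : 0 < d -> exists y, near_local E d f x y.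
  move=> d0; have [P [v [pP hv]]] := sampled_partition mf d0.
  case: (pP) => mP tP uP.
  have hk k : v k ^+ 2 * ip (E (P k) x) (E (P k) x) <=
      2 * d ^+ 2 * ip (E (P k) x) (E (P k) x) + 2 * ip (E (P k) u) (E (P k) u).
    have [->|/set0P[t Pt]] := eqVneq (P k) set0.
      by rewrite !pvm_set0// !ip0l !mulr0 addr0.
    have [_ [s Ps vs]] := hv k t Pt; rewrite vs.
    have [sd|sd] := leP `|f s| d.
      have h1 : f s ^+ 2 <= d ^+ 2 by rewrite -real_normK ?num_real// ler_pXn2r ?nnegrE// ltW.
      have := ip_ge0 (E (P k) u); have := ler_wpM2r (ip_ge0 (E (P k) x)) h1.
      have := mulr_ge0 (sqr_ge0 d) (ip_ge0 (E (P k) x)); lra.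
    have := hu (P k) (`|f s| - d) (mP k); rewrite subr_ge0 (ltW sd) => /(_ isT) h1.
    have {}h1 := h1 _; rewrite -(real_normK (num_real (f s))) -!nm2.
    have : (`|f s| - d) * nm (E (P k) x) <= nm (E (P k) u).
      apply: h1 => r Pr; have [h2 _] := hv k r Pr; rewrite vs distrC in h2.
      have := ler_normD (f s - f r) (f r); rewrite subrK; lra.
    have := nm_ge0 (E (P k) x); have := nm_ge0 (E (P k) u).
    move: (nm (E (P k) x)) (nm (E (P k) u)) sd => a b sd b0 a0 h2.
    have h3 : `|f s| * a <= d * a + b by lra.
    have h4 : (`|f s| * a) ^+ 2 <= (d * a + b) ^+ 2.
      by rewrite ler_pXn2r ?nnegrE// ?addr_ge0 ?mulr_ge0// ltW.
    have := sqr_ge0 (d * a - b); rewrite exprMn in h4; lra.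
  have [|y hy] := @orthogonal_series _ _ _ pE P v x (2 * d ^+ 2 * ip x x + 2 * ip u u) pP.
    move=> n; apply: le_trans (ler_sum _ (fun k _ => hk k)) _; rewrite big_split/=.
    rewrite -!mulr_sumr; apply: lerD; apply: ler_wpM2l; rewrite ?(bessel pE)//.
    by rewrite mulr_ge0 ?sqr_ge0.
  exists y => S c e mS hS.
  have [->|/set0P[t0 St0]] := eqVneq S set0.
    by rewrite !pvm_set0// scaler0 subrr nm0 mulr0.
  have e0 : 0 <= e by apply: le_trans (hS _ St0).
  have ed : 0 <= e + d by rewrite addr_ge0// ltW.
  rewrite -(@ler_pXn2r _ 2) ?nnegrE ?mulr_ge0 ?nm_ge0// exprMn !nm2.
  apply: (parseval_le1 pE pP); first exact: sqr_ge0.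
  move=> k; rewrite linearB/= linearZ/= (pvm_comm pE y (mP k) mS) (pvm_comm pE x (mP k) mS).
  rewrite hy linearZ/= !pvm_setI// -scalerBl -rmorphB/=.
  have [->|/set0P[t [St Pt]]] := eqVneq (S `&` P k) set0.
    by rewrite !pvm_set0// !scaler0 ip0l mulr0.
  rewrite !ipE mulrA -expr2 ler_wpM2r ?ip_ge0//.
  rewrite -(real_normK (num_real _)) ler_pXn2r ?nnegrE//.
  have [h1 _] := hv k t Pt; have h2 := hS _ St; rewrite distrC in h1.
  by have := ler_normD (v k - f t) (f t - c); rewrite addrA subrK; lra.
have i0 n : 0 < n.+1%:R^-1 :> R by rewrite invr_gt0.
have /choice[ys hys] : forall n : nat, exists y, near_local E (n.+1%:R^-1) f x y.
  by move=> n; apply: ex.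
have x0 : 0 < nm x + 1 by rewrite ltr_wpDl ?nm_ge0.
have [y yl] : exists y, cvs ys y.
  apply: cauchy_cvs => e e0.
  have [|N hN] := @inv_lt _ (e / (2 * (nm x + 1))).
    by rewrite divr_gt0// mulr_gt0.
  exists N => m n Nm Nn.
  apply: le_lt_trans (near_local_dist pE mf (ltW (i0 m)) (ltW (i0 n)) (hys m) (hys n)) _.
  have := hN _ Nm; have := hN _ Nn; rewrite !ltr_pdivlMr ?mulr_gt0//.
  have := i0 m; have := i0 n; move: (m.+1%:R^-1) (n.+1%:R^-1) => a b a0 b0.
  have := nm_ge0 x; nra.
exists y => S c e mS hS; rewrite -subr_le0; apply: small_eq => q q0.
have [|N hN] := @inv_lt _ (q / (2 * (nm x + 1))); first by rewrite divr_gt0// mulr_gt0.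
have [|N' hN'] := yl (q / 2); first by rewrite divr_gt0.
have := hN (maxn N N') (leq_maxl _ _); have := hN' (maxn N N') (leq_maxr _ _).
have := hys (maxn N N') S c e mS hS; have := i0 (maxn N N').
set r := _.+1%:R^-1; set yn := ys _ => r0 h1 h2; rewrite ltr_pdivlMr ?mulr_gt0// => h3.
have h4 : nm (E S y - c *r E S x) <= nm (E S yn - c *r E S x) + nm (y - yn).
  apply: le_trans (nm_tri (E S yn) _ _) _; rewrite addrC lerD2l -linearB/=.
  exact: nm_pvm_le.
have h5 : r * nm (E S x) <= r * nm x by rewrite ler_wpM2l ?(ltW r0)// nm_pvm_le.
rewrite nmB in h2; nra.
Qed.

Lemma local_exists_le (C : R) f g x y : measurable_fun setT f -> measurable_fun setT g ->
  0 <= C -> local E g x y -> (forall t, `|f t| <= C * (1 + `|g t|)) ->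
  exists z, local E f x z.
Proof.
by move=> mf mg C0 h hC; apply: local_exists => //; exact: local_dominated mg C0 h hC.
Qed.

Lemma local_cst (c : R) x : local E (fun=> c) x (c *r x).
Proof.
move=> S v e mS hS; have [->|/set0P[t /hS ht]] := eqVneq S set0.
  by rewrite !pvm_set0// scaler0 subrr nm0 mulr0.
by rewrite linearZ/= -scalerBl -rmorphB/= nmZ ler_wpM2r ?nm_ge0.
Qed.

Lemma local_id1 x : local E (fun=> 1) x x.
Proof. by rewrite -{2}[x]scale1r; exact: local_cst. Qed.

Lemma local_exists_bounded (C : R) f x : measurable_fun setT f ->
  (forall t, `|f t| <= C) -> exists z, local E f x z.
Proof.
move=> mf hC; have C0 : 0 <= C by apply: le_trans (hC 0).
apply: (@local_exists_le C f (fun=> 1) x x) => // [|t]; first exact: local_id1.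
by apply: le_trans (hC t) _; rewrite normr1; lra.
Qed.

Lemma local_add f g x y z : measurable_fun setT f -> measurable_fun setT g ->
  local E f x y -> local E g x z -> local E (fun t => f t + g t) x (y + z).
Proof.
move=> mf mg hf hg; apply: (@local_of_fine _ _ _ pE f g _ _ _ x x) => // d S t d0 _ mS St hS.
have := hf S _ _ mS (fun s Ss => (hS s Ss).1); have := hg S _ _ mS (fun s Ss => (hS s Ss).2).
have -> : E S (y + z) - (f t + g t) *r E S x = (E S y - f t *r E S x) + (E S z - g t *r E S x).
  by rewrite linearD/= rmorphD/= scalerDl opprD addrACA.
by have := nmD (E S y - f t *r E S x) (E S z - g t *r E S x); lra.
Qed.

Lemma local_opp f x y : local E f x y -> local E (fun t => - f t) x (- y).
Proof.
move=> h S v e mS hS; rewrite linearN/= -opprD nmN -[v *r _]opprK -scaleNr -rmorphN/=.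
by apply: h => // t /hS; rewrite -normrN opprD !opprK.
Qed.

Lemma local_sub f g x y z : measurable_fun setT f -> measurable_fun setT g ->
  local E f x y -> local E g x z -> local E (fun t => f t - g t) x (y - z).
Proof.
move=> mf mg hf /local_opp hg; exact: (local_add mf (measurable_funN mg) hf hg).
Qed.

(** E z - g f E x = (E z - g E y) + g (E y - f E x) on small pieces, so that a
    bound on g suffices. *)
Lemma local_mul (C : R) f g x y z : measurable_fun setT f -> measurable_fun setT g ->
  0 <= C -> (forall t, `|g t| <= C) ->
  local E f x y -> local E g y z -> local E (fun t => g t * f t) x z.
Proof.
move=> mf mg C0 hC hf hg; apply: (@local_of_fine _ _ _ pE f g _ _ _ y (C *r x)) => // d S t d0 _ mS St hS.
have := hf S _ _ mS (fun s Ss => (hS s Ss).1); have := hg S _ _ mS (fun s Ss => (hS s Ss).2).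
have -> : E S z - (g t * f t) *r E S x = (E S z - g t *r E S y) + g t *r (E S y - f t *r E S x).
  by rewrite scalerBr scalerA rmorphM/= addrA subrK.
rewrite [E S (C *r x)]linearZ/= (nmZ C) (ger0_norm C0) => h1 h2.
apply: le_trans (nmD _ _) _; rewrite nmZ.
have := ler_pM (normr_ge0 _) (nm_ge0 _) (hC t) h2; lra.
Qed.

(** E y - (r / f) E u = (E y - r E x) - (r / f) (E u - f E x) on small pieces, and
    r / f is at most 1. *)
Lemma local_quot f (r : R -> R) x u y : measurable_fun setT f -> measurable_fun setT r ->
  (forall t, 1 <= `|f t|) -> (forall t, `|r t| <= `|f t|) ->
  local E f x u -> local E r x y -> local E (fun t => r t / f t) u y.
Proof.
move=> mf mr f1 rf hf hr; apply: (@local_of_fine _ _ _ pE f r _ _ _ x x) => // d S t d0 _ mS St hS.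
have := hf S _ _ mS (fun s Ss => (hS s Ss).1); have := hr S _ _ mS (fun s Ss => (hS s Ss).2).
have ft : 0 < `|f t| by apply: lt_le_trans (f1 t).
have ft0 : f t != 0 by rewrite -normr_gt0.
have -> : E S y - (r t / f t) *r E S u =
    (E S y - r t *r E S x) - (r t / f t) *r (E S u - f t *r E S x).
  by rewrite scalerBr rscaleA divfK// opprB addrA subrK.
move=> h1 h2; apply: le_trans (nmD _ _) _; rewrite nmN nmZ.
have q1 : `|r t / f t| <= 1 by rewrite normf_div ler_pdivrMr// mul1r.
have := ler_pM (normr_ge0 _) (nm_ge0 _) q1 h2; lra.
Qed.

Lemma local_inv f x u : measurable_fun setT f -> (forall t, 1 <= `|f t|) ->
  local E (fun t => 1 / f t) u x -> local E f x u.
Proof.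
move=> mf f1 hf; apply: (@local_of_fine _ _ _ pE f f _ _ _ u u) => // d S t d0 _ mS St hS.
have f0 s : 0 < `|f s| by apply: lt_le_trans (f1 s).
have f00 s : f s != 0 by rewrite -normr_gt0.
have h s : S s -> `|1 / f s - 1 / f t| <= d / `|f t|.
  move=> /hS[hs _].
  have -> : 1 / f s - 1 / f t = (f t - f s) / (f s * f t) by field; rewrite !f00.
  rewrite normf_div normrM ler_pdivrMr ?mulr_gt0// mulrCA mulrC divfK ?gt_eqF//.
  by rewrite distrC (le_trans hs)// ler_pMr.
have h1 := hf S _ _ mS h.
have -> : E S u - f t *r E S x = (- f t) *r (E S x - (1 / f t) *r E S u).
  by rewrite scalerBr rscaleA mulNr mulrC divfK// rmorphN1 scaleN1r opprK addrC rmorphN scaleNr.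
rewrite nmZ normrN; have := ler_wpM2l (normr_ge0 (f t)) h1.
rewrite mulrA [_ * (d / _)]mulrC divfK ?gt_eqF//.
have := mulr_ge0 (ltW d0) (nm_ge0 (E S u)); lra.
Qed.

Lemma local_recip f x u : measurable_fun setT f -> (forall t, 1 <= `|f t|) ->
  local E f x u -> local E (fun t => 1 / f t) u x.
Proof.
move=> mf f1 hf; apply: (local_quot mf _ f1 _ hf (local_id1 x)) => [|t].
  exact: measurable_cst.
by rewrite normr1.
Qed.

Lemma pvm_bigcup0 (F : nat -> set R) x : (forall n, measurable (F n)) ->
  (forall n, E (F n) x = 0) -> E (\bigcup_n F n) x = 0.
Proof.
move=> mF F0; have mD n : measurable (seqDU F n).
  by apply: measurableD => //; exact: bigsetU_measurable.
have := pvm_series pE x mD (@trivIset_seqDU _ F); rewrite -seqDU_bigcup_eq => h.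
apply: (cvs_uniq h); move: (cvs_cst (0 : V)); congr cvs; apply/funext => n.
rewrite big1// => k _; rewrite (_ : seqDU F k = seqDU F k `&` F k).
  by rewrite -pvm_setI// F0 linear0.
by apply/esym/setIidPl; exact: subset_seqDU.
Qed.

(** If f is positive on the part of the spectrum carrying x, then <f(T) x, x> <= 0
    only for x = 0: exhaust this part by the sets where f >= 1 / (n + 1). *)
Lemma local_pos f S x y : measurable_fun setT f -> measurable S ->
  local E f x y -> E S x = x -> (forall t, S t -> 0 < f t) -> ip y x <= 0 -> x = 0.
Proof.
move=> mf mS h ex fpos yx.
pose F n := S `&` f @^-1` `[n.+1%:R^-1, +oo[%classic.
have mF n : measurable (F n).
  by apply: measurableI => //; rewrite -[X in measurable X]setTI; apply: mf.
have SF : S = \bigcup_n F n.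
  apply/seteqP; split => [t St|t [n _ []]//].
  have [N hN] := inv_lt (fpos t St); exists N => //; split => //=.
  by rewrite in_itv/= andbT ltW// hN.
rewrite -ex SF; apply: pvm_bigcup0 => // n.
have mC : measurable (~` F n) by exact: measurableC.
have dec w : w = E (F n) w + E (~` F n) w.
  by rewrite -pvm_setU// ?setICr// setUv pvm_setT.
have h1 : n.+1%:R^-1 * ip (E (F n) x) (E (F n) x) <= ip (E (F n) y) (E (F n) x).
  apply: (local_ge pE mf (mF n)); first exact: local_proj.
    by rewrite pvm_idem.
  by move=> t [_ /=]; rewrite in_itv/= andbT.
have h2 : 0 * ip (E (~` F n) x) (E (~` F n) x) <= ip (E (~` F n) y) (E (~` F n) x).
  apply: (local_ge pE (S := S `&` ~` F n) mf); first exact: measurableI.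
    exact: local_proj.
  - have -> : E (S `&` ~` F n) (E (~` F n) x) = E (S `&` ~` F n) x.
      by rewrite pvm_setI//; [congr (E _ x); rewrite -setIA setIid|exact: measurableI].
    by rewrite -pvm_setI// (pvm_comm pE x mS mC) ex.
  - by move=> t [/fpos/ltW].
have h3 : ip y x = ip (E (F n) y) (E (F n) x) + ip (E (~` F n) y) (E (~` F n) x).
  rewrite {1}(dec x) ipDr -{1}(pvm_idem pE x (mF n)) -{1}(pvm_idem pE x mC).
  by rewrite -!(adj_ip _ _ (pvm_sa pE _)).
apply: ip_eq0; apply/eqP; rewrite eq_le ip_ge0 andbT.
have i0 : 0 < n.+1%:R^-1 :> R by rewrite invr_gt0.
rewrite -(pmulr_rle0 _ i0); rewrite mul0r in h2.
by apply: le_trans h1 _; lra.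
Qed.

Lemma local_kernel f S x : measurable_fun setT f -> measurable S ->
  local E f x 0 -> (forall t, S t -> 0 < f t) -> E S x = 0.
Proof.
move=> mf mS h fpos; apply: (local_pos mf mS (local_proj pE mS h)) => //.
  by rewrite pvm_idem.
by rewrite linear0 ip0l.
Qed.

(** On small pieces E x - E z / (1 + t^2) and E y - t E z / (1 + t^2) are
    combinations, with coefficients at most 1, of the errors in the two
    relations. *)
Lemma local_resolvent x y z : local E id x y -> local E id y (z - x) ->
  local E (fun t => 1 / (1 + t ^+ 2)) z x /\ local E (fun t => t / (1 + t ^+ 2)) z y.
Proof.
move=> h1 h2; have mid : measurable_fun setT (@id R) by exact: measurable_id.
have k (t : R) : 0 < 1 + t ^+ 2 :> R by rewrite ltr_pwDl ?sqr_ge0.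
have k1 (t : R) : 1 + t ^+ 2 != 0 :> R by rewrite gt_eqF.
have kt (t : R) : `|t| <= 1 + t ^+ 2 :> R.
  by rewrite -[t ^+ 2]real_normK ?num_real//; have := sqr_ge0 (`|t| - 1); have := normr_ge0 t; nra.
have k2 (t : R) : `|1 / (1 + t ^+ 2)| <= 1.
  rewrite ger0_norm; last by rewrite (divr_ge0 ler01 (ltW (k t))).
  by rewrite ler_pdivrMr// mul1r lerDl sqr_ge0.
have k3 (t : R) : `|t / (1 + t ^+ 2)| <= 1.
  by rewrite normrM normfV (gtr0_norm (k t)) ler_pdivrMr// mul1r.
have aux (p q a b : R) (A B : V) (d : R) : `|p| <= 1 -> `|q| <= 1 -> nm A <= d * a -> nm B <= d * b ->
    nm (p *r A + q *r B) <= d * (a + b).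
  move=> p1 q1 hA hB; apply: le_trans (nmD _ _) _; rewrite !nmZ.
  have := ler_pM (normr_ge0 _) (nm_ge0 _) p1 hA; have := ler_pM (normr_ge0 _) (nm_ge0 _) q1 hB; lra.
split; apply: (@local_of_fine _ _ _ pE id id _ _ _ x y) => // d S t d0 _ mS St hS;
  have g1 := h1 S _ _ mS (fun s Ss => (hS s Ss).1);
  have g2 := h2 S _ _ mS (fun s Ss => (hS s Ss).2).
- have -> : E S x - (1 / (1 + t ^+ 2)) *r E S z =
     (- (t / (1 + t ^+ 2))) *r (E S y - t *r E S x) + (- (1 / (1 + t ^+ 2))) *r (E S (z - x) - t *r E S y).
    by rewrite linearB/=; apply: ip_inj => w; rewrite !ipE; field.
  by apply: aux => //; rewrite normrN.
- have -> : E S y - (t / (1 + t ^+ 2)) *r E S z =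
     (1 / (1 + t ^+ 2)) *r (E S y - t *r E S x) + (- (t / (1 + t ^+ 2))) *r (E S (z - x) - t *r E S y).
    by rewrite linearB/=; apply: ip_inj => w; rewrite !ipE; field.
  by apply: aux => //; rewrite normrN.
Qed.

End Calculus.

(** * Integration against the spectral measure *)

Section Mass.
Import HBNNSimple.
Context (R : realType) (V : hilbertType R).
Variable E : set R -> {linear V -> V}.

(** A measure has to be nonnegative on non-measurable sets as well, where
    <E S x, x> can take any value; hence the truncation. *)
Definition mass (_ : projection_valued_measure E) (x : V) (S : set R) : \bar R :=
  if `[< measurable S >] then (ip (E S x) (E S x))%:E else 0%E.

Variables (pE : projection_valued_measure E) (x : V).
Local Notation mu := (mass pE x).

Lemma massE S : measurable S -> mu S = (ip (E S x) (E S x))%:E.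
Proof. by move=> mS; rewrite /mass asboolT. Qed.

Let mass0 : mu set0 = 0%E.
Proof. by rewrite massE// (pvm_set0 pE) ip0l. Qed.

Let mass_ge0 S : (0 <= mu S)%E.
Proof. by rewrite /mass; case: ifP => // _; rewrite lee_fin ip_ge0. Qed.

Let mass_sigma_additive : semi_sigma_additive mu.
Proof.
move=> F mF tF mU.
rewrite massE// (_ : (fun n => _) = (EFin \o (fun n => \sum_(0 <= k < n) ip (E (F k) x) (E (F k) x)))).
  apply: cvg_EFin; first by near=> n.
  apply/cvgrPdist_lt => e e0.
  have [N hN] := cvs_ip x (pvm_series pE x mF tF) e0.
  exists N => // n /= /hN; rewrite distrC pvm_ip//; congr (`|_ - _| < _).
  by elim: n => [|n ih]; rewrite ?big_nil ?ip0l// !big_nat_recr//= ipDl ih pvm_ip.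
apply/funext => n /=; rewrite -sumEFin; apply: eq_bigr => k _; exact: massE.
Unshelve. all: by end_near. Qed.

HB.instance Definition _ := isMeasure.Build _ R R mu
  mass0 mass_ge0 mass_sigma_additive.

Lemma integral_mass (g : R -> \bar R) :
  (\int[spectral_mass E x]_t g t = \int[mu]_t g t)%E.
Proof.
have e (h : {nnsfun R >-> R}) : sintegral (spectral_mass E x) h = sintegral mu h.
  rewrite /sintegral; apply: eq_fsbigr => r _.
  have mh : measurable (h @^-1` [set r]) by exact: measurable_sfunP.
  by rewrite massE// /spectral_mass -/(ip _ _) pvm_ip.
rewrite /integral; congr (ereal_sup _ - ereal_sup _)%E;
  by apply/seteqP; split => _ [h hh <-]; exists h => //; rewrite e.
Qed.

Lemma integral_le_partition (P : nat -> set R) (g : R -> R) (b : nat -> R) (K : R) :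
  measurable_partition P -> measurable_fun setT g -> (forall t, 0 <= g t) ->
  (forall k t, P k t -> g t <= b k) ->
  (forall n, \sum_(0 <= k < n) b k * ip (E (P k) x) (E (P k) x) <= K) ->
  (\int[mu]_t (g t)%:E <= K%:E)%E.
Proof.
move=> [mP tP uP] mg g0 gb hK.
have mgE : measurable_fun setT (EFin \o g) by apply/measurable_EFinP.
rewrite -uP ge0_integral_bigcup//=; last 2 first.
- by rewrite uP.
- by move=> t _; rewrite lee_fin.
apply: lime_le.
  by apply: is_cvg_nneseries => n _ _; apply: integral_ge0 => t _; rewrite lee_fin.
apply: nearW => n.
apply: (@le_trans _ _ (\sum_(0 <= k < n) (b k * ip (E (P k) x) (E (P k) x))%:E)%E).
  apply: lee_sum => k _.
  have [e|/set0P[t Pt]] := eqVneq (P k) set0.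
    by rewrite e integral_set0 (pvm_set0 pE) ip0l mulr0.
  have b0 : 0 <= b k by apply: le_trans (g0 t) (gb _ _ Pt).
  rewrite EFinM -(massE (mP k)) -integral_cst//.
  apply: ge0_le_integral => //=.
  - by move=> s _; rewrite lee_fin.
  - exact: measurable_funS mgE.
  - by move=> s Ps; rewrite lee_fin gb.
by rewrite sumEFin lee_fin.
Qed.

Lemma integral_ge_partition (P : nat -> set R) (g : R -> R) (a : nat -> R) n :
  measurable_partition P -> measurable_fun setT g -> (forall t, 0 <= g t) ->
  (forall k t, P k t -> a k <= g t) ->
  ((\sum_(0 <= k < n) a k * ip (E (P k) x) (E (P k) x))%:E <= \int[mu]_t (g t)%:E)%E.
Proof.
move=> [mP tP uP] mg g0 ag.
have mgE : measurable_fun setT (EFin \o g) by apply/measurable_EFinP.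
rewrite -uP ge0_integral_bigcup//=; last 2 first.
- by rewrite uP.
- by move=> t _; rewrite lee_fin.
apply: le_trans (nneseries_lim_ge n _); last first.
  by move=> k _ _; apply: integral_ge0 => t _; rewrite lee_fin.
rewrite -sumEFin; apply: lee_sum => k _.
have [a0|a0] := leP 0 (a k); last first.
  apply: (@le_trans _ _ 0%E).
    by rewrite lee_fin mulr_le0_ge0 ?ip_ge0// ltW.
  by apply: integral_ge0 => t _; rewrite lee_fin.
rewrite EFinM -(massE (mP k)) -integral_cst//.
apply: ge0_le_integral => //=.
- exact: measurable_funS mgE.
- by move=> s Ps; rewrite lee_fin ag.
Qed.

End Mass.

Section SpectralIntegral.
Context (R : realType) (V : hilbertType R).
Implicit Types (x y z u w : V) (S T : set R) (f g h : R -> R).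
Variables (E : set R -> {linear V -> V}) (pE : projection_valued_measure E).

Lemma measurable_sqr f : measurable_fun setT f -> measurable_fun setT (fun t => f t ^+ 2).
Proof. by move=> mf; apply: measurable_funX. Qed.

Lemma dominated_partition f x : measurable_fun setT f -> dominated E f x ->
  exists P (w : nat -> R) (K : R), [/\ measurable_partition P,
    forall k t, P k t -> `|f t| <= w k &
    forall n, \sum_(0 <= k < n) w k ^+ 2 * ip (E (P k) x) (E (P k) x) <= K].
Proof.
move=> mf /(local_exists pE mf)[y hy].
by apply: (local_partition pE (C := 1) mf _ hy) => // t; rewrite mul1r; lra.
Qed.

(** Both conditions amount to a bound on the sums of w_k^2 |E_P x|^2 over a
    partition with |f| <= w_k on its pieces. *)
Lemma spectral_domP f x : measurable_fun setT f ->
  spectral_dom E f x <-> dominated E f x.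
Proof.
move=> mf; rewrite /spectral_dom /= (integral_mass pE).
have mf2 := measurable_sqr mf.
have [P [v [pP hv]]] := sampled_partition mf ltr01.
case: (pP) => mP tP uP.
split=> [fin|/(dominated_partition mf) [Q [w [K [pQ hw hK]]]]].
- pose K := fine (\int[mass pE x]_t ((f t) ^+ 2)%:E)%E.
  have KE : (\int[mass pE x]_t ((f t) ^+ 2)%:E)%E = K%:E.
    rewrite fineK// ge0_fin_numE//; apply: integral_ge0 => t _.
    by rewrite lee_fin sqr_ge0.
  apply: (@dominated_of_partition _ _ _ pE P (fun k => `|v k| + 1) (2 * K + 8 * ip x x)) => //.
    move=> k t Pt; have [h _] := hv k t Pt.
    have := ler_normD (f t - v k) (v k); rewrite subrK; lra.
  move=> n.
  have h1 : \sum_(0 <= k < n) ((`|v k| + 1) ^+ 2 - 8) / 2 * ip (E (P k) x) (E (P k) x) <= K.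
    rewrite -lee_fin -KE; apply: (integral_ge_partition pE x n pP mf2) => [t|k t Pt].
      exact: sqr_ge0.
    have [h _] := hv k t Pt.
    have := ler_normD (v k - f t) (f t); rewrite subrK (distrC (v k)) => h1.
    rewrite -(real_normK (num_real (f t))).
    have := normr_ge0 (f t); have := normr_ge0 (v k).
    have := sqr_ge0 (`|f t| - 2).
    move: h h1; move: `|f t - v k| `|f t| `|v k| => c a b h h1 h2 b0 a0; nra.
  have h2 := bessel pE x n mP tP.
  suff -> : \sum_(0 <= k < n) (`|v k| + 1) ^+ 2 * ip (E (P k) x) (E (P k) x) =
    2 * (\sum_(0 <= k < n) ((`|v k| + 1) ^+ 2 - 8) / 2 * ip (E (P k) x) (E (P k) x)) +
    8 * \sum_(0 <= k < n) ip (E (P k) x) (E (P k) x) by lra.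
  by rewrite !mulr_sumr -big_split/=; apply: eq_bigr => k _; field.
- apply: (@le_lt_trans _ _ K%:E); last by rewrite ltry.
  apply: (integral_le_partition pE (b := fun k => w k ^+ 2) pQ mf2) => [t|k t Qt|n].
  + exact: sqr_ge0.
  + by rewrite -(real_normK (num_real (f t))) ler_pXn2r ?nnegrE ?hw// ?(le_trans _ (hw _ _ Qt)).
  + exact: hK.
Qed.

Lemma parseval_ip_le (P : nat -> set R) y x n : measurable_partition P ->
  (forall k, 0 <= ip (E (P k) y) (E (P k) x)) ->
  \sum_(0 <= k < n) ip (E (P k) y) (E (P k) x) <= ip y x.
Proof.
move=> pP r0; rewrite -subr_le0; apply: small_eq => e e0.
have [N hN] := parseval_ip pE y x pP e0.
have := hN (maxn N n) (leq_maxl _ _).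
have : \sum_(0 <= k < n) ip (E (P k) y) (E (P k) x) <=
       \sum_(0 <= k < maxn N n) ip (E (P k) y) (E (P k) x).
  rewrite [leRHS](@big_cat_nat _ _ _ n)//= ?leq_maxr// lerDl.
  by apply: sumr_ge0 => k _.
by rewrite ltr_norml => h /andP[_ ?]; lra.
Qed.

(** On a piece P where f is within d of v, both the integral of f and <E_P y, x>
    are within d |E_P x|^2 of v |E_P x|^2. *)
Lemma local_integral_ge0 f x y : measurable_fun setT f -> (forall t, 0 <= f t) ->
  local E f x y -> (\int[mass pE x]_t (f t)%:E = (ip y x)%:E)%E.
Proof.
move=> mf f0 h.
have r0 S : measurable S -> 0 <= ip (E S y) (E S x).
  move=> mS; have := local_ge pE mf mS (local_proj pE mS h) (pvm_idem pE x mS) (fun t _ => f0 t).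
  by rewrite mul0r.
have main (e : R) : 0 < e -> (\int[mass pE x]_t (f t)%:E <= (ip y x + e)%:E)%E /\
    ((ip y x - e)%:E <= \int[mass pE x]_t (f t)%:E)%E.
  move=> e0; have x0 : 0 < ip x x + 1 by rewrite ltr_wpDl ?ip_ge0.
  pose d := e / (4 * (ip x x + 1)).
  have d0 : 0 < d by rewrite divr_gt0// mulr_gt0.
  have dx : 2 * d * ip x x <= e / 2.
    have -> : e / 2 = 2 * d * (ip x x + 1) by rewrite /d; field; rewrite gt_eqF.
    apply: ler_wpM2l; first by rewrite mulr_ge0 ?(ltW d0).
    by rewrite lerDl.
  have [P [v [pP hv]]] := sampled_partition mf d0.
  case: (pP) => mP tP uP.
  have hk k : `|ip (E (P k) y) (E (P k) x) - v k * ip (E (P k) x) (E (P k) x)| <=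
      d * ip (E (P k) x) (E (P k) x).
    have [e1|/set0P[t Pt]] := eqVneq (P k) set0.
      by rewrite e1 !(pvm_set0 pE) !ip0l !mulr0 subr0 normr0.
    have := h _ _ _ (mP k) (fun s Ps => (hv k s Ps).1).
    have -> : ip (E (P k) y) (E (P k) x) - v k * ip (E (P k) x) (E (P k) x) =
       ip (E (P k) y - v k *r E (P k) x) (E (P k) x) by rewrite !ipE.
    move=> h1; apply: le_trans (ip_cauchy_schwarz _ _) _.
    by rewrite -nm2 expr2 mulrA ler_wpM2r ?nm_ge0.
  have e20 : 0 < e / 2 by rewrite divr_gt0.
  split.
  - apply: (integral_le_partition pE (b := fun k => v k + d) pP mf f0) => [k t Pt|n].
      by have [] := hv k t Pt; rewrite ler_norml => /andP[? ?] _; lra.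
    have h1 : \sum_(0 <= k < n) (v k + d) * ip (E (P k) x) (E (P k) x) <=
       \sum_(0 <= k < n) ip (E (P k) y) (E (P k) x) +
       2 * d * \sum_(0 <= k < n) ip (E (P k) x) (E (P k) x).
      rewrite mulr_sumr -big_split/=; apply: ler_sum => k _.
      by have := hk k; rewrite ler_norml => /andP[? _]; lra.
    have h2 := ler_wpM2l (mulr_ge0 (ler0n _ 2) (ltW d0)) (bessel pE x n mP tP).
    have h3 := parseval_ip_le n pP (fun k => r0 _ (mP k)); lra.
  - have [N hN] := parseval_ip pE y x pP e20.
    apply: le_trans (integral_ge_partition pE x N (a := fun k => v k - d) pP mf f0 _).
      have h1 : \sum_(0 <= k < N) ip (E (P k) y) (E (P k) x) -
         2 * d * (\sum_(0 <= k < N) ip (E (P k) x) (E (P k) x)) <=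
         \sum_(0 <= k < N) (v k - d) * ip (E (P k) x) (E (P k) x).
        rewrite mulr_sumr -sumrB; apply: ler_sum => k _.
        by have := hk k; rewrite ler_norml => /andP[_ ?]; lra.
      have h2 := ler_wpM2l (mulr_ge0 (ler0n _ 2) (ltW d0)) (bessel pE x N mP tP).
      have := hN N (leqnn _); rewrite ltr_norml => /andP[h3 _].
      by rewrite lee_fin; lra.
    by move=> k t Pt; have [] := hv k t Pt; rewrite ler_norml => /andP[? ?] _; lra.
apply/eqP; rewrite eq_le; apply/andP; split; apply/lee_addgt0Pr => e e0.
  by have [] := main e e0.
by have [_] := main e e0; rewrite EFinB leeBlDr.
Qed.

Lemma local_integral f x y : measurable_fun setT f -> local E f x y ->
  fine (\int[spectral_mass E x]_t (f t)%:E)%E = ip y x.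
Proof.
move=> mf h; rewrite (integral_mass pE).
pose f1 := fun t => Num.max (f t) 0; pose f2 := fun t => Num.max (- f t) 0.
have m1 : measurable_fun setT f1 by apply: measurable_maxr => //; exact: measurable_cst.
have m2 : measurable_fun setT f2.
  by apply: measurable_maxr; [exact: measurable_funN|exact: measurable_cst].
have p1 t : 0 <= f1 t by rewrite /f1 le_max lexx orbT.
have p2 t : 0 <= f2 t by rewrite /f2 le_max lexx orbT.
have f12 t : f t = f1 t - f2 t.
  by rewrite /f1 /f2; case: (leP 0 (f t)) => ft; rewrite ?(max_l ft) ?(max_r (ltW ft)); [rewrite max_r|rewrite max_l]; lra.
have [y1 h1] : exists y1, local E f1 x y1.
  apply: (local_exists_le pE (C := 1) m1 mf _ h) => // t; rewrite mul1r ger0_norm//.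
  by rewrite /f1 ge_max; have := ler_norm (f t); have := normr_ge0 (f t); lra.
have [y2 h2] : exists y2, local E f2 x y2.
  apply: (local_exists_le pE (C := 1) m2 mf _ h) => // t; rewrite mul1r ger0_norm//.
  by rewrite /f2 ge_max; have := ler_norm (- f t); rewrite normrN; have := normr_ge0 (f t); lra.
have -> : y = y1 - y2.
  apply: (local_unique pE mf h).
  have := local_sub pE m1 m2 h1 h2.
  by congr local; apply/funext => t; rewrite f12.
rewrite ipDl ipNl integralE (_ : (fun t => (f t)%:E)^\+%E = (fun t => (f1 t)%:E)); last first.
  by apply/funext => t; rewrite funeposE /f1 EFin_max.
rewrite (_ : (fun t => (f t)%:E)^\-%E = (fun t => (f2 t)%:E)); last first.
  by apply/funext => t; rewrite funenegE /f2 EFin_max.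
by rewrite (local_integral_ge0 m1 p1 h1) (local_integral_ge0 m2 p2 h2).
Qed.

Lemma local_real f x y : measurable_fun setT f -> local E f x y ->
  '[y, x] = (ip y x)%:C%C.
Proof.
move=> mf h; have := local_sym pE mf h h; rewrite (innerC y x) /ip.
by case: ('[y, x]) => p q /= [e]; congr (_ +i* _)%C; lra.
Qed.

(** Polarization, spelled out with i^2 = -1. *)
Lemma local_form f x y z w : measurable_fun setT f ->
  local E f x y -> local E f z w -> spectral_form E f x z = '[y, z].
Proof.
move=> mf hx hz; rewrite /spectral_form.
have h (c : R[i]) : (fine (\int[spectral_mass E (x + c *: z)%R]_t (f t)%:E)%E)%:C%C =
    '[y, x] + (c^*)%C * '[y, z] + c * '[w, x] + c * (c^*)%C * '[w, z].
  have hc : local E f (x + c *: z) (y + c *: w).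
    by rewrite addrC (addrC y); exact: local_linear.
  rewrite (local_integral mf hc) -(local_real mf hc).
  by rewrite linearDl !linearDr/= !innerZl !innerZr; ring.
have ii : 'i%C ^+ 2 = -1 :> R[i] by exact: sqr_i.
have ic n : ((('i%C : R[i]) ^+ n)^*)%C = (- 'i%C) ^+ n :> R[i].
  by rewrite rmorphXn/=; congr (_ ^+ n); apply/eqP; rewrite eq_complex /= oppr0 !eqxx.
rewrite !big_ord_recl big_ord0 !h !ic /= /bump /= !(addn0, add0n).
have -> : 'i = 'i%C :> R[i] by [].
move: 'i%C ii => j ii; move: ('[y, x]) ('[y, z]) ('[w, x]) ('[w, z]) => p q r t.
have j3 : j ^+ (1 + (1 + 1)) = - j by rewrite exprS ii mulrN1.
have n2 : (- j) ^+ (1 + 1) = -1 by rewrite sqrrN ii.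
have n3 : (- j) ^+ (1 + (1 + 1)) = j by rewrite exprS n2 mulrN1 opprK.
have jj : j * - j = 1 by rewrite mulrN -expr2 ii opprK.
rewrite n2 j3 n3 !expr1 !expr0 -[j ^+ (1 + 1)]/(j ^+ 2) ii.
apply: (mulfI (_ : 4 != 0 :> R[i])); first by rewrite pnatr_eq0.
rewrite mulrA mulfV ?pnatr_eq0// !mul1r.
rewrite -[RHS]addr0 -[X in _ = _ + X](subrr (q * (j ^+ 2))) ii.
have e : j ^+ 2 * q = - q by rewrite ii mulN1r.
ring: ii.
Qed.

(** A spectral integral y and the local y' have the same inner products with the
    domain; u = y - y' is thus orthogonal to E_Q u whenever f is bounded on Q, so
    that E_Q u = 0 for all such Q. *)
Lemma spectral_integralP f x y : measurable_fun setT f ->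
  spectral_integral E f (x, y) <-> local E f x y.
Proof.
move=> mf; split=> [[/= dx hx]|h].
  have /spectral_domP dx' := dx; have [y' hy'] := local_exists pE mf (dx' mf).
  suff -> : y = y' by [].
  apply/eqP; rewrite -subr_eq0; apply/eqP; set u := y - y'.
  pose F n := f @^-1` `[- n%:R, n%:R]%classic.
  have mF n : measurable (F n) by rewrite -[X in measurable X]setTI; apply: mf.
  have Fu n : E (F n) u = 0.
    have df : dominated E f (E (F n) u).
      exists (n%:R *r u) => S c mS c0 hS; rewrite pvm_setI// linearZ/= nmZ.
      have mI : measurable (S `&` F n) by exact: measurableI.
      have [->|/set0P[t [St]]] := eqVneq (S `&` F n) set0.
        by rewrite (pvm_set0 pE) nm0 mulr0 mulr_ge0 ?nm_ge0.
      rewrite /F /= in_itv/= -ler_norml => ft; apply: ler_pM => //; rewrite ?nm_ge0//.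
        by rewrite ger0_norm//; exact: le_trans (hS _ St) ft.
      by rewrite (setIC S) -(pvm_setI pE u (mF n) mS); exact: (nm_pvm_le pE _ (mF n)).
    have := hx _ ((spectral_domP _ mf).2 df).
    have [w hw] := local_exists pE mf df.
    rewrite (local_form mf hy' hw) => e; apply: ip_eq0.
    rewrite -(adj_ip _ _ (pvm_sa pE (mF n))) (pvm_idem pE)// ipC.
    rewrite ipC (adj_ip _ _ (pvm_sa pE (mF n))) /u ipDl ipNl /ip.
    by rewrite e subrr.
  rewrite -(pvm_setT pE u); have -> : setT = \bigcup_n F n.
    apply/seteqP; split => // t _; exists (Num.truncn `|f t|).+1 => //.
    by rewrite /F /= in_itv/= -ler_norml ltW// truncnS_gt.
  exact: pvm_bigcup0.
split=> /=.
  apply/(spectral_domP x mf)/(local_dominated pE (C := 1) mf _ h) => // t.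
  by rewrite mul1r; lra.
move=> z /(spectral_domP z mf) /(local_exists pE mf)[w hw].
by rewrite (local_form mf h hw).
Qed.

End SpectralIntegral.

(** * The spectral projection of a bounded operator onto its positive part *)

Section Polynomials.
Context (R : realType) (V : hilbertType R).
Implicit Types (x y z u w : V) (A B C D P : V -> V) (p q : {poly R}).

Definition pol D p x := \sum_(i < size p) p`_i *r iter i D x.

Lemma pol_widen D p x n : (size p <= n)%N -> pol D p x = \sum_(i < n) p`_i *r iter i D x.
Proof.
move=> pn; rewrite /pol (big_ord_widen_cond n xpredT (fun i => p`_i *r iter i D x))//.
rewrite [RHS](bigID (fun i : 'I_n => (i < size p)%N))/= [X in _ + X]big1 ?addr0//.
by move=> i; rewrite -leqNgt => h; rewrite nth_default// scale0r.
Qed.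

Lemma polD D p q x : pol D (p + q) x = pol D p x + pol D q x.
Proof.
set n := maxn (size p) (size q).
rewrite (@pol_widen D (p + q) x n) ?size_polyD//.
rewrite (@pol_widen D p x n) ?leq_maxl// (@pol_widen D q x n) ?leq_maxr//.
by rewrite -big_split/=; apply: eq_bigr => i _; rewrite coefD rscaleDl.
Qed.

Lemma polZ D (r : R) p x : pol D (r *: p) x = r *r pol D p x.
Proof.
rewrite (@pol_widen D (r *: p) x (size p)) ?size_scale_leq// /pol scaler_sumr.
by apply: eq_bigr => i _; rewrite coefZ rscaleA.
Qed.

Lemma polC D (r : R) x : pol D r%:P x = r *r x.
Proof. by rewrite (@pol_widen D _ x 1) ?size_polyC_leq1// big_ord1 coefC. Qed.

Lemma polMX D p x : pol D (p * 'X) x = pol D p (D x).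
Proof.
rewrite (@pol_widen D (p * 'X) x (size p).+1) ?size_polyMX_leq//; last first.
  by have [->|p0] := eqVneq p 0; rewrite ?mul0r ?size_poly0// size_mulX.
rewrite big_ord_recl coefMX/= scale0r add0r; apply: eq_bigr => i _.
by rewrite coefMX/= -iterSr.
Qed.

Lemma polN D p x : pol D (- p) x = - pol D p x.
Proof. by rewrite -scaleN1r polZ rmorphN1 scaleN1r. Qed.

Lemma polB D p q x : pol D (p - q) x = pol D p x - pol D q x.
Proof. by rewrite polD polN. Qed.

Lemma polX D x : pol D 'X x = D x.
Proof. by rewrite -['X]mul1r polMX polC scale1r. Qed.

Section Fixed.
Variables (D : V -> V).
Hypothesis sD : sa D.

Lemma polDC p x : D (pol D p x) = pol D p (D x).
Proof.
elim/poly_ind: p x => [|p c ih] x.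
  by rewrite !(polC _ 0) !scale0r (adj0 sD).
by rewrite !polD !polMX !polC (adjD _ _ sD) ih (adjZ _ _ sD).
Qed.

Lemma polM p q x : pol D (p * q) x = pol D p (pol D q x).
Proof.
elim/poly_ind: p q x => [|p c ih] q x.
  by rewrite mul0r !(polC _ 0) !scale0r.
rewrite mulrDl polD -mulrA (mulrC 'X) ih polD !polMX polC mul_polyC polZ.
by rewrite polDC.
Qed.

Lemma sa_pol p : sa (pol D p).
Proof.
elim/poly_ind: p => [|p c ih].
  by move=> x y; rewrite !(polC _ 0) !scale0r linear0l linear0r.
have e x : pol D (p * 'X + c%:P) x = D (pol D p x) + c *r x.
  by rewrite polD polC mulrC polM polX.
move=> x y; rewrite polD polMX polC e.
by rewrite linearDl linearDr/= innerZl innerZr ih sD /= oppr0.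
Qed.

Lemma pol_comm C C' p x : adj C C' -> (forall x, C (D x) = D (C x)) ->
  C (pol D p x) = pol D p (C x).
Proof.
move=> aC CD; elim/poly_ind: p x => [|p c ih] x.
  by rewrite !(polC _ 0) !scale0r (adj0 aC).
by rewrite !polD !polMX !polC (adjD _ _ aC) (adjZ _ _ aC) ih CD.
Qed.

Definition posp p := forall x, 0 <= ip (pol D p x) x.

Lemma pospD p q : posp p -> posp q -> posp (p + q).
Proof. by move=> hp hq x; rewrite polD ipDl addr_ge0. Qed.

Lemma pospZ (r : R) p : 0 <= r -> posp p -> posp (r *: p).
Proof. by move=> r0 hp x; rewrite polZ ipZl mulr_ge0. Qed.

Lemma pospM2 p q : posp p -> posp (q * p * q).
Proof.
by move=> hp x; rewrite -mulrA polM (adj_ip _ _ (sa_pol q)) polM.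
Qed.

Lemma posp_sqr q : posp (q ^+ 2).
Proof. by move=> x; rewrite expr2 polM (adj_ip _ _ (sa_pol q)) ip_ge0. Qed.

End Fixed.

(** Products of commuting positive operators are positive: scaled so that
    A <= 1, the recursion a_(n+1) = a_n - a_n^2 from a_0 = A stays in [0, 1], so
    A B is the sum of the a_n B a_n up to a rest a_n B which is small on x along
    a subsequence. *)
Lemma commuting_pos A B : sa A -> sa B -> (forall x, A (B x) = B (A x)) ->
  (forall x, 0 <= ip (A x) x) -> (forall x, 0 <= ip (B x) x) ->
  forall x, 0 <= ip (A (B x)) x.
Proof.
move=> sA sB AB A0 B0.
have [C C0 hC] := adj_bounded sA; have [K K0 hK] := adj_bounded sB.
pose k := (C + 1)^-1; have k0 : 0 < k by rewrite invr_gt0; lra.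
pose a := fix a n := if n is m.+1 then a m - a m ^+ 2 else k *: 'X.
have a01 n : posp A (a n) /\ posp A (1 - a n).
  elim: n => [|n [h1 h2]] /=.
    split => x; first by rewrite polZ polX ipZl mulr_ge0 ?A0 ?ltW.
    rewrite polB polC polZ polX scale1r !ipE.
    have h : ip (A x) x <= C * ip x x.
      by apply: le_trans (ip_le _ _) _; rewrite -nm2 expr2 mulrA ler_wpM2r ?nm_ge0.
    have : k * ip (A x) x <= k * ((C + 1) * ip x x).
      by rewrite ler_wpM2l ?(ltW k0)//; have := ip_ge0 x; lra.
    by rewrite mulrA mulVf ?mul1r; [lra|rewrite gt_eqF//; lra].
  have -> : a n - a n ^+ 2 = a n * (1 - a n) * a n + (1 - a n) * a n * (1 - a n) by ring.
  have -> : 1 - (a n * (1 - a n) * a n + (1 - a n) * a n * (1 - a n)) = (1 - a n) + a n ^+ 2 by ring.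
  split; apply: pospD => //; try exact: pospM2; exact: posp_sqr.
pose S n x := pol A (a n) x.
have sS n : sa (S n) by exact: sa_pol.
have SB n x : B (S n x) = S n (B x) by apply: (pol_comm _ _ sB) => y; rewrite AB.
have Sr n x : S n.+1 x = S n x - S n (S n x) by rewrite /S /= polB expr2 polM.
have S1 n x : \sum_(i < n) ip (S i x) (S i x) = ip (S 0%N x) x - ip (S n x) x.
  elim: n => [|n ih]; first by rewrite big_ord0 subrr.
  by rewrite big_ord_recr/= ih Sr ipDl ipNl (adj_ip (S n x) x (sS n)); ring.
have S2 n x : \sum_(i < n) ip (B (S i x)) (S i x) = ip (B (S 0%N x)) x - ip (B (S n x)) x.
  elim: n => [|n ih]; first by rewrite big_ord0 subrr.
  rewrite big_ord_recr/= ih Sr (adjB _ _ sB) ipDl ipNl (SB _ (S n x)).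
  by rewrite (adj_ip (B (S n x)) x (sS n)); ring.
have S0 n x : 0 <= ip (S n x) x by have [h _] := a01 n; exact: h.
move=> x; have h0 : 0 <= ip (B (S 0%N x)) x.
  rewrite -oppr_le0; apply: small_eq => e e0.
  have L0 : 0 < (K + 1) * (nm x + 1) by rewrite mulr_gt0//; have := nm_ge0 x; lra.
  pose q := e / ((K + 1) * (nm x + 1)); have q0 : 0 < q by rewrite divr_gt0.
  have [n hn] : exists n, nm (S n x) <= q.
    apply: contrapT => /forallNP hn.
    have q2 : 0 < q ^+ 2 by rewrite exprn_gt0.
    have hsum n : n%:R * q ^+ 2 <= ip (S 0%N x) x.
      have : \sum_(i < n) q ^+ 2 <= \sum_(i < n) ip (S i x) (S i x).
        apply: ler_sum => i _; rewrite -nm2 ler_pXn2r ?nnegrE ?nm_ge0 ?(ltW q0)//.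
        by rewrite leNgt; apply/negP => /ltW; exact: hn.
      rewrite S1 sumr_const card_ord -mulr_natl; have := S0 n x; lra.
    have := hsum (Num.truncn (ip (S 0%N x) x / q ^+ 2)).+1.
    by rewrite -ler_pdivlMr// leNgt truncnS_gt.
  have h1 : 0 <= \sum_(i < n) ip (B (S i x)) (S i x) by apply: sumr_ge0 => i _.
  rewrite S2 in h1; suff : - ip (B (S n x)) x <= e by lra.
  apply: le_trans (ler_norm _) _; rewrite normrN; apply: le_trans (ip_cauchy_schwarz _ _) _.
  have h2 : nm (B (S n x)) <= K * q by apply: le_trans (hK _) _; rewrite ler_wpM2l.
  have -> : e = ((K + 1) * q) * (nm x + 1) by rewrite /q; field; rewrite gt_eqF//= ?gt_eqF//; have := nm_ge0 x; lra.
  by apply: ler_pM; rewrite ?nm_ge0//; have := nm_ge0 x; lra.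
move: h0; rewrite /S /= polZ polX (adjZ _ _ sB) ipZl pmulr_rge0// AB.
by [].
Qed.

(** Otherwise <A u, u> is negative at u = z - t A z for small t > 0. *)
Lemma psd_zero A z : sa A -> (forall x, 0 <= ip (A x) x) -> ip (A z) z = 0 -> A z = 0.
Proof.
move=> sA A0 h; apply: ip_eq0; apply/eqP; rewrite eq_le ip_ge0 andbT leNgt; apply/negP => N0.
pose K := ip (A (A z)) (A z); have K0 : 0 <= K by exact: A0.
pose t := ip (A z) (A z) / (K + 1).
have t0 : 0 < t by rewrite divr_gt0//; lra.
have := A0 (z - t *r A z).
rewrite (adjB _ _ sA) (adjZ _ _ sA) !ipE h (adj_ip (A z) z sA) -/K.
have tK : t * K <= ip (A z) (A z).
  rewrite /t mulrAC ler_pdivrMr; last by lra.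
  by rewrite ler_wpM2l ?(ltW N0)//; lra.
move: t t0 tK => t t0 tK h1.
have : 0 <= t * (t * K - 2 * ip (A z) (A z)) by lra.
by rewrite pmulr_rge0//; lra.
Qed.

End Polynomials.

Section PositiveProjection.
Context (R : realType) (V : hilbertType R).
Implicit Types (x y z u w : V) (A B C D P : V -> V) (p q : {poly R}).

(** P is the orthogonal projection onto the strictly positive spectral part
    of D. *)
Definition pos_proj D P := [/\ sa P, forall x, P (P x) = P x,
  (forall x, P (D x) = D (P x)), (forall x, 0 <= ip (D (P x)) x) /\
  (forall x, ip (D (x - P x)) x <= 0) & forall x, D x = 0 -> P x = 0].

Lemma cvs_ip_lim (u v : nat -> V) l k x y : cvs u l -> cvs v k ->
  (forall n, ip (u n) x = ip (v n) y) -> ip l x = ip k y.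
Proof.
move=> ul vk e; apply/eqP; rewrite -subr_eq0 -normr_eq0 eq_le normr_ge0 andbT.
apply: small_eq => d d0; have d2 : 0 < d / 2 by rewrite divr_gt0.
have [N hN] := cvs_ip x ul d2; have [N' hN'] := cvs_ip y vk d2.
have := hN (maxn N N') (leq_maxl _ _); have := hN' (maxn N N') (leq_maxr _ _).
rewrite e; move: (ip (v _) y) => a; rewrite !ltr_norml ler_norml => /andP[? ?] /andP[? ?].
apply/andP; split; lra.
Qed.

Lemma sa_limit (X : nat -> V -> V) S : (forall n, sa (X n)) ->
  (forall x, cvs (fun n => X n x) (S x)) -> sa S.
Proof.
move=> sX XS x y; rewrite !innerE; congr (_ +i* _)%C.
  rewrite (ipC x); apply: (cvs_ip_lim (XS x) (XS y)) => n.
  by rewrite (adj_ip _ _ (sX n)) ipC.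
have ipi (a b : V) : ip a ('i%C *: b) = - ip b ('i%C *: a).
  rewrite /ip !innerZr (innerC a b); case: ('[a, b]) => p q /=.
  by rewrite !mul0r !sub0r; lra.
rewrite (ipi x) -ipNl; apply: (cvs_ip_lim (XS x) (cvsN (XS y))) => n /=.
by rewrite (adj_ip _ _ (sX n)) (adjZ _ _ (sX n)) ipi ipNl.
Qed.

(** The Newton-Schulz iteration X |-> X (3 - X^2) / 2, started at a small multiple
    of D, increases |X| and tends strongly to S = sgn D, with S = 0 on the kernel
    of D; the projection is (S^2 + S) / 2.  Every iterate is a polynomial in D, so
    that the limit commutes with all that commutes with D. *)
Lemma pos_proj_exists D : sa D -> exists2 P, pos_proj D P &
  forall C C', adj C C' -> (forall x, C (D x) = D (C x)) -> forall x, C (P x) = P (C x).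
Proof.
move=> sD.
have [K K0 hK] := adj_bounded sD.
pose k := (K + 1)^-1; have k0 : 0 < k by rewrite invr_gt0; lra.
pose X := fix X n : {poly R} := if n is m.+1 then 2^-1 *: (X m * (3%:P - X m ^+ 2)) else k *: 'X.
pose Y n : {poly R} := 1 - X n ^+ 2.
have half : 2%:R * (2^-1)%:P = 1 :> {poly R}.
  by rewrite -(rmorph_nat (@polyC R)) -rmorphM/= mulfV// pnatr_eq0.
(* In terms of Y = 1 - X^2 a step adds X Y / 2 to X and turns Y into
   (3 Y^2 + Y^3) / 4, so that Y stays positive. *)
have XS n : X n.+1 = (2^-1)%:P * (X n * (3%:P - X n ^+ 2)) by rewrite /= mul_polyC.
have XY n : X n.+1 = X n + (2^-1) *: (X n * Y n).
  rewrite XS -mul_polyC /Y.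
  have -> : 3%:P = 1 + 2%:R :> {poly R} by rewrite -(rmorph_nat (@polyC R)) -rmorphD/=; congr (_%:P); lra.
  move: ((2^-1)%:P) half (X n) => c hc p.
  by rewrite -[p in RHS]mul1r -[X in X * p + _]hc; ring.
have posY n : posp D (Y n).
  elim: n => [|n ih].
    move=> x; rewrite /Y /= polB (polC _ 1) scale1r expr2 polM//.
    rewrite !ipE (adj_ip _ _ (sa_pol sD _)) !polZ polX !ipE -!nm2.
    have : k * nm (D x) <= nm x.
      rewrite /k mulrC ler_pdivrMr; last by lra.
      by have := hK x; have := nm_ge0 x; lra.
    move=> h; rewrite mulrA -expr2 -exprMn subr_ge0 ler_pXn2r ?nnegrE ?nm_ge0//.
    by rewrite mulr_ge0 ?nm_ge0 ?ltW.
  have -> : Y n.+1 = 4^-1 *: (3 *: (Y n ^+ 2) + Y n * Y n * Y n).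
    have h4 : (4^-1)%:P = (2^-1)%:P * (2^-1)%:P :> {poly R}.
      by rewrite -rmorphM/=; congr (_%:P); field.
    have e3 : 3%:P = 3%:R :> {poly R} by rewrite -(rmorph_nat (@polyC R)).
    rewrite /Y XS -!mul_polyC h4 e3; move: ((2^-1)%:P) half (X n) => c hc p.
    transitivity ((1 - (2%:R * c) ^+ 2) + c * c * (3%:R * (1 - p ^+ 2) ^+ 2 +
      (1 - p ^+ 2) * (1 - p ^+ 2) * (1 - p ^+ 2))); first by ring.
    by rewrite hc expr1n subrr add0r.
  apply: pospZ; first by [].
  apply: pospD; first by apply: pospZ => //; exact: posp_sqr.
  exact: pospM2.
have X1 n x : nm (pol D (X n) x) <= nm x.
  rewrite -(@ler_pXn2r _ 2) ?nnegrE ?nm_ge0// !nm2.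
  have := posY n x; rewrite /Y polB (polC _ 1) scale1r expr2 polM// !ipE.
  by rewrite (adj_ip _ _ (sa_pol sD _)) subr_ge0.
have posXX n m : posp D (X (n + m)%N * X n - X n ^+ 2).
  elim: m => [|m ih]; first by rewrite addn0 -expr2 subrr => x; rewrite (polC _ 0) scale0r ip0l.
  have -> : X (n + m.+1)%N * X n - X n ^+ 2 = (X (n + m)%N * X n - X n ^+ 2) +
      2^-1 *: (X (n + m)%N * X n * Y (n + m)%N).
    by rewrite addnS XY -!mul_polyC; ring.
  apply: pospD => //; apply: pospZ; first by [].
  move=> x; rewrite polM//.
  apply: commuting_pos; try exact: sa_pol.
  - by move=> y; rewrite -!polM// mulrC.
  - have := pospD ih (posp_sqr sD (X n)); rewrite subrK; exact.
  - exact: posY.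
have [S XSl] : exists S, forall x, cvs (fun n => pol D (X n) x) (S x).
  suff h x : exists l, cvs (fun n => pol D (X n) x) l by have [S hS] := choice h; exists S.
  apply: (monotone_cvs (s := fun n => ip (pol D (X n) x) (pol D (X n) x)) (K := ip x x)).
    move=> m n mn; have := posXX m (n - m)%N x; rewrite subnKC// polB expr2 !polM// !ipE.
    rewrite (adj_ip (pol D (X m) x) x (sa_pol sD _)) (adj_ip (pol D (X m) x) x (sa_pol sD _)).
    rewrite (ipC (pol D (X m) x) (pol D (X n) x)); lra.
  move=> n; rewrite -!nm2 ler_pXn2r ?nnegrE ?nm_ge0//.
have sS : sa S by apply: (sa_limit _ XSl) => n; exact: sa_pol.
have SC C C' : adj C C' -> (forall x, C (D x) = D (C x)) -> forall x, C (S x) = S (C x).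
  move=> aC CD x; apply: (cvs_uniq (cvs_adj aC (XSl x))).
  by have := XSl (C x); congr cvs; apply/funext => n; rewrite (pol_comm _ _ aC).
have SD x : S (D x) = D (S x) by rewrite (SC D D sD).
have Xlim (u : nat -> V) l : cvs u l -> cvs (fun n => pol D (X n) (u n)) (S l).
  move=> ul; have := cvsD (XSl l) (_ : cvs (fun n => pol D (X n) (u n - l)) 0).
  rewrite addr0 => h; have {}h := h _.
  have hh : cvs (fun n => pol D (X n) l + pol D (X n) (u n - l)) (S l).
    apply: h => e e0; have [N hN] := ul e e0; exists N => n /hN.
    by rewrite subr0; exact/le_lt_trans.
  move: hh; congr cvs; apply/funext => n.
  by rewrite -(adjD _ _ (sa_pol sD _)) addrC subrK.
have S3 x : S (S (S x)) = S x.
  have h1 := cvs_shift 1%N (XSl x).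
  have h2 := Xlim _ _ (Xlim _ _ (XSl x)).
  have h3 := cvsZ 2^-1 (cvsB (cvsZ 3 (XSl x)) h2).
  have : S x = 2^-1 *r (3 *r S x - S (S (S x))).
    apply: (cvs_uniq h1); move: h3; congr cvs; apply/funext => n.
    rewrite addn1 XS polM// polC; congr (_ *r _).
    by rewrite mulrBr polB mulrC polM// polC expr2 !polM.
  move: (S x) (S (S (S x))) => a b e; apply: ip_inj => w.
  by have := congr1 (ip w) e; rewrite !ipE; lra.
have SDpos x : k * ip (D x) (D x) <= ip (S (D x)) x.
  rewrite -(ler_pM2l k0) mulrA -[k * ip (S _) _]ipZl -(adjZ _ _ sS).
  have -> : k * k * ip (D x) (D x) = ip (k *r D x) (k *r D x) by rewrite !ipE; ring.
  apply: (cvs_ip_ge (XSl (k *r D x))) => n; have := posXX 0%N n x.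
  have X0 y : pol D (X 0%N) y = k *r D y by rewrite /= polZ polX.
  rewrite add0n polB expr2 !polM// !X0 ipDl ipNl subr_ge0; apply: le_trans.
  by rewrite (adjZ _ _ sD) !ipZl (adj_ip (D x) x sD) ipZr.
have Dnull z : S z = 0 -> D z = 0.
  move=> Sz; apply: ip_eq0; apply/eqP; rewrite eq_le ip_ge0 andbT.
  by rewrite -(pmulr_rle0 _ k0); apply: le_trans (SDpos z) _; rewrite SD Sz (adj0 sD) ip0l.
have DSS x : D x = D (S (S x)).
  apply/eqP; rewrite -subr_eq0 -(adjB _ _ sD); apply/eqP/Dnull.
  by rewrite (adjB _ _ sS) S3 subrr.
pose P x := 2^-1 *r (S (S x) + S x).
have sSS : sa (fun x => S (S x)) by apply: sa_comp.
have sP : sa P by apply: sa_scale; apply: sa_sum.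
have SP x : S (P x) = P x.
  by rewrite /P (adjZ _ _ sS) (adjD _ _ sS) S3 addrC.
have PP x : P (P x) = P x.
  rewrite -[LHS]/(2^-1 *r (S (S (P x)) + S (P x))) !SP.
  by apply: ip_inj => w; rewrite !ipE; field.
have PC C C' : adj C C' -> (forall x, C (D x) = D (C x)) -> forall x, C (P x) = P (C x).
  by move=> aC CD x; rewrite /P (adjZ _ _ aC) (adjD _ _ aC) !(SC C C').
have PD x : P (D x) = D (P x) by rewrite (PC D D sD).
exists P => //; split => //.
- split=> x.
  + have -> : ip (D (P x)) x = ip (S (D (P x))) (P x).
      by rewrite SD SP -PD (adj_ip _ _ sP) -{1}(PP x) -(adj_ip _ _ sP) PD.
    by apply: le_trans (SDpos _); rewrite mulr_ge0 ?ip_ge0// ltW.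
  + set q := x - P x.
    have e1 : D q = - S (D q).
      have SSq : S (S q) = - S q.
        by rewrite /q !(adjB _ _ sS) !SP; apply: ip_inj => w; rewrite /P !ipE; field.
      by rewrite [LHS]DSS SSq (adjN _ sD) SD.
    have -> : ip (D q) x = ip (D q) q.
      rewrite {3}/q ipDr ipNr -(adj_ip _ _ sP) PD /q (adjB _ _ sP) PP subrr (adj0 sD) ip0l.
      by rewrite oppr0 addr0.
    rewrite e1 ipNl oppr_le0; apply: le_trans (SDpos _).
    by rewrite mulr_ge0 ?ip_ge0// ltW.
- move=> x Dx; suff Sx : S x = 0 by rewrite /P Sx (adj0 sS) addr0 scaler0.
  apply: (cvs_uniq (XSl x)); move: (cvs_cst (0 : V)); congr cvs; apply/funext => n.
  elim: n => [|n ih]; first by rewrite /= polZ polX Dx scaler0.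
  by rewrite XY polD polZ mulrC polM// -ih (adj0 (sa_pol sD _)) scaler0 addr0.
Qed.

(** On z in the range of P (1 - Q) the form of D is both nonnegative and
    nonpositive, so D z = 0, and P vanishes on the kernel of D. *)
Lemma pos_proj_unique D P Q : sa D -> pos_proj D P -> pos_proj D Q ->
  (forall x, P (Q x) = Q (P x)) -> forall x, P x = Q x.
Proof.
move=> sD.
have half P1 Q1 : pos_proj D P1 -> pos_proj D Q1 -> (forall x, P1 (Q1 x) = Q1 (P1 x)) ->
    forall x, P1 x = P1 (Q1 x).
  move=> [sP PP PD [Ppos _] Pk] [sQ QQ QD [_ Qneg] _] PQ x.
  apply/eqP; rewrite -subr_eq0 -(adjB _ _ sP); set z := P1 _.
  have Pz : P1 z = z by exact: PP.
  have Qz : Q1 z = 0 by rewrite /z -PQ (adjB _ _ sQ) QQ subrr (adj0 sP).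
  have h0 : ip (D (P1 z)) z = 0.
    apply/eqP; rewrite eq_le Ppos andbT Pz.
    by have := Qneg z; rewrite Qz subr0.
  have Dz : D (P1 z) = 0.
    apply: (@psd_zero _ _ (fun x => D (P1 x))) => //.
    by apply: sa_comp => // y; rewrite PD.
  by rewrite -Pz; apply/eqP; apply: Pk; rewrite -Dz Pz.
by move=> hP hQ PQ x; rewrite (half P Q)// [RHS](half Q P)// => y.
Qed.

End PositiveProjection.

(** * The resolvent of a self-adjoint operator *)

Section Resolvent.
Context (R : realType) (V : hilbertType R).
Implicit Types (x y z u w : V) (T : op V).

Lemma ip_i x y : ip x ('i%C *: y) = - ip ('i%C *: x) y.
Proof.
rewrite /ip innerZr innerZl; case: ('[x, y]) => p q /=.
by rewrite !mul0r !mulN1r !sub0r; lra.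
Qed.

Lemma linear_opP T (a : R[i]) x y x' y' : linear_op T ->
  T (x, y) -> T (x', y') -> T (a *: x + x', a *: y + y').
Proof. by move=> [[_ h] _] t t'; exact: (h a _ _ t t'). Qed.

Lemma linear_op0 T : linear_op T -> T (0, 0).
Proof. by case=> [[]]. Qed.

Lemma linear_opZ T (a : R[i]) x y : linear_op T -> T (x, y) -> T (a *: x, a *: y).
Proof.
by move=> lT t; have := linear_opP a lT t (linear_op0 lT); rewrite !addr0.
Qed.

Lemma linear_opB T x y x' y' : linear_op T ->
  T (x, y) -> T (x', y') -> T (x - x', y - y').
Proof.
move=> lT t t'; have := linear_opP (-1) lT t' t.
by rewrite !scaleN1r ![- _ + _]addrC.
Qed.

Lemma linear_opD T x y x' y' : linear_op T ->
  T (x, y) -> T (x', y') -> T (x + x', y + y').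
Proof. by move=> lT t t'; have := linear_opP 1 lT t t'; rewrite !scale1r. Qed.

Lemma selfadjoint_linear T : selfadjoint T -> linear_op T. Proof. by case. Qed.

Lemma selfadjoint_sym T x y x' y' : selfadjoint T ->
  T (x, y) -> T (x', y') -> '[y, x'] = '[x, y'].
Proof. by case=> _ _ eT t; rewrite {1}eT => t'; exact: t'. Qed.

Lemma selfadjoint_mem T x y : selfadjoint T ->
  (forall u v, T (u, v) -> '[v, x] = '[u, y]) -> T (x, y).
Proof. by case=> _ _ eT h; rewrite eT => u v /h. Qed.

Lemma selfadjoint_mem_ip T x y : selfadjoint T ->
  (forall u v, T (u, v) -> ip v x = ip u y) -> T (x, y).
Proof.
move=> sT h; apply: (selfadjoint_mem sT) => u v t; rewrite !innerE (h _ _ t).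
by rewrite !ip_i (h _ _ (linear_opZ 'i%C (selfadjoint_linear sT) t)).
Qed.

Definition resolvent_pair T (c a : V -> V) :=
  forall z, T (c z, a z) /\ T (a z, z - c z).

(** von Neumann: the orthogonal projection of (z, 0) onto the graph of T is
    (c z, a z) with c = (1 + T^2)^-1 and a = T (1 + T^2)^-1. *)
Lemma resolvent_pair_exists T : selfadjoint T -> exists c a, resolvent_pair T c a.
Proof.
move=> sT; have lT := selfadjoint_linear sT.
suff h z : exists p : V * V, T p /\ T (p.2, z - p.1).
  by have [f hf] := choice h; exists (fst \o f), (snd \o f) => z /=; case: (f z) (hf z).
pose q (p p' : V * V) : R := ip p.1 p'.1 + ip p.2 p'.2.
pose lim (d : nat -> V * V) p := cvs (fst \o d) p.1 /\ cvs (snd \o d) p.2.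
have [|||||||||||[x y] [[d [dT [dx dy]]] lim_]] :=
    @riesz_form _ (V * V)%type q T (fun p => ip p.1 z) (ip z z) lim.
- by move=> p p'; rewrite /q ipC (ipC p.2).
- by move=> p p' r; rewrite /q /= !ipDl; ring.
- by move=> r p p'; rewrite /q /= !ipZl; ring.
- by move=> p; rewrite /q addr_ge0 ?ip_ge0.
- move=> d dC; have [m n|x dx] := @cauchy_sqr_cvs _ _ (fst \o d).
    by apply: le_trans (dC m n); rewrite /q lerDl ip_ge0.
  have [m n|y dy] := @cauchy_sqr_cvs _ _ (snd \o d); last by exists (x, y).
  by apply: le_trans (dC m n); rewrite /q lerDr ip_ge0.
- move=> d p p' e [dx dy] e0; have e2 : 0 < e / 2 by rewrite divr_gt0.
  have [N1 h1] := cvs_ip p'.1 dx e2; have [N2 h2] := cvs_ip p'.2 dy e2.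
  exists (maxn N1 N2) => n; rewrite geq_max => /andP[/h1 + /h2].
  rewrite /q !(ipC p'.1) !(ipC p'.2) /= !ltr_norml => /andP[? ?] /andP[? ?].
  by apply/andP; split; lra.
- exact: linear_op0.
- by move=> r [x y] [x' y'] t t'; exact: linear_opP.
- by move=> r p p' _ _; rewrite /= ipDl ipZl.
- exact: ip_ge0.
- move=> [x y] _; rewrite /q /=.
  have h : ip x z ^+ 2 <= ip z z * ip x x.
    rewrite -!nm2 mulrC -exprMn -real_normK ?num_real//.
    by rewrite ler_pXn2r ?nnegrE ?mulr_ge0 ?nm_ge0 ?ip_cauchy_schwarz.
  apply: le_trans h _; rewrite ler_wpM2l ?ip_ge0// lerDl ip_ge0//.
exists (x, y) => /=.
have lim' u v : T (u, v) -> ip u z = ip u x + ip v y by move=> /lim_.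
split; apply: (selfadjoint_mem_ip sT) => u v t.
  rewrite (ipC v) (ipC u); apply: (cvs_ip_lim dx dy) => n.
  rewrite /ip /=; case: (d n) (dT n) => x' y' t' /=.
  by rewrite (selfadjoint_sym sT t' t).
by rewrite ipDr ipNr (lim' _ _ t); ring.
Qed.

Section Fixed.
Variables (T : op V) (c a : V -> V).
Hypotheses (sT : selfadjoint T) (rT : resolvent_pair T c a).
Let lT := selfadjoint_linear sT.

Lemma linear_op_fun x y y' : T (x, y) -> T (x, y') -> y = y'.
Proof. by case: lT => _ h; exact: h. Qed.

Lemma inner_opp0 (p q : V) : '[q, q] = - '[p, p] -> p = 0 /\ q = 0.
Proof.
move=> /(congr1 (@complex.Re R)); rewrite raddfN/= -!/(ip _ _) => e'.
have := ip_ge0 p; have := ip_ge0 q => q0 p0.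
by split; apply: ip_eq0; apply/eqP; rewrite eq_le; apply/andP; split; lra.
Qed.

(** The difference p of two solutions satisfies |T p|^2 = <T^2 p, p> = - |p|^2. *)
Lemma resolvent_unique x y z : T (x, y) -> T (y, z - x) -> x = c z /\ y = a z.
Proof.
move=> t1 t2; have [t3 t4] := rT z.
have t5 := linear_opB lT t1 t3; have := linear_opB lT t2 t4.
have -> : z - x - (z - c z) = c z - x by rewrite opprB [LHS]addrC addrA subrK.
move=> t6.
have := selfadjoint_sym sT t5 t6; rewrite -[c z - x]opprB linearNr/= => e.
by have [/subr0_eq -> /subr0_eq ->] := inner_opp0 e.
Qed.

Lemma resolvent_sa : sa c /\ sa a.
Proof.
split=> z z'; have [t1 t2] := rT z; have [t3 t4] := rT z'.
  have e1 := selfadjoint_sym sT t1 t4; have e2 := selfadjoint_sym sT t3 t2.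
  move: e1; rewrite linearBr/= => /esym/eqP; rewrite subr_eq => /eqP ->.
  have := selfadjoint_sym sT t2 t3; rewrite linearBl/= => /eqP; rewrite subr_eq => /eqP ->.
  by rewrite addrC.
have e1 := selfadjoint_sym sT t2 t4; have e2 := selfadjoint_sym sT t1 t3.
move: e1; rewrite linearBl linearBr/= e2 => /eqP.
by rewrite (inj_eq (addIr _)) => /eqP ->.
Qed.

Lemma resolvent_comm z : c (a z) = a (c z) /\ a (a z) = c z - c (c z).
Proof.
have [t1 t2] := rT z; have [t3 t4] := rT (c z).
have [-> ->] // := resolvent_unique t4 (linear_opB lT t1 t3).
Qed.

Lemma resolvent_ip z : ip (c z) z = ip (c z) (c z) + ip (a z) (a z).
Proof.
have [t1 t2] := rT z.
have e : '[c z, z] = '[c z, z - c z] + '[c z, c z] by rewrite -linearDr/= subrK.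
by rewrite /ip e raddfD/= addrC (selfadjoint_sym sT t1 t2).
Qed.

Lemma resolvent_ge0 z : 0 <= ip (c z) z.
Proof. by rewrite resolvent_ip addr_ge0 ?ip_ge0. Qed.

Lemma resolvent_inj0 : inj0 c.
Proof.
move=> z cz; have [t1 t2] := rT z; rewrite cz in t1 t2.
have az := linear_op_fun t1 (linear_op0 lT); rewrite az subr0 in t2.
exact: linear_op_fun t2 (linear_op0 lT).
Qed.

Lemma resolvent_ip0 z : ip (c z) z = 0 -> z = 0.
Proof.
rewrite resolvent_ip => h; apply: resolvent_inj0; apply: ip_eq0.
by apply/eqP; rewrite eq_le ip_ge0 andbT; have := ip_ge0 (a z); lra.
Qed.

(** The graph is the range of the projection with blocks c, a, a, 1 - c. *)
Lemma resolvent_graph u v : T (u, v) -> u = c u + a v /\ v = a u + (v - c v).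
Proof.
move=> t; have [t1 t2] := rT u; have [t3 t4] := rT v.
have t5 := linear_opD lT t1 t4; have t6 := linear_opB lT t t5.
have [sc sa'] := resolvent_sa.
suff h : u = c u + a v.
  split => //; apply: (linear_op_fun t).
  have := linear_opD lT t1 t4; rewrite -h; exact.
apply/eqP; rewrite -subr_eq0; apply/eqP; set p := u - (c u + a v) in t6 *.
set q := v - (a u + (v - c v)) in t6.
suff e : '[p, p] = - '[q, q] by have [] := inner_opp0 e.
have e1 := selfadjoint_sym sT t6 t2; have e2 := selfadjoint_sym sT t6 t3.
have -> : '[p, p] = '[p, u - c u] - '[p, a v].
  by rewrite -linearBr/= -addrA -opprD.
rewrite -e1 -e2 -linearBr/= -linearNr/=; congr ('[_, _]).
by apply: ip_inj => w; rewrite /q !ipE; ring.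
Qed.

End Fixed.

End Resolvent.

(** * Uniqueness of the spectral measure *)

Section ResolventCalculus.
Context (R : realType) (V : hilbertType R).
Implicit Types (x y z u w : V) (S : set R).

Lemma spectral_measureP (T : op V) (E : set R -> {linear V -> V}) :
  projection_valued_measure E ->
  spectral_measure_of T E <-> forall x y, T (x, y) <-> local E id x y.
Proof.
move=> pE; have mid : measurable_fun setT (@id R) by exact: measurable_id.
split=> [[_ ->] x y|h]; first exact: spectral_integralP.
split=> //; apply/seteqP; split=> -[x y]; rewrite (spectral_integralP pE)//; [exact: (h x y).1 | exact: (h x y).2].
Qed.

Variables (T : op V) (c a : V -> V).
Hypotheses (sT : selfadjoint T) (rT : resolvent_pair T c a).

(** (T - l) (1 + T^2)^-1, a bounded operator with the sign of T - l. *)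
Definition shifted (l : R) z := a z - l *r c z.

Lemma sa_shifted l : sa (shifted l).
Proof.
by have [sc sa'] := resolvent_sa sT rT; apply: sa_sub => //; exact: sa_scale.
Qed.

Variable E : set R -> {linear V -> V}.
Hypothesis pE : projection_valued_measure E.
Hypothesis ET : forall x y, T (x, y) <-> local E id x y.

Lemma measurable_shift (l : R) :
  [/\ measurable_fun setT (fun t : R => 1 / (1 + t ^+ 2)),
      measurable_fun setT (fun t : R => t / (1 + t ^+ 2)) &
      measurable_fun setT (fun t : R => (t - l) / (1 + t ^+ 2))].
Proof.
have c1 : continuous (fun t : R => (1 + t ^+ 2)^-1).
  move=> t; apply: cvgV; first by rewrite gt_eqF// ltr_pwDl ?sqr_ge0.
  by apply: cvgD; [exact: cvg_cst|exact: exprn_continuous].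
have m1 : measurable_fun setT (fun t : R => (1 + t ^+ 2)^-1) by exact: continuous_measurable_fun.
split; apply: measurable_funM => //.
by apply: measurable_funB => //; exact: measurable_cst.
Qed.

Lemma local_shifted l z : local E (fun t => (t - l) / (1 + t ^+ 2)) z (shifted l z).
Proof.
have [t1 t2] := rT z.
have [h1 h2] := local_resolvent pE ((ET _ _).1 t1) ((ET _ _).1 t2).
have [m1 m2 m3] := measurable_shift l.
have mc : measurable_fun setT (fun _ : R => - l) by exact: measurable_cst.
have h3 := local_mul pE m1 mc (normr_ge0 _) (fun _ => lexx _) h1 (@local_cst _ _ _ pE (- l) (c z)).
have m4 : measurable_fun setT (fun t : R => - l * (1 / (1 + t ^+ 2))) by exact: measurable_funM.
have := local_add pE m2 m4 h2 h3; rewrite /shifted rmorphN scaleNr.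
by congr local; apply/funext => t; rewrite mulrBl mul1r mulNr.
Qed.

Arguments local_shifted : clear implicits.

(** (t - l) / (1 + t^2) has the sign of t - l. *)
Lemma spectral_pos_proj l : pos_proj (shifted l) (E `]l, +oo[%classic).
Proof.
set S := `]l, +oo[%classic; have mS : measurable S by exact: measurable_itv.
have mC : measurable (~` S) by exact: measurableC.
have [_ _ m3] := measurable_shift l.
have k (t : R) : 0 < (1 + t ^+ 2)^-1 by rewrite invr_gt0 ltr_pwDl ?sqr_ge0.
have comm z : E S (shifted l z) = shifted l (E S z).
  exact: (local_unique pE m3 (local_proj pE mS (local_shifted l z)) (local_shifted l _)).
split; first exact: pvm_sa.
- by move=> x; exact: pvm_idem.
- exact: comm.
- split=> z.
    have := local_ge pE (m := 0) m3 mS (local_shifted l (E S z)) (pvm_idem pE z mS).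
    rewrite mul0r -comm [X in _ -> 0 <= X](_ : _ = ip (E S (shifted l z)) (E S z)); last first.
      by rewrite -(adj_ip _ _ (pvm_sa pE mS)) pvm_idem.
    apply=> t; rewrite /S /= in_itv/= andbT => lt; rewrite mulr_ge0//; first by rewrite subr_ge0 ltW.
    by rewrite ltW.
  have -> : z - E S z = E (~` S) z.
    by rewrite -{1}(pvm_setT pE z) -(setUv S) (pvm_setU pE)// ?setICr// addrC addKr.
  have hN := local_opp (local_shifted l (E (~` S) z)).
  have := local_ge pE (m := 0) (measurable_funN m3) mC hN (pvm_idem pE z mC).
  rewrite mul0r ipNl oppr_ge0.
  have -> : shifted l (E (~` S) z) = E (~` S) (shifted l z).
    exact/esym/(local_unique pE m3 (local_proj pE mC (local_shifted l z)) (local_shifted l _)).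
  rewrite -(adj_ip _ _ (pvm_sa pE mC)) pvm_idem//; apply=> t.
  rewrite /S /= in_itv/= andbT => /negP; rewrite -leNgt => tl.
  by rewrite oppr_ge0 mulr_le0_ge0 ?(ltW (k t))// subr_le0.
- move=> z hz; have h := local_shifted l z; rewrite hz in h.
  apply: (local_kernel pE m3 mS h) => t; rewrite /S /= in_itv/= andbT => lt.
  by rewrite mulr_gt0// subr_gt0.
Qed.

End ResolventCalculus.

(** Both sides are determined by the half-lines ]l, +oo[, by a Dynkin argument,
    and there E and E' are the same projection attached to T alone. *)
Lemma spectral_intertwine (R : realType) (V : hilbertType R) (T : op V)
    (E E' : set R -> {linear V -> V}) (J J' : V -> V) : selfadjoint T ->
  spectral_measure_of T E -> spectral_measure_of T E' -> adj J J' ->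
  (forall x y, T (x, y) -> T (J x, J y)) ->
  forall S, measurable S -> forall x, J (E S x) = E' S (J x).
Proof.
move=> sT hE hE' aJ JT; have pE := hE.1; have pE' := hE'.1.
have /(spectral_measureP _ pE) ET := hE; have /(spectral_measureP _ pE') ET' := hE'.
have [c [a rT]] := resolvent_pair_exists sT.
have Jca z : J (c z) = c (J z) /\ J (a z) = a (J z).
  have [t1 t2] := rT z; have t3 := JT _ _ t1; have := JT _ _ t2.
  by rewrite (adjB _ _ aJ); exact: (resolvent_unique sT rT t3).
move=> S mS.
apply: (@dynkin_induction _ R (@RGenOInfty.G R) [set S | forall x, J (E S x) = E' S (J x)]) => //.
- exact: RGenOInfty.measurableE.
- move=> _ _ [l ->] [m ->]; exists (Num.max l m); apply/seteqP; split=> t /=;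
    rewrite !in_itv/= !andbT gt_max.
    by move=> [-> ->].
  by move/andP.
- by move=> x; rewrite !pvm_setT.
- move=> _ [l ->] x /=.
  have [P hP Pcomm] := pos_proj_exists (sa_shifted sT rT l).
  have h1 := spectral_pos_proj rT pE ET l; have h2 := spectral_pos_proj rT pE' ET' l.
  have e Q : pos_proj (shifted c a l) Q -> forall x, P x = Q x.
    move=> hQ; apply: (pos_proj_unique (sa_shifted sT rT l) hP hQ) => y.
    by case: hQ => sQ _ QD _ _; rewrite (Pcomm Q Q sQ).
  rewrite -(e _ h1) -(e _ h2) (Pcomm _ _ aJ) // => y.
  by rewrite /shifted (adjB _ _ aJ) (adjZ _ _ aJ); have [-> ->] := Jca y.
- move=> A mA hA x; have mC : measurable (~` A) by exact: measurableC.
  have d (F : set R -> {linear V -> V}) y : projection_valued_measure F -> F (~` A) y = y - F A y.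
    by move=> pF; rewrite -{2}(pvm_setT pF y) -(setUv A) (pvm_setU pF)// ?setICr// addrC addKr.
  by rewrite (d E)// (d E')// (adjB _ _ aJ) hA.
- move=> F mF tF hF x; apply: (cvs_uniq (cvs_adj aJ (pvm_series pE x mF tF))).
  have := pvm_series pE' (J x) mF tF; congr cvs; apply/funext => n.
  elim: n => [|n ih]; first by rewrite !big_nil (adj0 aJ).
  by rewrite !big_nat_recr//= (adjD _ _ aJ) ih hF.
exact: (eq_ind _ (fun G : set (set R) => G S) mS _ (RGenOInfty.measurableE R)).
Qed.

Lemma spectral_measure_unique (R : realType) (V : hilbertType R) (T : op V)
    (E E' : set R -> {linear V -> V}) : selfadjoint T ->
  spectral_measure_of T E -> spectral_measure_of T E' ->
  forall S, measurable S -> forall x, E S x = E' S x.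
Proof. by move=> sT hE hE'; apply: (spectral_intertwine (J' := id) sT hE hE'). Qed.

(** * Existence of the spectral measure *)

Section Projections.
Context (R : realType) (V : hilbertType R).
Implicit Types (x y z u w : V) (P Q : V -> V).

Definition oproj P := sa P /\ forall x, P (P x) = P x.

Lemma oproj_ip P x : oproj P -> ip (P x) x = ip (P x) (P x).
Proof. by move=> [sP PP]; rewrite -[in RHS](adj_ip _ _ sP) PP. Qed.

Lemma oproj_le P x : oproj P -> ip (P x) x <= ip x x.
Proof.
move=> hP; have := ip_ge0 (x - P x); rewrite !ipE (ipC x (P x)) oproj_ip//; lra.
Qed.

Lemma oproj_fix P x : oproj P -> ip (P x) x = ip x x -> P x = x.
Proof.
move=> hP h; apply/eqP; rewrite eq_sym -subr_eq0; apply/eqP/ip_eq0.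
by rewrite !ipE (ipC x (P x)) -(oproj_ip x hP) h; ring.
Qed.

Lemma oprojC P : oproj P -> oproj (fun x => x - P x).
Proof.
move=> [sP PP]; split; first by apply: sa_sub.
by move=> x; rewrite (adjB _ _ sP) PP subrr subr0.
Qed.

(** Polarization over the reals suffices for self-adjoint operators. *)
Lemma sa_form_inj P Q : sa P -> sa Q -> (forall x, ip (P x) x = ip (Q x) x) ->
  forall x, P x = Q x.
Proof.
move=> sP sQ h x; apply: ip_inj => y.
have e P' : sa P' -> ip (P' y) x = ip (P' x) y.
  by move=> sP'; rewrite (adj_ip _ _ sP') ipC.
have := h (x + y); rewrite (adjD _ _ sP) (adjD _ _ sQ) !ipE !h (e P)// (e Q)//.
by rewrite !(ipC y); lra.
Qed.

(** Projections whose quadratic forms have partial sums below the identity are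
    mutually orthogonal and can be summed. *)
Lemma oproj_series (Q : nat -> V -> V) : (forall k, oproj (Q k)) ->
  (forall n x, \sum_(0 <= k < n) ip (Q k x) x <= ip x x) ->
  exists2 P, oproj P & forall x, cvs (fun n => \sum_(0 <= k < n) Q k x) (P x).
Proof.
move=> hQ hle; have sQ k : sa (Q k) by case: (hQ k).
have QQ k x : Q k (Q k x) = Q k x by case: (hQ k).
have q0 k x : 0 <= ip (Q k x) x by rewrite oproj_ip// ip_ge0.
have orth j k x : (j != k)%N -> Q j (Q k x) = 0.
  move=> jk; set w := Q k x; apply: ip_eq0; rewrite -oproj_ip//.
  apply/eqP; rewrite eq_le q0 andbT.
  have := hle (maxn j k).+1 w; rewrite big_mkord.
  have jn : (j < (maxn j k).+1)%N by rewrite ltnS leq_maxl.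
  have kn : (k < (maxn j k).+1)%N by rewrite ltnS leq_maxr.
  rewrite (bigD1 (Ordinal kn))//= (bigD1 (Ordinal jn))//=.
  rewrite /w QQ -/w; set s := \sum_(_ | _) _.
  have : 0 <= s by apply: sumr_ge0 => i _.
  lra.
pose S n x := \sum_(0 <= k < n) Q k x.
have Srec n x : S n.+1 x = S n x + Q n x by rewrite /S big_nat_recr.
have QS n k x : Q k (S n x) = if (k < n)%N then Q k x else 0.
  elim: n => [|n ih]; first by rewrite /S big_nil (adj0 (sQ k)).
  have -> : (k < n.+1)%N = (k == n) || (k < n)%N by rewrite ltnS leq_eqVlt.
  rewrite Srec (adjD _ _ (sQ k)) ih.
  have [->|kn] := eqVneq k n; first by rewrite ltnn QQ add0r.
  by rewrite orth// addr0.
have SS n x : ip (S n x) (S n x) = \sum_(0 <= k < n) ip (Q k x) x.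
  elim: n => [|n ih]; first by rewrite /S !big_nil ip0l.
  rewrite Srec big_nat_recr//= pythagoras; first by rewrite ih oproj_ip.
  by rewrite -(adj_ip _ _ (sQ n)) QS ltnn ip0l.
have SmS m n x : (m <= n)%N -> S m (S n x) = S m x.
  move=> mn; rewrite -[LHS]/(\sum_(0 <= k < m) Q k (S n x)) -[RHS]/(\sum_(0 <= k < m) Q k x).
  by rewrite !big_nat; apply: eq_bigr => k /andP[_ km]; rewrite QS (leq_trans km mn).
have sS n : sa (S n).
  elim: n => [|n ih]; first by move=> x y; rewrite /S !big_nil linear0l linear0r.
  by move=> x y; rewrite !Srec linearDl linearDr/= ih sQ.
have ex x : exists l, cvs (fun n => S n x) l.
  apply: (monotone_cvs (s := fun n => ip (S n x) (S n x)) (K := ip x x)).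
    move=> m n mn; rewrite !ipE (ipC (S n x) (S m x)).
    have -> : ip (S m x) (S n x) = ip (S m x) (S m x).
      by rewrite (adj_ip _ _ (sS m)) SmS// (adj_ip _ _ (sS m)) SmS.
    lra.
  by move=> n; rewrite SS.
have [P hP] := choice ex.
have sP : sa P by exact: sa_limit sS hP.
exists P => //; split=> // x.
apply: (cvs_uniq (hP (P x))).
have h n : S n (P x) = S n x.
  apply: (cvs_uniq (cvs_shift n (cvs_adj (sS n) (hP x)))).
  move: (cvs_cst (S n x)); congr cvs; apply/funext => m.
  by rewrite SmS// leq_addl.
by move: (hP x); congr cvs; apply/funext => n; rewrite h.
Qed.

End Projections.

Section Existence.
Context (R : realType) (V : hilbertType R).
Implicit Types (x y z u w : V) (S : set R) (l : R).
Variables (T : op V) (c a : V -> V).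
Hypotheses (sT : selfadjoint T) (rT : resolvent_pair T c a).

Let sc : sa c. Proof. by case: (resolvent_sa sT rT). Qed.
Let sa_a : sa a. Proof. by case: (resolvent_sa sT rT). Qed.
Let D := shifted c a.
Let sD l : sa (D l). Proof. exact: sa_shifted sT rT l. Qed.

Variable P : R -> V -> V.
Hypothesis hP : forall l, pos_proj (D l) (P l).
Hypothesis PC : forall l C C', adj C C' -> (forall x, C (D l x) = D l (C x)) ->
  forall x, C (P l x) = P l (C x).

Let sP l : sa (P l). Proof. by case: (hP l). Qed.
Let PP l x : P l (P l x) = P l x. Proof. by case: (hP l). Qed.
Let oP l : oproj (P l). Proof. by []. Qed.

Let cD l x : c (D l x) = D l (c x).
Proof.
rewrite /D /shifted (adjB _ _ sc) (adjZ _ _ sc).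
by have [-> _] := resolvent_comm sT rT x.
Qed.

Let aD l x : a (D l x) = D l (a x).
Proof.
rewrite /D /shifted (adjB _ _ sa_a) (adjZ _ _ sa_a).
by have [-> _] := resolvent_comm sT rT x.
Qed.

Let cP l x : c (P l x) = P l (c x). Proof. exact: PC sc (cD l) x. Qed.
Let aP l x : a (P l x) = P l (a x). Proof. exact: PC sa_a (aD l) x. Qed.

Let PD l m x : P l (D m x) = D m (P l x).
Proof. by rewrite /D /shifted (adjB _ _ (sP l)) (adjZ _ _ (sP l)) cP aP. Qed.

Let PPC l m x : P l (P m x) = P m (P l x).
Proof. by rewrite (PC (sP l)) // => y; rewrite PD. Qed.

Let D_pos l z : P l z = z -> 0 <= ip (D l z) z.
Proof. by case: (hP l) => _ _ _ [h _] _ e; have := h z; rewrite e. Qed.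

Let D_neg l z : P l z = 0 -> ip (D l z) z <= 0.
Proof. by case: (hP l) => _ _ _ [_ h] _ e; have := h z; rewrite e subr0. Qed.

Let D_null l z : P l z = z -> ip (D l z) z <= 0 -> z = 0.
Proof.
move=> Pz h; case: (hP l) => _ _ _ [Dpos _] Dk; rewrite -Pz; apply: Dk; rewrite -[X in D l X]Pz.
apply: (@psd_zero _ _ (fun x => D l (P l x))) => //.
  by apply: sa_comp => // x; rewrite PD.
by rewrite Pz; apply/eqP; rewrite eq_le h; have := Dpos z; rewrite Pz.
Qed.

Let D_ip l m z : ip (D l z) z = ip (D m z) z + (m - l) * ip (c z) z.
Proof. by rewrite /D /shifted !ipE; ring. Qed.

(** D l decreases with l, because c >= 0. *)
Let P_mono l m x : l <= m -> P l (P m x) = P m x.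
Proof.
move=> lm; apply/eqP; rewrite eq_sym -subr_eq0; apply/eqP; set z := _ - _.
have Pmz : P m z = z by rewrite /z (adjB _ _ (sP m)) PP PPC PP.
have Plz : P l z = 0 by rewrite /z (adjB _ _ (sP l)) PP subrr.
apply: (D_null Pmz); have := D_neg Plz; rewrite (D_ip l m).
have : 0 <= (m - l) * ip (c z) z.
  by rewrite mulr_ge0 ?subr_ge0//; exact: resolvent_ge0 sT rT z.
lra.
Qed.

Let P_mono' l m x : l <= m -> P m (P l x) = P m x.
Proof. by move=> lm; rewrite PPC P_mono. Qed.

Let P_mono_ip l m x : l <= m -> ip (P m x) x <= ip (P l x) x.
Proof.
move=> lm; rewrite (oproj_ip x (oP l)).
have -> : ip (P m x) x = ip (P m (P l x)) (P l x).
  by rewrite P_mono'// -{1}(P_mono x lm) (adj_ip _ _ (sP l)).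
exact: oproj_le.
Qed.

Let P_diff l m x : l <= m ->
  ip (P l x - P m x) (P l x - P m x) = ip (P l x) x - ip (P m x) x.
Proof.
move=> lm; rewrite !ipE (ipC (P m x) (P l x)) -!oproj_ip//.
have -> : ip (P l x) (P m x) = ip (P m x) x.
  by rewrite (ipC (P l x)) -(adj_ip _ _ (sP l)) P_mono.
ring.
Qed.

(** What a limit from the right misses lies in the kernel of D l. *)
Let P_right l x : cvs (fun n => P (l + n.+1%:R^-1) x) (P l x).
Proof.
pose m n := l + n.+1%:R^-1.
have lm n : l <= m n by rewrite lerDl invr_ge0.
have mm i j : (i <= j)%N -> m j <= m i.
  by move=> ij; rewrite lerD2l lef_pV2 ?posrE// ler_nat ltnS.
have [u hu] : exists u, cvs (fun n => P (m n) x) u.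
  apply: (monotone_cvs (s := fun n => ip (P (m n) x) x) (K := ip x x)).
    by move=> i j ij; rewrite P_diff ?mm.
  by move=> n; exact: oproj_le.
suff -> : P l x = u by [].
apply/eqP; rewrite -subr_eq0; apply/eqP; set z := _ - _.
have lim k : P (m k) u = P (m k) x.
  apply: (cvs_uniq (cvs_shift k (cvs_adj (sP (m k)) hu))).
  move: (cvs_cst (P (m k) x)); congr cvs; apply/funext => n.
  by rewrite P_mono'// mm// leq_addl.
have Pu : P l u = u.
  apply: (cvs_uniq (cvs_adj (sP l) hu)); move: hu; congr cvs; apply/funext => n.
  by rewrite P_mono.
have Pz : P l z = z by rewrite /z (adjB _ _ (sP l)) PP Pu.
apply: (D_null Pz); apply: small_eq => e e0.
have c0 : 0 <= ip (c z) z by exact: resolvent_ge0 sT rT z.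
have K0 : 0 < ip (c z) z + 1 by lra.
have [|N hN] := @inv_lt _ (e / (ip (c z) z + 1)); first by rewrite divr_gt0.
have := D_neg (_ : P (m N) z = 0); rewrite {1}/z (adjB _ _ (sP _)) lim P_mono' ?lm// subrr.
move=> /(_ erefl); rewrite (D_ip l (m N)); have := hN _ (leqnn N); rewrite ltr_pdivlMr//.
rewrite /m; move: (N.+1%:R^-1) => r; nra.
Qed.

(** On a nonzero vector a - n c, or - a - n c, cannot be nonnegative for all n. *)
Let P_top x : cvs (fun n => P n%:R x) 0.
Proof.
have [u hu] : exists u, cvs (fun n => P n%:R x) u.
  apply: (monotone_cvs (s := fun n => - ip (P n%:R x) x) (K := 0)).
    by move=> i j ij; rewrite -[P j%:R x - _]opprB !ipNl !ipNr !opprK P_diff ?ler_nat//; lra.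
  by move=> n; rewrite oppr_le0 oproj_ip ?ip_ge0.
suff -> : 0 = u by [].
have Pu k : P k%:R u = u.
  apply: (cvs_uniq (cvs_shift k (cvs_adj (sP k%:R) hu))).
  move: (cvs_shift k hu); congr cvs; apply/funext => n.
  by rewrite P_mono// ler_nat leq_addl.
apply/esym/(resolvent_ip0 sT rT)/eqP; rewrite eq_le (resolvent_ge0 sT rT) andbT leNgt; apply/negP => c0.
have := D_pos (Pu (Num.truncn (ip (a u) u / ip (c u) u)).+1).
have := truncnS_gt (ip (a u) u / ip (c u) u); rewrite ltr_pdivrMr//.
by move: (_%:R) => r; rewrite /D /shifted !ipE; lra.
Qed.

Let P_bot x : cvs (fun n => P (- n%:R) x) x.
Proof.
have [u hu] : exists u, cvs (fun n => P (- n%:R) x) u.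
  apply: (monotone_cvs (s := fun n => ip (P (- n%:R) x) x) (K := ip x x)).
    by move=> i j ij; rewrite P_diff ?lerN2 ?ler_nat//.
  by move=> n; exact: oproj_le.
suff e : x = u by rewrite {2}e.
apply/eqP; rewrite -subr_eq0; apply/eqP; set z := x - u.
have Pz k : P (- k%:R) z = 0.
  rewrite /z (adjB _ _ (sP _)); apply/eqP; rewrite subr_eq0; apply/eqP/esym.
  apply: (cvs_uniq (cvs_shift k (cvs_adj (sP (- k%:R)) hu))).
  move: (cvs_cst (P (- k%:R) x)); congr cvs; apply/funext => n.
  by rewrite P_mono'// lerN2 ler_nat leq_addl.
apply/(resolvent_ip0 sT rT)/eqP; rewrite eq_le (resolvent_ge0 sT rT) andbT leNgt; apply/negP => c0.
have := D_neg (Pz (Num.truncn (- ip (a z) z / ip (c z) z)).+1).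
have := truncnS_gt (- ip (a z) z / ip (c z) z); rewrite ltr_pdivrMr//.
by move: (_.+1%:R) => r; rewrite /D /shifted !ipE; lra.
Qed.

(** ** The measures d<E(.) x, x> *)

Let F x l := ip x x - ip (P l x) x.

Let F_nd x : nondecreasing (F x).
Proof. by move=> l m lm; rewrite /F lerD2l lerN2 P_mono_ip. Qed.

Let F_rc x : right_continuous (F x).
Proof.
move=> l; apply/cvgrPdist_lt => e e0.
have [N hN] := cvs_ip x (P_right l x) e0; have := hN N (leqnn _).
have : l < l + N.+1%:R^-1 by rewrite ltrDl invr_gt0.
move: (l + _) => m lm; rewrite ltr_norml => /andP[h1 _].
near=> t.
have lt : l <= t by apply: ltW; near: t; exact: nbhs_right_gt.
have tm : t <= m by apply: ltW; near: t; exact: nbhs_right_lt.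
have := P_mono_ip x lt; have := P_mono_ip x tm.
by rewrite /F ltr_norml => ? ?; apply/andP; split; lra.
Unshelve. all: by end_near. Qed.

Let Fc x : cumulative R R :=
  HB.pack_for (cumulative R R) (F x) (isCumulative.Build R _ R (F x) (@F_nd x) (@F_rc x)).

Let mu x : {measure set (measurableTypeR R) -> \bar R} := lebesgue_stieltjes_measure (Fc x).

Let mu_itv x (p q : R) : p <= q -> mu x `]p, q]%classic = (ip (P p x) x - ip (P q x) x)%:E.
Proof.
move=> pq; rewrite /mu/= /lebesgue_stieltjes_measure /measure_extension.
rewrite measurable_mu_extE/=; last exact: is_ocitv.
by rewrite wlength_itv_bnd//; congr (_%:E); rewrite /F; ring.
Qed.

Let mu_setT x : mu x setT = (ip x x)%:E.
Proof.
pose I n : set R := `]- (n%:R), n%:R]%classic.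
have -> : setT = \bigcup_n I n by rewrite -(bigcup_itvT false false).
have h1 : (mu x \o I) n @[n --> \oo] --> mu x (\bigcup_n I n).
  apply: nondecreasing_cvg_mu.
  - by move=> n; exact: measurable_itv.
  - by apply: bigcup_measurable => n _; exact: measurable_itv.
  - by move=> *; apply/subsetPset/subset_itv; rewrite leBSide/= ?lerN2 ler_nat.
apply: (cvg_unique _ h1) => //.
rewrite (_ : mu x \o I = EFin \o (fun n : nat => ip (P (- n%:R) x) x - ip (P n%:R x) x)); last first.
  apply/funext => n /=; rewrite /I mu_itv//; have : 0 <= n%:R :> R by [].
  by lra.
apply: cvg_EFin; first by near=> n.
apply/cvgrPdist_lt => e e0; have e2 : 0 < e / 2 by rewrite divr_gt0.
have [N1 h2] := cvs_ip x (P_bot x) e2; have [N2 h3] := cvs_ip x (P_top x) e2.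
exists (maxn N1 N2) => // n /=; rewrite geq_max => /andP[/h2 + /h3].
rewrite ip0l subr0 !ltr_norml => /andP[? ?] /andP[? ?].
by apply/andP; split; lra.
Unshelve. all: by end_near. Qed.

(** Q is the spectral projection of S. *)
Let projects S Q := oproj Q /\ forall x, (ip (Q x) x)%:E = mu x S.

Let projects_uniq S Q Q' : projects S Q -> projects S Q' -> forall x, Q x = Q' x.
Proof.
move=> [[sQ _] h] [[sQ' _] h']; apply: sa_form_inj => // x.
by have := h x; rewrite -h' => -[].
Qed.

Let projects_bigcup (S : nat -> set R) (Q : nat -> V -> V) :
  (forall k, measurable (S k)) -> trivIset setT S -> (forall k, projects (S k) (Q k)) ->
  exists2 P', projects (\bigcup_k S k) P' & forall x, cvs (fun n => \sum_(0 <= k < n) Q k x) (P' x).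
Proof.
move=> mS tS hQ; have mU : measurable (\bigcup_k S k) by exact: bigcup_measurable.
have hs x : (fun n => \sum_(0 <= k < n) mu x (S k))%E @ \oo --> mu x (\bigcup_k S k).
  exact: measure_semi_sigma_additive.
have Esum x n : (\sum_(0 <= k < n) mu x (S k))%E = (\sum_(0 <= k < n) ip (Q k x) x)%:E.
  by rewrite -sumEFin; apply: eq_bigr => k _; rewrite (hQ k).2.
have [||P' oP' hP'] := @oproj_series _ _ Q; first by move=> k; case: (hQ k).
  move=> n x; rewrite -lee_fin -Esum -mu_setT.
  apply: (@le_trans _ _ (\sum_(0 <= k <oo) mu x (S k))%E); first exact: nneseries_lim_ge.
  by rewrite (cvg_lim _ (hs x))// le_measure// inE.
exists P' => //; split=> // x.
apply: (cvg_unique _ _ (hs x)) => //.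
rewrite (_ : (fun n => _) = EFin \o (fun n => \sum_(0 <= k < n) ip (Q k x) x)); last exact/funext/Esum.
apply: cvg_EFin; first by near=> n.
apply/cvgrPdist_lt => e e0; have [N hN] := cvs_ip x (hP' x) e0.
exists N => // n /= /hN; rewrite distrC; congr (`|_ - _| < _).
by elim: n => [|n ih]; rewrite ?big_nil ?ip0l// !big_nat_recr//= ipDl ih.
Unshelve. all: by end_near. Qed.

Let projects_exist S : measurable S -> exists2 Q, projects S Q &
  forall C C', adj C C' -> (forall l x, C (P l x) = P l (C x)) -> forall x, C (Q x) = Q (C x).
Proof.
move=> mS; apply: (@dynkin_induction _ R (@ocitv R) [set S | exists2 Q, projects S Q &
  forall C C', adj C C' -> (forall l x, C (P l x) = P l (C x)) -> forall x, C (Q x) = Q (C x)]) => //.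
- exact: ocitvI.
- by exists id => //; split=> // x; rewrite mu_setT.
- move=> I /ocitvP [->|[[p q] /= pq ->]].
    exists (fun=> 0); last by move=> C C' aC _ x; rewrite (adj0 aC).
    split; first by split=> // x y; rewrite linear0l linear0r.
    by move=> x; rewrite ip0l measure0.
  exists (fun x => P p x - P q x); last first.
    by move=> C C' aC h x; rewrite (adjB _ _ aC) !h.
  split; last by move=> x; rewrite mu_itv ?ltW// ipDl ipNl.
  split; first exact: sa_sub.
  move=> x; rewrite (adjB _ _ (sP p)) (adjB _ _ (sP q)) !PP.
  by rewrite P_mono ?P_mono' ?ltW// subrr subr0.
- move=> A mA [Q [oQ hQ] QC]; exists (fun x => x - Q x); last first.
    by move=> C C' aC h x; rewrite (adjB _ _ aC) (QC C C').
  split; first exact: oprojC.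
  move=> x; have mC : measurable (~` A) by exact: measurableC.
  have : (mu x (A `|` ~` A) = mu x A + mu x (~` A))%E by rewrite measureU// setICr.
  rewrite setUv mu_setT -hQ ipDl ipNl; case: (mu x (~` A)) => [r| |]//= [] e.
  by congr (_%:E); rewrite e; ring.
- move=> A mA tA hA; have /choice[Q hQ] : forall k, exists Q, projects (A k) Q /\
      forall C C', adj C C' -> (forall l x, C (P l x) = P l (C x)) -> forall x, C (Q x) = Q (C x).
    by move=> k; have [Q h1 h2] := hA k; exists Q.
  have [P' h1 h2] := projects_bigcup mA tA (fun k => (hQ k).1).
  exists P' => // C C' aC h x; apply: (cvs_uniq (cvs_adj aC (h2 x))).
  move: (h2 (C x)); congr cvs; apply/funext => n.
  elim: n => [|n ih]; first by rewrite !big_nil (adj0 aC).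
  by rewrite !big_nat_recr//= (adjD _ _ aC) ih ((hQ n).2 C C').
Qed.

Let pack_linear (f : V -> V) (lf : linear f) : {linear V -> V} :=
  HB.pack f (GRing.isLinear.Build _ _ _ _ _ lf).

Lemma spectral_projections_exist : exists2 E : set R -> {linear V -> V},
  projection_valued_measure E & spectral_measure_of T E.
Proof.
have /choice[E hE] : forall S, exists L : {linear V -> V}, measurable S ->
    projects S L /\ forall C C', adj C C' -> (forall l x, C (P l x) = P l (C x)) -> forall x, C (L x) = L (C x).
  move=> S; have [mS|nS] := pselect (measurable S); last first.
    by exists (pack_linear (adj_linear (sP 0))).
  have [Q hQ QC] := projects_exist mS; have sQ : sa Q by case: hQ => [[]].
  by exists (pack_linear (adj_linear sQ)).
have pE : projection_valued_measure E.
  split.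
  - by move=> S mS x; have [[[_ h] _] _] := hE S mS; exact: h.
  - by move=> S mS x y; have [[[h _] _] _] := hE S mS; exact: h.
  - move=> x; have [[oE h] _] := hE setT measurableT; apply: (oproj_fix oE).
    by have := h x; rewrite mu_setT => -[].
  - move=> S mS tS x; apply/cvsP.
    have [Q hQ hc] := projects_bigcup mS tS (fun k => (hE _ (mS k)).1).
    have mU : measurable (\bigcup_k S k) by exact: bigcup_measurable.
    by rewrite (projects_uniq (hE _ mU).1 hQ).
exists E => //; apply/(spectral_measureP _ pE).
have Eitv p q x : p <= q -> E `]p, q]%classic x = P p x - P q x.
  move=> pq; have [h _] := hE `]p, q]%classic (measurable_itv _).
  apply: (projects_uniq h (Q' := fun x => P p x - P q x)); split; last by move=> y; rewrite mu_itv// ipDl ipNl.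
  split; first exact: sa_sub.
  move=> y; rewrite (adjB _ _ (sP p)) (adjB _ _ (sP q)) !PP.
  by rewrite P_mono ?P_mono'// subrr subr0.
have cE S x : measurable S -> c (E S x) = E S (c x).
  by move=> mS; have [_ h] := hE S mS; apply: (h c c).
have aE S x : measurable S -> a (E S x) = E S (a x).
  by move=> mS; have [_ h] := hE S mS; apply: (h a a).
have Edisj S I w : measurable S -> measurable I -> S `&` I = set0 -> E S w = w -> E I w = 0.
  by move=> mS mI SI <-; rewrite (pvm_disj pE)// setIC.
have top S q w : measurable S -> E S w = w -> (forall t, S t -> t <= q) -> P q w = 0.
  move=> mS Sw hS.
  have qN : q <= (Num.truncn q).+1%:R by exact/ltW/truncnS_gt.
  apply: (cvs_uniq _ (cvs_shift (Num.truncn q).+1 (P_top w))).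
  move: (cvs_cst (P q w)); congr cvs; apply/funext => n.
  have qn : q <= (n + (Num.truncn q).+1)%:R.
    by apply: le_trans qN _; rewrite ler_nat leq_addl.
  apply/eqP; rewrite -subr_eq0 -Eitv//; apply/eqP/(Edisj S) => //.
  by apply/seteqP; split=> // t [/hS tq /=]; rewrite in_itv/= => /andP[]; rewrite ltNge tq.
have bot S p w : measurable S -> E S w = w -> (forall t, S t -> p < t) -> P p w = w.
  move=> mS Sw hS.
  have qN : - (Num.truncn (- p)).+1%:R <= p by rewrite lerNl; exact/ltW/truncnS_gt.
  apply: (cvs_uniq _ (cvs_shift (Num.truncn (- p)).+1 (P_bot w))).
  move: (cvs_cst (P p w)); congr cvs; apply/funext => n.
  have qn : - (n + (Num.truncn (- p)).+1)%:R <= p.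
    by apply: le_trans qN; rewrite lerN2 ler_nat leq_addl.
  apply/eqP; rewrite eq_sym -subr_eq0 -Eitv//; apply/eqP/(Edisj S) => //.
  by apply/seteqP; split=> // t [/hS tq /=]; rewrite in_itv/= => /andP[_]; rewrite leNgt tq.
(* For p < v - e and q = v + e, the operator D q is negative and D p is positive
   on the range of E S, so <D q w, D p w> <= 0 there. *)
have loc z : local E id (c z) (a z).
  move=> S v e mS hS; have [->|/set0P[t0 St0]] := eqVneq S set0.
    by rewrite !(pvm_set0 pE) scaler0 subrr nm0 mulr0.
  have e0 : 0 <= e by apply: le_trans (hS _ St0).
  rewrite -aE// -cE//; set w := E S z.
  have Sw : E S w = w by exact: pvm_idem.
  set X := a w - v *r c w; set Y := c w.
  have key (h : R) : 0 < h -> ip (X - e *r Y) (X + (e + h) *r Y) <= 0.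
    move=> h0; pose p := v - e - h; pose q := v + e.
    have Pq : P q w = 0.
      by apply: (top S) => // t /hS; rewrite ler_norml /q => /andP[_ ?]; lra.
    have Pp : P p w = w.
      by apply: (bot S) => // t /hS; rewrite ler_norml /p => /andP[? _]; lra.
    have sA : sa (fun x => D p (P p x)) by apply: sa_comp => // x; rewrite PD.
    have sB : sa (fun x => - D q (x - P q x)).
      apply: sa_opp; apply: sa_comp => //; first exact: sa_sub.
      by move=> x; rewrite (adjB _ _ (sD q)) PD.
    have DD x : D p (D q x) = D q (D p x).
      rewrite -[LHS]/(a (D q x) - p *r c (D q x)) aD cD.
      by rewrite -(adjZ _ _ (sD q)) -(adjB _ _ (sD q)).
    have AB x : D p (P p (- D q (x - P q x))) = - D q (D p (P p x) - P q (D p (P p x))).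
      rewrite (adjN _ (sP p)) (adjN _ (sD p)) PD DD; congr (- D q _).
      by rewrite (adjB _ _ (sP p)) (adjB _ _ (sD p)) PD PPC.
    have A0 x : 0 <= ip (D p (P p x)) x by case: (hP p) => _ _ _ [].
    have B0 x : 0 <= ip (- D q (x - P q x)) x.
      by rewrite ipNl oppr_ge0; case: (hP q) => _ _ _ [].
    have := commuting_pos sA sB AB A0 B0 w; rewrite (adj_ip _ _ sA) Pp Pq subr0 ipNl oppr_ge0.
    have -> : D q w = X - e *r Y by apply: ip_inj => k; rewrite /D /shifted /X /q !ipE; ring.
    have -> // : D p w = X + (e + h) *r Y by apply: ip_inj => k; rewrite /D /shifted /X /p !ipE; ring.
  clearbody X Y.
  rewrite -(@ler_pXn2r _ 2) ?nnegrE ?mulr_ge0 ?nm_ge0// exprMn !nm2 -subr_le0.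
  apply: small_eq => d d0.
  have K0 : 0 < e * ip Y Y + `|ip X Y| + 1 by rewrite ltr_wpDl// addr_ge0// mulr_ge0 ?ip_ge0.
  have := key _ (divr_gt0 d0 K0); have e1 : d / (e * ip Y Y + `|ip X Y| + 1) * (e * ip Y Y + `|ip X Y| + 1) = d.
    by rewrite divfK// gt_eqF.
  have := divr_gt0 d0 K0; move: (d / _) e1 => h e1 h0; rewrite !ipE (ipC Y X).
  have := ler_norm (- ip X Y); rewrite normrN; nra.
have loc2 z : local E id (a z) (z - c z).
  have [u hu] := sa_dense_range sc (resolvent_inj0 sT rT) z.
  apply: (local_closed pE (cvs_adj sa_a hu) (cvsB hu (cvs_adj sc hu))) => n.
  have [e1 e2] := resolvent_comm sT rT (u n); rewrite -e1 -e2; exact: loc.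
have mid : measurable_fun setT (@id R) by exact: measurable_id.
have TE x y : T (x, y) -> local E id x y.
  move=> t; have [e1 e2] := resolvent_graph sT rT t.
  by have := local_linear pE 1 mid (loc x) (loc2 y); rewrite !scale1r -e1 -e2.
move=> x y; split=> [|h]; first exact: TE.
apply: (selfadjoint_mem sT) => u v /TE h'.
exact: (local_sym pE mid h' h).
Qed.

End Existence.

Lemma spectral_theorem (R : realType) (V : hilbertType R) (T : op V) : selfadjoint T ->
  exists2 E, projection_valued_measure E & spectral_measure_of T E.
Proof.
move=> sT; have [c [a rT]] := resolvent_pair_exists sT.
have /choice[P hP] : forall l, exists P, pos_proj (shifted c a l) P /\
    forall C C', adj C C' -> (forall x, C (shifted c a l x) = shifted c a l (C x)) ->
      forall x, C (P x) = P (C x).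
  by move=> l; have [P h1 h2] := pos_proj_exists (sa_shifted sT rT l); exists P.
exact: (spectral_projections_exist sT rT (fun l => (hP l).1) (fun l => (hP l).2)).
Qed.

(** * Functions of a self-adjoint operator *)

Section OpFun.
Context (R : realType) (V : hilbertType R).
Implicit Types (x y z u w : V) (S : set R) (f g h phi : R -> R) (T : op V).

Lemma dense_cvs (D : set V) : (forall x, exists u : nat -> V, (forall n, D (u n)) /\ cvs u x) -> dense D.
Proof.
move=> h O [x Ox] oO; have [u [uD /cvsP ux]] := h x.
have /ux [N _ hN] : nbhs x O by exact: open_nbhs_nbhs.
by exists (u N); split => //; exact: hN N (leqnn _).
Qed.

Lemma local_eq_pvm (E E' : set R -> {linear V -> V}) f x y :
  (forall S, measurable S -> forall x, E S x = E' S x) -> local E f x y -> local E' f x y.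
Proof. by move=> h H S v e mS hS; rewrite -!h//; exact: H. Qed.

Section Fixed.
Variables (E : set R -> {linear V -> V}).
Hypothesis pE : projection_valued_measure E.
Let mid : measurable_fun setT (@id R). Proof. exact: measurable_id. Qed.

(** E P x lies in the domain of T when P is a piece on which the identity is
    bounded; finite sums of such vectors are dense, and testing the adjoint on
    them shows that it is contained in T. *)
Lemma spectral_selfadjoint T : (forall x y, T (x, y) <-> local E id x y) -> selfadjoint T.
Proof.
move=> TE; have [P [v [pP hv]]] := sampled_partition mid ltr01.
case: (pP) => mP tP uP.
have ex k x : exists y, local E id (E (P k) x) y.
  have [e|/set0P[t0 Pt0]] := eqVneq (P k) set0.
    by exists 0; rewrite e (pvm_set0 pE); exact: local0.
  apply: (local_exists pE mid); exists ((`|v k| + 1) *r x) => S c mS c0 hS.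
  rewrite pvm_setI// linearZ/= nmZ.
  have [->|/set0P[t [St Pt]]] := eqVneq (S `&` P k) set0.
    by rewrite (pvm_set0 pE) nm0 mulr0 mulr_ge0 ?nm_ge0.
  apply: ler_pM => //; rewrite ?nm_ge0//.
    rewrite ger0_norm ?addr_ge0//; apply: le_trans (hS _ St) _.
    have [h _] := hv k t Pt; have := ler_normD (t - v k) (v k); rewrite subrK /=.
    by move: h => /=; lra.
  by rewrite (setIC S) -(pvm_setI pE x (mP k) mS); exact: (nm_pvm_le pE _ (mP k)).
have sum n x (Y : nat -> V) : (forall k, local E id (E (P k) x) (Y k)) ->
    local E id (\sum_(0 <= k < n) E (P k) x) (\sum_(0 <= k < n) Y k).
  move=> hY; elim: n => [|n ih]; first by rewrite !big_nil; exact: local0.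
  by rewrite !big_nat_recr//=; have := local_linear pE 1 mid ih (hY n); rewrite !scale1r.
have lim x : cvs (fun n => \sum_(0 <= k < n) E (P k) x) x.
  by have := pvm_series pE x mP tP; rewrite uP pvm_setT.
split.
- split; last by move=> x y z /TE h /TE h'; exact: (local_unique pE mid h h').
  split; first by apply/TE; exact: local0.
  by move=> b [x y] [x' y'] /TE h /TE h'; apply/TE; exact: local_linear.
- apply: dense_cvs => x; have /choice[Y hY] := ex ^~ x.
  by exists (fun n => \sum_(0 <= k < n) E (P k) x); split => // n; exists (\sum_(0 <= k < n) Y k); apply/TE; exact: sum.
- apply/seteqP; split=> -[x y] /=.
    by move=> /TE h u' v' /TE h'; exact: (local_sym pE mid h' h).
  move=> h; apply/TE; apply: (local_closed pE (lim x) (lim y)) => n; apply: sum => k.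
  have [yk hk] := ex k x; suff -> : E (P k) y = yk by [].
  have fk : E (P k) yk = yk by exact: (local_proj_fix pE mid (mP k) hk (pvm_idem pE _ (mP k))).
  apply: inner_inj => w; rewrite -fk -!(pvm_sa pE (mP k)).
  have [vk hvk] := ex k w; have /= := h _ _ ((TE _ _).2 hvk) => <-.
  have fv : E (P k) vk = vk by exact: (local_proj_fix pE mid (mP k) hvk (pvm_idem pE _ (mP k))).
  by rewrite -fv (pvm_sa pE (mP k)) (local_sym pE mid hvk hk).
Qed.

(** The spectral measure of phi(T) is the image of that of T under phi. *)
Definition push phi S : {linear V -> V} := E (phi @^-1` S).

Lemma measurable_preimage phi S : measurable_fun setT phi -> measurable S ->
  measurable (phi @^-1` S).
Proof. by move=> mp mS; rewrite -[X in measurable X]setTI; apply: mp. Qed.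

Lemma push_pvm phi : measurable_fun setT phi -> projection_valued_measure (push phi).
Proof.
move=> mp; have mpre := fun S => @measurable_preimage phi S mp; split.
- by move=> S mS x; rewrite /push pvm_idem//; exact: mpre.
- by move=> S mS x y; rewrite /push (pvm_sa pE)//; exact: mpre.
- by move=> x; rewrite /push preimage_setT pvm_setT.
- move=> F mF tF x; rewrite /push preimage_bigcup; apply/cvsP; apply: pvm_series => //.
    by move=> n; exact: mpre.
  by move=> i j _ _ [t [Fi Fj]]; apply: tF => //; exists (phi t).
Qed.

(** From right to left this is a matter of preimages.  From left to right,
    [local] for phi^-1(S) only says something about sets of this form; existence
    of a vector for g o phi together with uniqueness avoids the question. *)
Lemma local_push phi g x y : measurable_fun setT phi -> measurable_fun setT g ->
  local (push phi) g x y <-> local E (g \o phi) x y.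
Proof.
move=> mp mg; have pp := push_pvm mp.
have mpre := fun S => @measurable_preimage phi S mp.
have back z : local E (g \o phi) x z -> local (push phi) g x z.
  by move=> h S v e mS hS; apply: h; [exact: mpre|move=> t; exact: hS].
split=> [h|]; last exact: back.
have mgp : measurable_fun setT (g \o phi) by exact: measurableT_comp.
have dg : dominated (push phi) g x.
  by apply: (local_dominated pp (C := 1) mg _ h) => // t; rewrite mul1r; lra.
have [P [w [K [[mP tP uP] hw hK]]]] := dominated_partition pp mg dg.
have [z hz] : exists z, local E (g \o phi) x z.
  apply: (local_exists pE mgp).
  apply: (dominated_of_partition pE (P := fun k => phi @^-1` P k) (w := w) _ _ hK).
    split; first by move=> k; exact: mpre.
      by move=> i j _ _ [t [Fi Fj]]; apply: tP => //; exists (phi t).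
    by rewrite -preimage_bigcup uP preimage_setT.
  by move=> k t; exact: hw.
by rewrite (local_unique pp mg h (back z hz)).
Qed.

Lemma op_funP T f x y : measurable_fun setT f ->
  (forall x y, T (x, y) <-> local E id x y) -> op_fun f T (x, y) <-> local E f x y.
Proof.
move=> mf TE; have hE : spectral_measure_of T E by apply/spectral_measureP.
split=> [[E' hE' /(spectral_integralP hE'.1 _ _ mf)]|h]; last first.
  by exists E => //; apply/spectral_integralP.
apply: local_eq_pvm; exact: (spectral_measure_unique (spectral_selfadjoint TE) hE' hE).
Qed.

End Fixed.

Lemma op_fun_compP (E : set R -> {linear V -> V}) T phi f x y :
  projection_valued_measure E -> measurable_fun setT phi -> measurable_fun setT f ->
  (forall x y, T (x, y) <-> local E phi x y) ->
  op_fun f T (x, y) <-> local E (f \o phi) x y.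
Proof.
move=> pE mp mf TE; rewrite -(local_push pE _ _ mp mf).
apply: (op_funP (push_pvm pE mp) _ _ mf) => x' y'.
by rewrite (local_push pE _ _ mp (@measurable_id _ _ setT)); exact: TE.
Qed.

End OpFun.

Section BoundedFunctions.
Context (R : realType) (V : hilbertType R).
Implicit Types (x y z u w : V) (S : set R) (f g h : R -> R) (T : op V).

Lemma measurable_sqrt f : measurable_fun setT f -> measurable_fun setT (fun t => Num.sqrt (f t)).
Proof.
move=> mf; apply: (measurableT_comp (f := @Num.sqrt R)) => //.
by apply: continuous_measurable_fun; exact: sqrt_continuous.
Qed.

(** 1 / f = q o f for the continuous q(r) = r / max(1, r^2). *)
Lemma measurable_inv f : measurable_fun setT f -> (forall t, 1 <= `|f t|) ->
  measurable_fun setT (fun t => 1 / f t).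
Proof.
move=> mf f1; pose q (r : R) := r / Num.max 1 (r ^+ 2).
have qc : continuous q.
  move=> r; apply: cvgM; first exact: cvg_id.
  apply: cvgV; first by rewrite gt_eqF// lt_max ltr01.
  apply: (@continuous_max R R (fun=> 1) (fun r => r ^+ 2) r).
    exact: cvg_cst.
  exact: exprn_continuous.
rewrite (_ : (fun t => _) = q \o f).
  by apply: measurableT_comp => //; exact: continuous_measurable_fun.
apply/funext => t /=; have f0 : f t != 0 by rewrite -normr_gt0 (lt_le_trans ltr01).
rewrite /q max_r; first by field.
by rewrite -(real_normK (num_real (f t))) expr_ge1.
Qed.

Section Fixed.
Variables (E : set R -> {linear V -> V}).
Hypothesis pE : projection_valued_measure E.

Lemma bounded_function_op f (C : R) : measurable_fun setT f -> (forall t, `|f t| <= C) ->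
  exists2 F, sa F & forall x, local E f x (F x).
Proof.
move=> mf hC; have /choice[F hF] := fun x => local_exists_bounded pE x mf hC.
by exists F => // x y; exact: (local_sym pE mf (hF x) (hF y)).
Qed.

Lemma inverse_function_op f : measurable_fun setT f -> (forall t, 1 <= `|f t|) ->
  exists F, [/\ sa F, inj0 F, forall x, local E (fun t => 1 / f t) x (F x) &
    forall x u, local E f x u <-> x = F u].
Proof.
move=> mf f1; have mi := measurable_inv mf f1.
have [|F sF hF] := @bounded_function_op _ 1 mi.
  move=> t; rewrite normrM normrV ?unitfE -?normr_gt0 ?(lt_le_trans ltr01)//.
  by rewrite normr1 mul1r invf_le1 ?(lt_le_trans ltr01).
have FP x u : local E f x u <-> x = F u.
  split=> [/(local_recip pE mf f1) h|->]; first exact: (local_unique pE mi h (hF u)).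
  exact: local_inv.
exists F; split => // u Fu.
have := (FP (F u) u).2 erefl; rewrite Fu => h.
exact: (local_unique pE mf h (@local0 _ _ E f)).
Qed.

Lemma function_op_comm f g (Cf Cg : R) F G : measurable_fun setT f -> measurable_fun setT g ->
  (forall t, `|f t| <= Cf) -> (forall t, `|g t| <= Cg) ->
  (forall x, local E f x (F x)) -> (forall x, local E g x (G x)) ->
  forall x, F (G x) = G (F x).
Proof.
move=> mf mg hf hg hF hG x.
have Cf0 : 0 <= Cf by apply: le_trans (hf 0). have Cg0 : 0 <= Cg by apply: le_trans (hg 0).
have h1 := local_mul pE mg mf Cf0 hf (hG x) (hF (G x)).
have h2 := local_mul pE mf mg Cg0 hg (hF x) (hG (F x)).
have mfg : measurable_fun setT (fun t => f t * g t) by exact: measurable_funM.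
apply: (local_unique pE mfg h1); move: h2; congr local.
by apply/funext => t; rewrite mulrC.
Qed.

Lemma local_isometry J J' f x y : adj J J' -> (forall w, nm (J w) = nm w) ->
  (forall S, measurable S -> forall w, J (E S w) = E S (J w)) ->
  local E f x y -> local E f (J x) (J y).
Proof.
move=> aJ nJ JE h S v e mS hS.
rewrite -!JE// -(adjZ _ _ aJ) -(adjB _ _ aJ) !nJ; exact: h.
Qed.

Lemma spectral_comm T J J' : (forall x y, T (x, y) <-> local E id x y) -> adj J J' ->
  (forall x y, T (x, y) -> T (J x, J y)) ->
  forall S, measurable S -> forall x, J (E S x) = E S (J x).
Proof.
move=> TE aJ; have hE : spectral_measure_of T E by apply/spectral_measureP.
exact: (spectral_intertwine (spectral_selfadjoint pE TE) hE hE aJ).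
Qed.

End Fixed.
End BoundedFunctions.

Section UnitarySign.
Context (R : realType) (s : R).
Hypothesis s1 : s = -1 \/ s = 1.
Local Notation sg := (unitary_sign s).

Lemma measurable_unitary_sign : measurable_fun setT sg.
Proof.
apply: measurable_fun_ifT; first exact: measurable_fun_ltr.
  exact: measurable_cst.
by apply: measurable_fun_ifT; [exact: measurable_fun_eqr|exact: measurable_cst..].
Qed.

Lemma unitary_signE t : (sg t = -1 /\ t <= 0) \/ (sg t = 1 /\ 0 <= t).
Proof.
rewrite /unitary_sign; case: (ltP t 0) => [t0|t0]; first by left; split => //; exact: ltW.
by case: eqP => [->|_]; [case: s1 => ->; [left|right]|right].
Qed.

Lemma norm_unitary_sign t : `|sg t| = 1.
Proof. by case: (unitary_signE t) => -[-> _]; rewrite ?normrN normr1. Qed.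

Lemma norm_add_unitary_sign t : `|t + sg t| = `|t| + 1.
Proof.
case: (unitary_signE t) => -[-> t0]; first by rewrite !ler0_norm; lra.
by rewrite !ger0_norm; lra.
Qed.

Lemma sqr_unitary_sign t : sg t * sg t = 1.
Proof. by case: (unitary_signE t) => -[-> _]; rewrite ?mulrNN mulr1. Qed.

Lemma unitary_sign_div t : sg t * (1 / `|t + sg t|) = 1 / (t + sg t).
Proof.
case: (unitary_signE t) => -[-> t0]; first by rewrite ler0_norm; [field; lra|lra].
by rewrite ger0_norm ?mul1r//; lra.
Qed.

End UnitarySign.

(** * The operators attached to A and to B *)

Section FactorA.
Context (R : realType) (V : hilbertType R).
Implicit Types (x y z u w : V) (T A B : op V).

Lemma op_appE T x y : (forall y', T (x, y') -> y' = y) -> T (x, y) -> app T x = y.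
Proof.
move=> h t; rewrite /app; case: xgetP => [z _ tz|/(_ y)//].
exact: h.
Qed.

(** L = (A + 1)^(-1/2) and C = A^(1/2) L.  On the spectrum of A, which lies in
    [0, oo[, the function max(t, 0) + 1 agrees with t + 1 and is at least 1
    everywhere. *)
Lemma form_factor A : selfadjoint A -> op_ge0 A -> exists L C, [/\
  [/\ sa L, inj0 L & sa C],
  (forall x u, op_sqrt (op_add A op_id) (x, u) <-> x = L u),
  (forall x y, op_sqrt A (x, y) <-> exists2 u, x = L u & y = C u),
  (forall u, C (C u) + L (L u) = u) &
  (forall J, sa J -> (forall x, J (J x) = x) -> (forall x y, A (x, y) -> A (J x, J y)) ->
     forall u, J (L u) = L (J u) /\ J (C u) = C (J u))].
Proof.
move=> sA A0; have [E pE hE] := spectral_theorem sA.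
have /(spectral_measureP _ pE) AE := hE.
have mid : measurable_fun setT (@id R) by exact: measurable_id.
(* By positivity of A, its spectral measure vanishes on ]-oo, 0[. *)
have neg : E `]-oo, 0[%classic =1 fun=> 0.
  move=> w; have mS : measurable (`]-oo, (0 : R)[%classic) by exact: measurable_itv.
  have [c [a rT]] := resolvent_pair_exists sA.
  pose z := E `]-oo, 0[%classic w.
  have [t1 t2] := rT z.
  have [h1 h2] := local_resolvent pE ((AE _ _).1 t1) ((AE _ _).1 t2).
  have [m1 m2 m3] := measurable_shift (0 : R).
  have ez : E `]-oo, 0[%classic z = z by exact: pvm_idem.
  have ec := local_proj_fix pE m1 mS h1 ez.
  apply: (resolvent_inj0 sA rT); apply: (local_pos pE (measurable_funN mid) mS (local_opp ((AE _ _).1 t1)) ec).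
    by move=> t /=; rewrite in_itv/= oppr_gt0.
  rewrite ipNl oppr_le0.
  have := A0 _ _ t1; rewrite /ip; by case: ('[a z, c z]) => p q; rewrite lecE /= => /andP[].
pose g (t : R) := Num.sqrt (Num.max t 0 + 1); pose r (t : R) := Num.sqrt t.
have mg : measurable_fun setT g.
  apply: measurable_sqrt; apply: measurable_funD; last exact: measurable_cst.
  by apply: measurable_maxr => //; exact: measurable_cst.
have mr : measurable_fun setT r by exact: measurable_sqrt.
have g1 t : 1 <= g t.
  by rewrite -[leLHS]sqrtr1 ler_wsqrtr// lerDr le_max lexx orbT.
have g1' t : 1 <= `|g t| by rewrite ger0_norm// ltW// (lt_le_trans ltr01).
have gr t : g t ^+ 2 = r t ^+ 2 + 1.
  rewrite sqr_sqrtr; last by rewrite addr_ge0// le_max lexx orbT.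
  rewrite /r; case: (leP t 0) => t0; first by rewrite ler0_sqrtr// expr0n.
  by rewrite sqr_sqrtr// ltW.
have r0 t : 0 <= r t by exact: sqrtr_ge0.
have rg t : `|r t| <= `|g t|.
  rewrite !ger0_norm ?sqrtr_ge0// -(@ler_pXn2r _ 2) ?nnegrE ?sqrtr_ge0// gr.
  by rewrite lerDl.
have gr1 t : `|g t| <= 1 * (1 + `|r t|).
  rewrite mul1r !ger0_norm ?sqrtr_ge0// -(@ler_pXn2r _ 2) ?nnegrE ?sqrtr_ge0 ?addr_ge0// gr.
  by have := r0 t; nra.
have rg1 t : `|r t| <= 1 * (1 + `|g t|) by have := rg t; lra.
have mi := measurable_inv mg g1'.
have [L [sL Li hL LP]] := inverse_function_op pE mg g1'.
have mq : measurable_fun setT (fun t => r t / g t).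
  rewrite (_ : (fun t => _) = (fun t => r t * (1 / g t))); first exact: measurable_funM.
  by apply/funext => t; rewrite mul1r.
have q1 t : `|r t / g t| <= 1.
  by rewrite normrM normfV ler_pdivrMr ?mul1r// (lt_le_trans ltr01).
have i1 t : `|1 / g t| <= 1.
  by rewrite normrM normfV normr1 ler_pdivrMr ?mul1r// (lt_le_trans ltr01).
have [C sC hC] := bounded_function_op pE mq q1.
exists L, C; split=> //.
- move=> x u; rewrite -LP.
  have A1 x' y' : op_add A op_id (x', y') <-> local E (fun t => t + 1) x' y'.
    have m1 : measurable_fun setT (fun _ : R => 1 : R) by exact: measurable_cst.
    have m2 : measurable_fun setT (fun t : R => t + 1) by exact: measurable_funD.
    split=> [[y [z [/AE h zx yz]]]|h].
      move: zx yz; rewrite /op_id /graph_of /= => -> ->.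
      exact: (local_add pE mid m1 h (local_id1 pE _)).
    exists (y' - x'), x'; split; rewrite /= ?subrK//; apply/AE.
    have := local_sub pE m2 m1 h (local_id1 pE x'); congr local; apply/funext => t.
    by rewrite addrK.
  have m2 : measurable_fun setT (fun t : R => t + 1).
    by apply: measurable_funD => //; exact: measurable_cst.
  have ms : measurable_fun setT (@Num.sqrt R) by exact: mr.
  rewrite /op_sqrt (op_fun_compP _ _ pE m2 ms A1).
  have mC : measurable (~` `]-oo, (0 : R)[%classic) by apply: measurableC; exact: measurable_itv.
  have EC S y : measurable S -> E S y = E (S `&` ~` `]-oo, (0 : R)[%classic) y.
    move=> mS; rewrite -pvm_setI//; congr (E S _).
    rewrite -[LHS](pvm_setT pE) -(setUv `]-oo, (0 : R)[%classic).
    by rewrite (pvm_setU pE _ (measurable_itv _) mC (setICr _)) neg add0r.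
  have eqfg f1 f2 : (forall t, 0 <= t -> f1 t = f2 t) -> local E f1 x u -> local E f2 x u.
    move=> e h S v d mS hS; rewrite !(EC S)//; apply: h; first exact: measurableI.
    move=> t [St /=]; rewrite in_itv/= => /negP; rewrite -leNgt => t0.
    by rewrite e//; exact: hS.
  by split; apply: eqfg => t t0; rewrite /g /= max_l.
- move=> x y; rewrite /op_sqrt (op_funP pE _ _ mr AE); split=> [h|[u -> ->]].
    have [u hu] := local_exists_le pE mg mr ler01 h gr1.
    exists u; first exact/LP.
    exact: (local_unique pE mq (local_quot pE mg mr g1' rg hu h) (hC u)).
  have hu := (LP _ u).2 erefl.
  have [y' hy] := local_exists_le pE mr mg ler01 hu rg1.
  by rewrite -(local_unique pE mq (local_quot pE mg mr g1' rg hu hy) (hC u)).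
- move=> u.
  have h1 := local_mul pE mq mq ler01 q1 (hC u) (hC (C u)).
  have h2 := local_mul pE mi mi ler01 i1 (hL u) (hL (L u)).
  have m1 : measurable_fun setT (fun t => r t / g t * (r t / g t)) by exact: measurable_funM.
  have m2 : measurable_fun setT (fun t => 1 / g t * (1 / g t)) by exact: measurable_funM.
  have := local_add pE m1 m2 h1 h2.
  rewrite (_ : (fun t => _) = fun=> 1); last first.
    apply/funext => t; have g0 : g t != 0 by rewrite gt_eqF// (lt_le_trans ltr01).
    apply: (mulfI (_ : g t ^+ 2 != 0)); first by rewrite expf_neq0.
    rewrite mulr1 [RHS]gr; field; exact: g0.
  move=> h; apply: (local_unique pE _ h (local_id1 pE u)); exact: measurable_cst.
- move=> J sJ JJ JA u.
  have nJ w : nm (J w) = nm w by rewrite /nm (adj_ip _ _ sJ) JJ.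
  have JE := spectral_comm pE AE sJ JA.
  split.
    exact: (local_unique pE mi (local_isometry sJ nJ JE (hL u)) (hL (J u))).
  exact: (local_unique pE mq (local_isometry sJ nJ JE (hC u)) (hC (J u))).
Qed.

(** S = sgn B and M = |B + S|^(-1/2), so that S M^2 inverts B + S. *)
Lemma sign_factor B (s : R) : selfadjoint B -> s = -1 \/ s = 1 -> exists S M, [/\
  [/\ sa S, sa M & inj0 M],
  (forall x, S (S x) = x) /\ (forall x, S (M x) = M (S x)),
  (forall x y, op_sgn s B (x, y) <-> y = S x) /\
  (forall x y, B (x, y) <-> x = S (M (M (y + S x)))),
  (forall x y, op_abs (op_add B (op_sgn s B)) (x, y) <-> x = M (M y)) &
  (forall x, dom (op_sqrt (op_abs B)) x <-> exists u, x = M u)].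
Proof.
move=> sB s1; have [E pE hE] := spectral_theorem sB.
have /(spectral_measureP _ pE) BE := hE.
have mid : measurable_fun setT (@id R) by exact: measurable_id.
set sg := unitary_sign s; have msg : measurable_fun setT sg by exact: measurable_unitary_sign.
have sg1 t : `|sg t| <= 1 by rewrite /sg norm_unitary_sign.
pose f t := t + sg t; have mf : measurable_fun setT f by exact: measurable_funD.
have fE t : `|f t| = `|t| + 1 by exact: norm_add_unitary_sign.
have f1 t : 1 <= `|f t| by rewrite fE lerDr.
have mnorm : measurable_fun setT (fun t : R => `|t|) by exact: normr_measurable.
have maf : measurable_fun setT (fun t => `|f t|) by exact: measurableT_comp.
have af1 t : 1 <= `| `|f t| | by rewrite normr_id.
pose g t := Num.sqrt `|f t|; have mg : measurable_fun setT g by exact: measurable_sqrt.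
have g1 t : 1 <= g t by rewrite -[leLHS]sqrtr1 ler_wsqrtr.
have g1' t : 1 <= `|g t| by rewrite ger0_norm// ltW// (lt_le_trans ltr01).
have i1 t : `|1 / g t| <= 1.
  by rewrite normrM normfV normr1 ler_pdivrMr ?mul1r// (lt_le_trans ltr01).
have mi := measurable_inv mg g1'.
have [S sS hS] := bounded_function_op pE msg sg1.
have [M [sM Mi hM MP]] := inverse_function_op pE mg g1'.
have [T [sT Ti hT TP]] := inverse_function_op pE mf f1.
have [N [sN Ni hN NP]] := inverse_function_op pE maf af1.
have maf' := measurable_inv maf af1; have mf' := measurable_inv mf f1.
have mm t : 1 / g t * (1 / g t) = 1 / `|f t|.
  have g0 : g t != 0 by rewrite gt_eqF// (lt_le_trans ltr01).
  by rewrite -[`|f t|](@sqr_sqrtr R)// -/(g t); field.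
have MM u : N u = M (M u).
  have := local_mul pE mi mi ler01 i1 (hM u) (hM (M u)).
  rewrite (_ : (fun t => _) = fun t => 1 / `|f t|); last by apply/funext => t; exact: mm.
  exact: (local_unique pE maf' (hN u)).
have SN u : T u = S (M (M u)).
  have := local_mul pE maf' msg ler01 sg1 (hN u) (hS (N u)); rewrite -MM.
  rewrite (_ : (fun t => _) = fun t => 1 / f t); last first.
    by apply/funext => t; exact: unitary_sign_div.
  exact: (local_unique pE mf' (hT u)).
have SP x y : op_sgn s B (x, y) <-> y = S x.
  rewrite /op_sgn (op_funP pE _ _ msg BE); split=> [h|->]; last exact: hS.
  exact: (local_unique pE msg h (hS x)).
have BfP x y : B (x, y) <-> local E f x (y + S x).
  rewrite BE; split=> h; first exact: (local_add pE mid msg h (hS x)).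
  have := local_sub pE mf msg h (hS x); rewrite addrK; congr local.
  by apply/funext => t; rewrite /f addrK.
exists S, M; split => //.
- split=> x; last exact: (function_op_comm pE msg mi sg1 i1 hS hM).
  have := local_mul pE msg msg ler01 sg1 (hS x) (hS (S x)).
  rewrite (_ : (fun t => _) = fun=> 1); last by apply/funext => t; exact: sqr_unitary_sign.
  move=> h; apply: (local_unique pE _ h (local_id1 pE x)); exact: measurable_cst.
- by split=> // x y; rewrite BfP TP SN.
- have BS x y : op_add B (op_sgn s B) (x, y) <-> local E f x y.
    split=> [[y1 [z /= [/BfP + /SP -> ->]]]//|h].
    exists (y - S x), (S x); rewrite /= subrK; split => //; last exact/SP.
    by apply/BfP; rewrite subrK.
  by move=> x y; rewrite /op_abs (op_fun_compP _ _ pE mf mnorm BS) NP MM.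
- have aB x y : op_abs B (x, y) <-> local E (fun t => `|t|) x y by exact: op_funP.
  have ms : measurable_fun setT (@Num.sqrt R) by exact: measurable_sqrt.
  have msa : measurable_fun setT (fun t : R => Num.sqrt `|t|) by exact: measurable_sqrt.
  move=> x; split=> [[y]|[u xu]].
    rewrite /op_sqrt (op_fun_compP _ _ pE mnorm ms aB) => h.
    have [t|u hu] := local_exists_le pE mg msa ler01 h _; last by exists u; exact/MP.
    rewrite /g fE mul1r !(ger0_norm (sqrtr_ge0 _)).
    rewrite -(@ler_pXn2r _ 2) ?nnegrE ?sqrtr_ge0 ?addr_ge0 ?sqrtr_ge0//.
    have e1 : Num.sqrt (`|t| + 1) ^+ 2 = `|t| + 1 by rewrite sqr_sqrtr// addr_ge0.
    have e2 : Num.sqrt `|t| ^+ 2 = `|t| by rewrite sqr_sqrtr.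
    by rewrite e1 sqrrD e2; have := sqrtr_ge0 `|t|; lra.
  have hu := (MP _ _).2 xu.
  have [t|y hy] := local_exists_le pE msa mg ler01 hu _; last first.
    by exists y; rewrite /op_sqrt (op_fun_compP _ _ pE mnorm ms aB).
  rewrite /g fE mul1r !(ger0_norm (sqrtr_ge0 _)).
  have : Num.sqrt `|t| <= Num.sqrt (`|t| + 1) by rewrite ler_wsqrtr// lerDl.
  by lra.
Qed.

End FactorA.

(** * The form as a bounded operator *)

Section Forms.
Context (R : realType) (V : hilbertType R).
Implicit Types (x y z u w : V) (A B : op V) (b : sform V).

Lemma graph_sa (f : V -> V) : selfadjoint (graph_of f) -> sa f.
Proof.
move=> h x y.
by apply: (@selfadjoint_sym _ _ (graph_of f) x (f x) y (f y)).
Qed.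

Lemma commutes_withP A (J : V -> V) : linear_op A -> commutes_with J A ->
  forall x y, A (x, y) -> A (J x, J y).
Proof.
move=> [_ fA] h x y t; have [[y' t'] e] := h x (ex_intro _ y t).
have appA u v : A (u, v) -> app A u = v.
  by move=> tu; apply: op_appE => // v' tv; exact: fA tv tu.
by rewrite (appA _ _ t) (appA _ _ t') in e; rewrite e.
Qed.

(** L maps the whole space onto the domain of b, so that H stands for the form
    b + <., J .> without reference to a domain. *)
Definition represents b (L J H : V -> V) := forall u w,
  b (L u) (L w) + '[L u, J (L w)] = '[u, H w].

Section Reduce.
Variables (A : op V) (b : sform V) (L C : V -> V).
Hypotheses (sA : selfadjoint A) (sL : sa L) (Li : inj0 L) (sC : sa C).
Hypothesis A1L : forall x u, op_sqrt (op_add A op_id) (x, u) <-> x = L u.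
Hypothesis AL : forall x y, op_sqrt A (x, y) <-> exists2 u, x = L u & y = C u.
Hypothesis CL : forall u, C (C u) + L (L u) = u.
Hypothesis JLC : forall J, sa J -> (forall x, J (J x) = x) ->
  (forall x y, A (x, y) -> A (J x, J y)) ->
  forall u, J (L u) = L (J u) /\ J (C u) = C (J u).
Hypothesis fb : fdom b = dom (op_sqrt A).

Lemma dom_sqrtL u : dom (op_sqrt A) (L u).
Proof. by exists (C u); apply/AL; exists u. Qed.

Lemma app_sqrtL u : app (op_sqrt A) (L u) = C u.
Proof.
apply: op_appE; last by apply/AL; exists u.
by move=> y /AL [w /(inj0P sL Li) -> ->].
Qed.

Lemma app_sqrt1L u : app (op_sqrt (op_add A op_id)) (L u) = u.
Proof.
apply: op_appE; last exact/A1L.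
by move=> y /A1L /(inj0P sL Li) ->.
Qed.

Lemma ipCL u w : ip (C u) (C w) + ip (L u) (L w) = ip u w.
Proof. by rewrite (adj_ip _ _ sC) (adj_ip _ _ sL) -ipDr CL. Qed.

(** With P the projection (1 + J) / 2, which commutes with L and C, the diagonal
    blocks of C H C + J L^2 are at least a P and at most - a (1 - P), since
    C^2 + L^2 = 1 and a <= 1. *)
Lemma reduce_G : setting_G A b -> exists J H (a : R),
  [/\ sa J, sa H, 0 < a, forall x, a * nm x <= nm (H x) & represents b L J H].
Proof.
move=> [H [J [a /=]]] [[_ /graph_sa sH _] [[_ /graph_sa sJ JJ] cJ _ _] /andP[a0 a1] [hp hn] [_ hb]].
have JA := commutes_withP (selfadjoint_linear sA) cJ.
have JL u : J (L u) = L (J u) by have [] := JLC sJ JJ JA u.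
have JC u : J (C u) = C (J u) by have [] := JLC sJ JJ JA u.
pose K w := C (H (C w)) + J (L (L w)).
have sK : sa K.
  apply: sa_sum; first exact: sa_sandwich.
  by apply: (sa_comp sJ (sa_comp sL sL _)) => // x; rewrite !JL.
exists J, K, a; split => // [x|u w]; last first.
  rewrite hb ?fb; try exact: dom_sqrtL.
  by rewrite !app_sqrtL linearDr/= sC sL !JL.
pose P z := 2^-1 *: (z + J z).
have Pi z : J z = z -> P z = z.
  by move=> e; rewrite /P e -mulr2n -(scaler_nat 2 z) scalerA mulVf ?scale1r// pnatr_eq0.
have Pn z : J z = - z -> P z = 0 by move=> e; rewrite /P e subrr scaler0.
have half : (2^-1 : R[i]) = (2^-1)%:C%C by rewrite fmorphV /= rmorph_nat.
have hp' z : J z = z -> a * ip z z <= ip (H z) z.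
  move=> e; have := hp z; rewrite -/(P z) (Pi z e) -/(P (H z)) lecE => /andP[_].
  rewrite Re_realM -!/(ip _ _) /P half ipZl ipDl (adj_ip (H z) z sJ) e; lra.
have hn' z : J z = - z -> ip (H z) z <= - (a * ip z z).
  move=> e; have := hn z; rewrite -/(P z) (Pn z e) subr0 -/(P (H z)) lecE => /andP[_].
  rewrite -rmorphN Re_realM -!/(ip _ _) /P half ipDl ipNl ipZl ipDl (adj_ip (H z) z sJ) e ipNr; lra.
pose x1 := 2^-1 *r (x + J x); pose x2 := 2^-1 *r (x - J x).
have J1 : J x1 = x1 by rewrite /x1 (adjZ _ _ sJ) (adjD _ _ sJ) JJ addrC.
have J2 : J x2 = - x2 by rewrite /x2 (adjZ _ _ sJ) (adjB _ _ sJ) JJ -scalerN opprB.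
have xE : x = x1 + x2 by apply: ip_inj => w; rewrite /x1 /x2 !ipE; field.
have JxE : J x = x1 - x2 by rewrite {1}xE (adjD _ _ sJ) J1 J2.
have o12 : ip x1 x2 = 0.
  have : ip (J x1) x2 = ip x1 (J x2) by rewrite (adj_ip _ _ sJ).
  by rewrite J1 J2 ipNr; lra.
have k1 : a * ip x1 x1 <= ip (K x1) x1.
  rewrite /K ipDl (adj_ip _ _ sC) !JL (adj_ip _ _ sL) J1 -(ipCL x1 x1).
  have := hp' (C x1); rewrite JC J1 => /(_ erefl); have := ip_ge0 (L x1); nra.
have k2 : ip (K x2) x2 <= - (a * ip x2 x2).
  rewrite /K ipDl (adj_ip _ _ sC) !JL (adj_ip _ _ sL) J2 (adjN _ sL) ipNl -(ipCL x2 x2).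
  have := hn' (C x2); rewrite JC J2 (adjN _ sC) => /(_ erefl); have := ip_ge0 (L x2); nra.
clearbody x1 x2.
have key : a * ip x x <= ip (K x) (J x).
  have -> : ip (K x) (J x) = ip (K x1) x1 - ip (K x2) x2.
    clearbody K; rewrite JxE xE (adjD _ _ sK) !ipE (adj_ip x2 x1 sK) (ipC x2 (K x1)); ring.
  have -> : ip x x = ip x1 x1 + ip x2 x2 by rewrite xE pythagoras.
  by lra.
have nJ : nm (J x) = nm x by rewrite /nm (adj_ip _ _ sJ) JJ.
have := le_trans key (ip_le _ _); rewrite nJ -nm2 expr2 mulrA.
have [x0 _|x0] := leP (nm x) 0.
  by apply: le_trans (nm_ge0 _); rewrite pmulr_rle0.
by rewrite ler_pM2r.
Qed.

(** <J x, W x> is imaginary for W anticommuting with J, whence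
    |(J + W) x|^2 = |x|^2 + |W x|^2. *)
Lemma reduce_O : setting_O A b -> exists J H (a : R),
  [/\ sa J, sa H, 0 < a, forall x, a * nm x <= nm (H x) & represents b L J H].
Proof.
move=> [J [v [beta]]] [[[_ /graph_sa sJ JJ] cJ] [[[sv vl vr] vs] Av] hbeta vJ [_ hb]].
have JA := commutes_withP (selfadjoint_linear sA) cJ.
have JL u : J (L u) = L (J u) by have [] := JLC sJ JJ JA u.
have JC u : J (C u) = C (J u) by have [] := JLC sJ JJ JA u.
have vd u : fdom v (L u) by apply: Av; exact: dom_sqrtL.
pose t u w := complex.Re (v (L u) (L w)).
have tC u w : t u w = t w u by rewrite /t vs//; case: (v _ _).
have tP (r : R) x y w : t (r *r x + y) w = r * t x w + t y w.
  by rewrite /t (adj_linear sL) vl// raddfD/= Re_realM.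
pose k := `|beta| + 1; have k0 : 0 < k by rewrite ltr_wpDl.
have tb u : `|t u u| <= k * ip u u.
  have := hbeta (L u) (dom_sqrtL u); rewrite app_sqrt1L normE2 -rmorphM/= => h.
  have h1 : `|t u u| <= complex.Re `|v (L u) (L u)|.
    rewrite /t normc_def/= -[X in `|X|]/(complex.Re _); case: (v _ _) => p q /=.
    by rewrite -sqrtr_sqr ler_wsqrtr// lerDl sqr_ge0.
  apply: le_trans h1 _; move: h; rewrite lecE/= => /andP[_ h]; apply: le_trans h _.
  rewrite ler_wpM2r ?ip_ge0// /k; have := ler_norm beta; lra.
have t0 w : t 0 w = 0.
  by have := tP (-1) 0 0 w; rewrite scaler0 addr0; lra.
(* The bound on the quadratic form of t bounds t itself, by polarization with the
   optimal factor r. *)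
have tsq u w : t u w ^+ 2 <= k ^+ 2 * ip w w * ip u u.
  have [u0|un] := eqVneq (ip u u) 0.
    by rewrite (ip_eq0 u0) t0 ip0l mulr0 expr0n.
  have up : 0 < ip u u by rewrite lt_neqAle eq_sym un ip_ge0.
  have h (r : R) : 2 * r * t u w <= k * (r ^+ 2 * ip u u + ip w w).
    have e1 : t (r *r u + w) (r *r u + w) = r ^+ 2 * t u u + 2 * r * t u w + t w w.
      rewrite tP !(tC _ (r *r u + w)) !tP (tC w u); ring.
    have e2 : t (r *r u + -1 *r w) (r *r u + -1 *r w) = r ^+ 2 * t u u - 2 * r * t u w + t w w.
      have e3 y z : t (-1 *r y) z = - t y z.
        by have := tP (-1) y 0 z; rewrite addr0 t0; lra.
      by rewrite tP e3 !(tC _ (r *r u + _)) !tP !e3 (tC w u); ring.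
    have := tb (r *r u + w); have := tb (r *r u + -1 *r w).
    rewrite e1 e2 !ipE (ipC w u) !ler_norml => /andP[? ?] /andP[? ?]; lra.
  have := h (t u w / (k * ip u u)).
  have ku : k * ip u u != 0 by rewrite mulf_neq0 ?gt_eqF.
  have -> : 2 * (t u w / (k * ip u u)) * t u w = 2 * (t u w ^+ 2 / (k * ip u u)) by field; rewrite gt_eqF// gt_eqF.
  have -> : k * ((t u w / (k * ip u u)) ^+ 2 * ip u u + ip w w) = t u w ^+ 2 / (k * ip u u) + k * ip w w.
    by field; rewrite gt_eqF// gt_eqF.
  move=> h1; have : t u w ^+ 2 / (k * ip u u) <= k * ip w w by lra.
  rewrite ler_pdivrMr ?mulr_gt0// => h2; apply: le_trans h2 _.
  by rewrite le_eqVlt; apply/orP; left; apply/eqP; ring.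
have /choice[W hW] : forall w, exists w', forall u, t u w = ip u w'.
  move=> w; have [|||||w' [_ hw']] := @riesz _ _ setT (t^~ w) (k ^+ 2 * ip w w).
  - by [].
  - by [].
  - by move=> r x y _ _; rewrite tP.
  - by rewrite mulr_ge0 ?sqr_ge0 ?ip_ge0.
  - by move=> x _; exact: tsq.
  - by exists w' => u; exact: hw'.
have WE u w : '[u, W w] = v (L u) (L w).
  have e : t ('i%C *: u) w = - complex.Im (v (L u) (L w)).
    rewrite /t (adjZ _ _ sL); have := vl 'i%C (L u) 0 (L w) (vd u).
    have f0 : fdom v 0 by rewrite -(adj0 sL).
    have -> : v ('i%C *: L u) (L w) = 'i%C * v (L u) (L w).
      have := vl 'i%C (L u) 0 (L w) (vd u) f0 (vd w); rewrite addr0 => ->.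
      have := vl 1 0 0 (L w) f0 f0 (vd w); rewrite scaler0 addr0 mul1r -[LHS]addr0 => /addrI <-.
      by rewrite addr0.
    by move=> _; case: (v _ _) => p q /=; rewrite mul0r mul1r sub0r.
  rewrite innerE ip_i -!hW e opprK /t; by case: (v _ _).
have sW : sa W.
  by move=> u w; rewrite innerC !WE [in RHS]vs.
have WJ w : W (J w) = - J (W w).
  apply: inner_inj => u; rewrite WE linearNr/= -sJ WE -!JL.
  by rewrite vJ; try exact: dom_sqrtL; rewrite opprK.
pose H w := J w + W w.
have sH : sa H by exact: sa_sum.
exists J, H, 1; split => // [x|u w]; last first.
  rewrite hb ?fb; try exact: dom_sqrtL.
  rewrite JL !app_sqrtL linearDr/= WE addrAC; congr (_ + _).
  by rewrite sC sL -linearDr/= CL.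
rewrite mul1r -(@ler_pXn2r _ 2) ?nnegrE ?nm_ge0// !nm2.
have nJ : ip (J x) (J x) = ip x x by rewrite (adj_ip _ _ sJ) JJ.
have o : ip (J x) (W x) = 0.
  have : ip (J x) (W x) = - ip (W x) (J x).
    by rewrite (adj_ip _ _ sJ) (adj_ip _ _ sW) WJ ipNr opprK.
  by rewrite (ipC (W x)); lra.
by rewrite /H pythagoras// nJ lerDl ip_ge0.
Qed.

End Reduce.
End Forms.

(** * The operator of the form in factored form *)

Section Associated.
Context (R : realType) (V : hilbertType R).
Variables (b : sform V) (B : op V) (L J H S M : V -> V) (a : R).
Hypotheses (sL : sa L) (sJ : sa J) (sH : sa H) (sS : sa S) (sM : sa M).
Hypotheses (a0 : 0 < a) (ha : forall x, a * nm x <= nm (H x)).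
Hypotheses (SM : forall x, S (M x) = M (S x)).
Hypothesis rep : represents b L J H.
Hypothesis domL : forall x, fdom b x <-> exists u, x = L u.
Hypothesis aB : associated_op b B.
Hypothesis BP : forall x y, B (x, y) <-> x = S (M (M (y + S x))).

(** T := S M^2 inverts B + S, and T0 := L H^-1 L inverts B + J.  With D := S - J
    this reads T0 - T = T D T0 = T0 D T; hence
    T = T0 - T0 D T0 + T0 D T D T0, in which every term starts and ends with L.
    The inverse of the operator between the two factors L is H + L D L. *)
Lemma sandwich_factor : exists F G, [/\ sa F, sa G, forall x, F (G x) = x,
  forall x, G (F x) = x & forall x, S (M (M x)) = L (F (L x))].
Proof.
have [Q [sQ HQ QH]] := sa_inverse sH a0 ha.
have [sB dB hB] := aB.
pose T x := S (M (M x)); have sT : sa T.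
  apply: (sa_comp sS (sa_comp sM sM _)) => // x; by rewrite !SM.
pose D x := S x - J x; have sD : sa D by exact: sa_sub.
pose T0 x := L (Q (L x)); have sT0 : sa T0 by exact: (sa_sandwich sL sQ).
have BT0 z : B (T0 z, z - J (T0 z)).
  apply: (selfadjoint_mem sB) => u v uv.
  have du : dom B u by exists v.
  have av : app B u = v.
    have [_ fB] := selfadjoint_linear sB.
    by apply: op_appE => // v' uv'; exact: fB uv' uv.
  have [p up] := (domL u).1 (dB _ du).
  rewrite innerC [RHS]innerC; congr (_^*)%C.
  have dT : fdom b (T0 z) by apply/domL; exists (Q (L z)).
  rewrite -{1}av -hB// linearBl/= {2}up -(sL z p) sJ {1 2}up.
  have := rep (Q (L z)) p; rewrite -/(T0 z) -(sH (Q (L z))) HQ => <-.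
  by rewrite addrK.
have TT0 z : T0 z = T (z + D (T0 z)).
  by have /BP := BT0 z; rewrite -/(T _) addrAC -addrA.
have T1 z : T z = T0 z - T (D (T0 z)) by rewrite {1}TT0 (adjD _ _ sT) addrK.
have T2 z : T z = T0 z - T0 (D (T z)).
  by apply: inner_inj => w; rewrite -sT T1 linearBl linearBr/= sT0 sT sD sT0.
have TE x : S (M (M x)) = T x by [].
clearbody T => {BT0 TT0}.
pose N x := L (D (L x)).
pose E1 x := N x - L (D (T (D (L x)))).
have sN : sa N by exact: (sa_sandwich sL sD).
have sE1 : sa E1.
  apply: sa_sub => //; exact: (sa_sandwich sL (sa_sandwich sD sT)).
pose F x := Q x - Q (E1 (Q x)); pose G x := H x + N x.
have sF : sa F by exact: (sa_sub sQ (sa_sandwich sQ sE1)).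
have sG : sa G by exact: sa_sum.
have NQ q : N (Q (E1 q)) = L (D (T (D (L q)))).
  rewrite /N -/(T0 _) /E1 /N.
  have -> : L (Q (L (D (L q)) - L (D (T (D (L q)))))) = T (D (L q)).
    by rewrite [RHS]T2 (adjB _ _ sQ) (adjB _ _ sL).
  by [].
have GF x : G (F x) = x.
  rewrite /G /F (adjB _ _ sH) !HQ (adjB _ _ sN) NQ /E1.
  by apply: ip_inj => w; rewrite !ipE; ring.
exists F, G; split => // x.
  by apply: inner_inj => w; rewrite -sF -sG GF.
rewrite TE [LHS]T2 T1 /F (adjB _ _ sL) -/(T0 x); congr (_ - _).
rewrite /E1 /N (adjB _ _ sD) (adjB _ _ sT0) (adjB _ _ sQ) (adjB _ _ sL).
by [].
Qed.

End Associated.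

(** * The statements as bounds *)

Section Parametrised.
Context (R : realType) (V : hilbertType R).
Implicit Types (x y : V).

Lemma norm_leE (k : R) x y : (`|y| <= k%:C%C * `|x|) = (nm y <= k * nm x).
Proof. by rewrite !normE -rmorphM/= lecR. Qed.

Section Graph.
Variables (T : op V) (f f' g g' : V -> V).
Hypotheses (ff : adj f f') (gg : adj g g') (fi : inj0 f).
Hypothesis TP : forall x y, T (x, y) <-> exists2 z, x = f z & y = g z.

Lemma linear_graph : linear_op T.
Proof.
split; [split|].
- by apply/TP; exists 0; rewrite ?(adj0 ff) ?(adj0 gg).
- move=> k [x y] [x' y'] /TP[z -> ->] /TP[z' -> ->]; apply/TP.
  by exists (k *: z + z'); rewrite ?(adj_linear ff) ?(adj_linear gg).
- by move=> x y w /TP[z -> ->] /TP[z' /(inj0P ff fi) -> ->].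
Qed.

Lemma bounded_graph : op_bounded T <->
  exists2 k, 0 <= k & forall z, nm (g z) <= k * nm (f z).
Proof.
split=> [[_ [k hk]]|[k k0 hk]].
  exists `|k| => // z; have := hk (f z) (g z); rewrite norm_leE => h.
  apply: (le_trans (h _)); first by apply/TP; exists z.
  by rewrite ler_wpM2r ?nm_ge0 ?ler_norm.
split; first exact: linear_graph.
by exists k => x y /TP[z -> ->]; rewrite norm_leE.
Qed.

Lemma symmetric_graph : (forall y, exists u : nat -> V, cvs (fun n => f (u n)) y) ->
  (forall x y, '[g x, f y] = '[f x, g y]) -> symmetric_op T.
Proof.
move=> df gf; split; first exact: linear_graph.
  apply: dense_cvs => y; have [u uy] := df y; exists (fun n => f (u n)).
  by split=> // n; exists (g (u n)); apply/TP; exists (u n).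
by move=> [x y] /TP[z -> ->] x' y' /TP[z' -> ->] /=.
Qed.

End Graph.
End Parametrised.

Section Statements.
Context (R : realType) (V : hilbertType R).
Variables (A B : op V) (s : R) (L C S M F G : V -> V).
Hypotheses (sL : sa L) (sM : sa M) (sS : sa S) (sF : sa F) (sG : sa G).
Hypotheses (Li : inj0 L) (Mi : inj0 M).
Hypotheses (SS : forall x, S (S x) = x) (SM : forall x, S (M x) = M (S x)).
Hypotheses (FG : forall x, F (G x) = x) (GF : forall x, G (F x) = x).
Hypothesis SMM : forall x, S (M (M x)) = L (F (L x)).
Let sqrtA1 := op_sqrt (op_add A op_id).
Let sgnB := op_sgn s B.
Let absB1 := op_abs (op_add B sgnB).
Hypothesis A1P : forall x u, sqrtA1 (x, u) <-> x = L u.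
Hypothesis AP : forall x y, op_sqrt A (x, y) <-> exists2 u, x = L u & y = C u.
Hypothesis sgnP : forall x y, sgnB (x, y) <-> y = S x.
Hypothesis BP : forall x y, B (x, y) <-> x = S (M (M (y + S x))).
Hypothesis absP : forall x y, absB1 (x, y) <-> x = M (M y).

Let domX := [set y | exists2 x, dom B x & sqrtA1 (x, y)].
Let X := op_restrict
  (op_comp (op_inv sqrtA1) (op_comp absB1 (op_inv sqrtA1))) domX.
Let Y := op_restrict
  (op_comp sqrtA1 (op_comp (op_inv absB1) sqrtA1)) (dom (op_sqrt A)).
Let K := op_comp sqrtA1 (op_comp sgnB (op_inv sqrtA1)).

Lemma MML z : M (M z) = L (F (L (S z))).
Proof. by rewrite -SMM SM SM SS. Qed.

Lemma LFL z : L (F (L z)) = M (M (S z)).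
Proof. by rewrite MML SS. Qed.

Lemma FL_inj0 : inj0 (F \o L).
Proof. by move=> z /= h; apply: Li; rewrite -[L z]GF h (adj0 sG). Qed.

Lemma dom_sqrtP x : dom (op_sqrt A) x <-> exists u, x = L u.
Proof.
split=> [[y /AP[u -> _]]|[u ->]]; first by exists u.
by exists (C u); apply/AP; exists u.
Qed.

Lemma domXP y : domX y <-> exists z, y = F (L z).
Proof.
split=> [[x [w /BP + /A1P xE]]|[z ->]].
  by rewrite SMM xE => /(inj0P sL Li) ->; eexists.
exists (L (F (L z))); last exact/A1P.
by exists (z - S (L (F (L z)))); apply/BP; rewrite subrK SMM.
Qed.

(** M^2 maps S z to L F L z, so that the inverse of M^2 maps L (F L z) to S z. *)
Lemma XP x y : X (x, y) <-> exists2 z, x = (F \o L) z & y = (L \o S) z.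
Proof.
split=> [[[y1 [[y2 [/A1P /= -> /absP e]] /A1P /= ->]] /domXP[z /= xE]]|[z -> ->]].
  exists z => //=; congr L; apply: (inj0P sM Mi); apply: (inj0P sM Mi).
  by rewrite -e xE LFL.
split; last by apply/domXP; exists z.
exists (S z); split; last exact/A1P.
by exists (L (F (L z))); split; [exact/A1P | apply/absP; rewrite LFL].
Qed.

Lemma YP x y : Y (x, y) <-> exists2 z, x = L z & y = (F \o (L \o S)) z.
Proof.
split=> [[[y1 [[z [/A1P /= -> /absP /= ->]] /A1P /= e]] _]|[z -> ->]].
  by move: e; rewrite MML => /(inj0P sL Li) <-; exists z.
split; last by apply/dom_sqrtP; exists z.
exists (M (M z)); split; last by apply/A1P; rewrite MML.
by exists z; split; [exact/A1P | exact/absP].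
Qed.

Lemma KP x y : K (x, y) <-> S (L x) = L y.
Proof.
split=> [[y1 [[y2 [/A1P /= -> /sgnP ->]] /A1P //]]|e].
exists (S (L x)); split; last exact/A1P.
by exists (L x); split; [exact/A1P | exact/sgnP].
Qed.

Lemma subrangeP f g : subrange f g <->
  [set x | exists u, x = f u] `<=` [set x | exists u : V, x = g u].
Proof.
split=> [h _ [u ->]|h u]; first by have [z ->] := h u; exists z.
exact: (h (f u) (ex_intro _ u erefl)).
Qed.

Lemma X_sign_bound : [/\ dom X = domX, op_bounded X & symmetric_op X] <-> sign_bound L S.
Proof.
have FL := adj_comp sF sL; have LS := adj_comp sL sS.
have dX : dom X = domX.
  apply/seteqP; split=> [x [y /XP[z -> _]]|x /domXP[z ->]]; first by apply/domXP; exists z.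
  by exists (L (S z)); apply/XP; exists z.
have sX : symmetric_op X.
  apply: (symmetric_graph FL LS FL_inj0 XP) => [y|x y].
    have [u uy] := sa_dense_range sL Li (G y).
    by exists u; rewrite -[y]FG; exact: cvs_adj sF uy.
  by rewrite LS FL /= LFL -MML !SM SS.
have [CF CF0 hF] := adj_bounded sF; have [CG CG0 hG] := adj_bounded sG.
have bX := bounded_graph FL LS FL_inj0 XP.
split=> [[_ /bX[k k0 hk] _]|[k k0 hk]]; last first.
  split => //; apply/bX; exists (k * CG) => [|z /=]; first exact: mulr_ge0.
  apply: le_trans (hk _) _; rewrite -mulrA ler_wpM2l//.
  by have := hG (F (L z)); rewrite GF.
exists (k * CF) => [|z]; first exact: mulr_ge0.
by apply: le_trans (hk _) _; rewrite -mulrA ler_wpM2l//= hF.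
Qed.

Lemma Y_sign_bound :
  [/\ dom Y = dom (op_sqrt A), op_bounded Y & symmetric_op Y] <-> sign_bound L S.
Proof.
have FLS := adj_comp sF (adj_comp sL sS).
have dY : dom Y = dom (op_sqrt A).
  apply/seteqP; split=> [x [y /YP[z -> _]]|x /dom_sqrtP[z ->]].
    by apply/dom_sqrtP; exists z.
  by exists (F (L (S z))); apply/YP; exists z.
have sY : symmetric_op Y.
  apply: (symmetric_graph sL FLS Li YP) => [|x y]; first exact: sa_dense_range.
  by rewrite FLS sL /= LFL -MML !SM SS.
have [CF CF0 hF] := adj_bounded sF; have [CG CG0 hG] := adj_bounded sG.
have bY := bounded_graph sL FLS Li YP.
split=> [[_ /bY[k k0 hk] _]|[k k0 hk]]; last first.
  split => //; apply/bY; exists (CF * k) => [|z /=]; first exact: mulr_ge0.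
  by apply: le_trans (hF _) _; rewrite -mulrA ler_wpM2l.
exists (CG * k) => [|z]; first exact: mulr_ge0.
rewrite -[L (S z)]GF; apply: le_trans (hG _) _.
by rewrite -mulrA ler_wpM2l//; exact: hk.
Qed.

(** K is defined everywhere when S maps the range of L into itself, and in this
    case it is bounded by [subrange_factor]. *)
Lemma K_sign_bound : (everywhere_bounded K /\ op_comp K K = op_id) <-> sign_bound L S.
Proof.
rewrite (sign_boundP sL sS); split=> [[[_ dK] _] y|h].
  have [w /KP] : dom K y by rewrite dK.
  by exists w.
have [W [k [hW k0 kW]]] := subrange_factor (adj_comp sS sL) sL Li h.
have KW x y : K (x, y) <-> exists2 z, x = z & y = W z.
  split=> [/KP|[_ <- ->]]; last by apply/KP; rewrite -hW.
  by rewrite -[S _]/((S \o L) x) hW => /(inj0P sL Li) <-; exists x.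
split; [split|].
- split; last by exists k => x y /KW[_ <- ->]; rewrite norm_leE.
  split; [split|].
  + by apply/KP; rewrite (adj0 sL) (adj0 sS).
  + move=> a [x y] [x' y'] /KP e /KP e'; apply/KP.
    by rewrite !(adj_linear sL) (adj_linear sS) e e'.
  + by move=> x y z /KW[_ <- ->] /KW[_ <- ->].
- by apply/seteqP; split=> // x _; exists (W x); apply/KW; exists x.
apply/seteqP; split=> [[x z] [y [/KP e /KP e']]|[x z] xz].
  by apply: (inj0P sL Li); rewrite -e' -e SS.
have {z xz}-> : z = x by exact: xz.
exists (W x); split; first by apply/KW; exists x.
by apply/KP; rewrite -hW /= SS.
Qed.

Lemma app_sgn x : app sgnB x = S x.
Proof. by apply: op_appE => [y /sgnP|]; last exact/sgnP. Qed.

Lemma sign_equiv (absB : set V) : (forall x, absB x <-> exists u, x = M u) ->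
  [<-> absB = dom (op_sqrt A);
       dom (op_sqrt A) `<=` absB;
       absB `<=` dom (op_sqrt A);
       [/\ dom X = domX, op_bounded X & symmetric_op X];
       [/\ dom Y = dom (op_sqrt A), op_bounded Y & symmetric_op Y];
       everywhere_bounded K /\ op_comp K K = op_id;
       forall x, dom (op_sqrt A) x -> dom (op_sqrt A) (app sgnB x)].
Proof.
move=> aP.
have dE : dom (op_sqrt A) = [set x | exists u, x = L u] by apply/seteqP; split=> x /dom_sqrtP.
have aE : absB = [set x | exists u, x = M u] by apply/seteqP; split=> x /aP.
have ML := rangeML sL sM sS sG Li SM GF SMM.
have LM := rangeLM sL sM sS sF Mi SS SM SMM.
have sLM := sign_rangeLM sL sM sS sF Mi SS SM SMM.
have bML := rangeML_sign sL sM sS sF SS SMM.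
have h1 : dom (op_sqrt A) `<=` absB <-> sign_bound L S.
  rewrite dE aE -subrangeP; split=> [/sLM//|/bML/ML//].
have h2 : absB `<=` dom (op_sqrt A) <-> sign_bound L S.
  rewrite dE aE -subrangeP; split=> [/ML/sLM//|/bML//].
have h0 : absB = dom (op_sqrt A) <-> sign_bound L S.
  split=> [e|h]; first by apply/h1; rewrite e.
  by apply/seteqP; split; [apply/h2 | apply/h1].
have h6 : (forall x, dom (op_sqrt A) x -> dom (op_sqrt A) (app sgnB x)) <-> sign_bound L S.
  rewrite (sign_boundP sL sS); split=> [h y|h x /dom_sqrtP[y ->]].
    have /h : dom (op_sqrt A) (L y) by apply/dom_sqrtP; exists y.
    by rewrite app_sgn => /dom_sqrtP.
  by rewrite app_sgn; apply/dom_sqrtP; exact: h.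
tfae.
- by move/h0/h1.
- by move/h1/h2.
- by move/h2/X_sign_bound.
- by move/X_sign_bound/Y_sign_bound.
- by move/Y_sign_bound/K_sign_bound.
- by move/K_sign_bound/h6.
- by move/h6/h0.
Qed.

End Statements.

Theorem theorem3p8 (R : realType) (V : hilbertType R) (A B : op V) (b : sform V)
    (s : R) :
  selfadjoint A -> op_ge0 A ->
  is_symmetric_form b -> fdom b = dom (op_sqrt A) ->
  setting_G A b \/ setting_O A b ->
  associated_op b B ->
  s = -1 \/ s = 1 ->
  let sqrtA := op_sqrt A in
  let sqrtA1 := op_sqrt (op_add A op_id) in
  let sgnB := op_sgn s B in
  let absB1 := op_abs (op_add B sgnB) in
  let domX := [set y | exists2 x, dom B x & sqrtA1 (x, y)] in
  let X := op_restrict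
    (op_comp (op_inv sqrtA1) (op_comp absB1 (op_inv sqrtA1))) domX in
  let Y := op_restrict
    (op_comp sqrtA1 (op_comp (op_inv absB1) sqrtA1)) (dom sqrtA) in
  let K := op_comp sqrtA1 (op_comp sgnB (op_inv sqrtA1)) in
  [<-> dom (op_sqrt (op_abs B)) = dom sqrtA;
       dom sqrtA `<=` dom (op_sqrt (op_abs B));
       dom (op_sqrt (op_abs B)) `<=` dom sqrtA;
       [/\ dom X = domX, op_bounded X & symmetric_op X];
       [/\ dom Y = dom sqrtA, op_bounded Y & symmetric_op Y];
       everywhere_bounded K /\ op_comp K K = op_id;
       forall x, dom sqrtA x -> dom sqrtA (app sgnB x)].
Proof.
move=> sA A0 _ fb settings aB s1.
have [L [C [[sL Li sC] A1P AP CL JLC]]] := form_factor sA A0.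
have [sB _ _] := aB.
have [S [M [[sS sM Mi] [SS SM] [sgnP BP] absP dP]]] := sign_factor sB s1.
have [J [H [a [sJ sH a0 ha rep]]]] : exists J H (a : R),
    [/\ sa J, sa H, 0 < a, forall x, a * nm x <= nm (H x) & represents b L J H].
  case: settings => [hG|hO].
    exact: (reduce_G sA sL Li sC AP CL JLC fb hG).
  exact: (reduce_O sA sL Li sC A1P AP CL JLC fb hO).
have domL x : fdom b x <-> exists u, x = L u by rewrite fb; exact: dom_sqrtP.
have [F [G [sF sG FG GF SMM]]] :=
  sandwich_factor sL sJ sH sS sM a0 ha SM rep domL aB BP.
exact: (sign_equiv sL sM sS sF sG Li Mi SS SM FG GF SMM A1P AP sgnP BP absP dP).
Qed.
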